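(* Consider the fully dynamic 2-coloring problem for bipartite graphs on $n$ vertices: starting from the empty graph on $n$ vertices, a data structure must process an online sequence of operations $\mathsf{Insert}(u,v)$ (insert edge $\{u,v\}$), $\mathsf{Delete}(u,v)$ (delete edge $\{u,v\}$) and $\mathsf{getColor}(u)$ (report the color of $u$), where the graph is kept bipartite (an insertion creating an odd cycle is reported as a violation of bipartiteness), and the answers to $\mathsf{getColor}$ must form a proper 2-coloring of the current graph. In the cell-probe model, let $t_u$ be the update time (number of cell probes per update), $t_q$ the query time (number of cell probes per query), $t_R$ the number of cell writes during an update that modify a word storing the color of a vertex, and $t_D = t_u - t_R$. Then any such data structure satisfies $t_q \log\left(\frac{t_u}{t_q}\right) = \Omega(\log n)$ and $t_u \log\left(\frac{t_q}{t_u}\right) = \Omega(\log n)$; these bounds hold under amortization, non-deterministic queries and randomization, and even if the graph is a disjoint union of paths. Moreover, $\max\{t_D, t_R, t_q\} = \Omega(\log n)$.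
   Context: Cell-probe model: memory is organized into words; the cost of an operation is the number of words read or written. A proper 2-coloring assigns one of two colors to each vertex so that adjacent vertices get different colors.
   Formalization: Logarithms of the ratios are read as log2(2+x), since with the plain log the two bounds contradict each other; words are assumed to have O(log n) bits, since the claim fails for larger words; randomized structures may err with probability at most n^(-eps) per operation, for any fixed eps > 0. *)

(* Defs.v *)
From HB Require Import structures.
From mathcomp Require Import all_boot all_order all_algebra.
From mathcomp Require Import all_classical all_reals all_analysis.
From mathcomp Require Import measurable_realfun.

Set Implicit Arguments.
Unset Strict Implicit.
Unset Printing Implicit Defensive.

Import Order.TTheory GRing.Theory Num.Theory.

(** * Dynamic graphs on ['I_n] *)

(* The edge {u, v} is the two-element set [[set u; v]]. *)
Definition graph (n : nat) := {set {set 'I_n}}.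

Definition coloring (n : nat) := {ffun 'I_n -> bool}.

Definition proper (n : nat) (c : coloring n) (E : graph n) : bool :=
  [forall u, forall v, ([set u; v]%SET \in E) ==> (c u != c v)].

Definition bipartite (n : nat) (E : graph n) : bool :=
  [exists c : coloring n, proper c E].

Definition path_edges (n : nat) (p : seq 'I_n) : seq {set 'I_n} :=
  [seq [set e.1; e.2]%SET | e <- zip p (behead p)].

(* The sequences in [ps] are vertex-disjoint simple paths; vertices that occur
   in none of them are isolated, that is, trivial paths. *)
Definition path_union (n : nat) (E : graph n) : Prop :=
  exists ps : seq (seq 'I_n),
    uniq (flatten ps) /\ E = [set e in flatten (map (@path_edges n) ps)]%SET.

Variant graph_class := AllBipartite | PathUnions.

Definition in_class (cls : graph_class) (n : nat) (E : graph n) : Prop :=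
  match cls with
  | AllBipartite => bipartite E
  | PathUnions => path_union E
  end.

Variant update (n : nat) :=
  | Insert of 'I_n & 'I_n
  | Delete of 'I_n & 'I_n.

Variant operation (n : nat) :=
  | Update of update n
  | GetColor of 'I_n.

Arguments GetColor {n}.

Definition violates (n : nat) (E : graph n) (x : update n) : bool :=
  match x with
  | Insert u v => ~~ bipartite ([set u; v]%SET |: E)%SET
  | Delete _ _ => false
  end.

(* An insertion that violates bipartiteness leaves the graph unchanged. *)
Definition apply_update (n : nat) (E : graph n) (x : update n) : graph n :=
  match x with
  | Insert u v => if violates E x then E else ([set u; v]%SET |: E)%SET
  | Delete u v => (E :\ [set u; v]%SET)%SET
  end.

Definition admissible (n : nat) (E : graph n) (x : update n) : bool :=
  match x with
  | Insert u v => (u != v) && ([set u; v]%SET \notin E)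
  | Delete u v => [set u; v]%SET \in E
  end.

Fixpoint legal_from (cls : graph_class) (n : nat) (E : graph n)
    (ops : seq (operation n)) : Prop :=
  match ops with
  | [::] => True
  | Update x :: ops' =>
      [/\ admissible E x, in_class cls (apply_update E x)
        & legal_from cls (apply_update E x) ops']
  | GetColor _ :: ops' => legal_from cls E ops'
  end.

Definition legal (cls : graph_class) (n : nat) (ops : seq (operation n)) : Prop :=
  legal_from cls (finset.set0 : graph n) ops.

(* The answer to an update is its violation report. [c] is the coloring in
   force since the last update: all [GetColor] answers between two consecutive
   updates agree with one proper coloring of the current graph, and every
   update may change that coloring arbitrarily. *)
Fixpoint correct_from (n : nat) (E : graph n) (c : coloring n)
    (tr : seq (operation n * bool)) : Prop :=
  match tr with
  | [::] => True
  | (Update x, b) :: tr' =>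
      b = violates E x /\
      exists c' : coloring n, proper c' (apply_update E x) /\
        correct_from (apply_update E x) c' tr'
  | (GetColor u, b) :: tr' => b = c u /\ correct_from E c tr'
  end.

Definition correct_transcript (n : nat) (tr : seq (operation n * bool)) : Prop :=
  exists c : coloring n, proper c (finset.set0 : graph n) /\
    correct_from (finset.set0 : graph n) c tr.

Definition is_update (n : nat) (o : operation n) : bool :=
  if o is Update _ then true else false.

Definition num_updates (n : nat) (ops : seq (operation n)) : nat :=
  count (@is_update n) ops.

Definition num_queries (n : nat) (ops : seq (operation n)) : nat :=
  count (fun o => ~~ is_update o) ops.

(** * The cell-probe model *)

(* Memory cells hold [w]-bit words and are addressed by [w]-bit words. *)
Definition word (w : nat) := w.-tuple bool.

Definition memory (w : nat) := {ffun word w -> word w}.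

Definition store (w : nat) (M : memory w) (a x : word w) : memory w :=
  [ffun a' => if a' == a then x else M a'].

Inductive program (w : nat) (A : Type) : Type :=
  | Ret of A
  | Read of word w & (word w -> program w A)
  | Write of word w & word w & program w A.

Fixpoint value (w : nat) (A : Type) (p : program w A) (M : memory w) : A :=
  match p with
  | Ret r => r
  | Read a k => value (k (M a)) M
  | Write a x p' => value p' (store M a x)
  end.

Fixpoint final (w : nat) (A : Type) (p : program w A) (M : memory w) : memory w :=
  match p with
  | Ret _ => M
  | Read a k => final (k (M a)) M
  | Write a x p' => final p' (store M a x)
  end.

Fixpoint probes (w : nat) (A : Type) (p : program w A) (M : memory w) : nat :=
  match p with
  | Ret _ => 0
  | Read a k => (probes (k (M a)) M).+1
  | Write a x p' => (probes p' (store M a x)).+1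
  end.

(* Writes to a cell of [C] that change its contents. *)
Fixpoint modifications (w : nat) (A : Type) (C : pred (word w))
    (p : program w A) (M : memory w) : nat :=
  match p with
  | Ret _ => 0
  | Read a k => modifications C (k (M a)) M
  | Write a x p' => (C a && (x != M a)) + modifications C p' (store M a x)
  end.

(* Updates are deterministic and return a violation report. A query is
   nondeterministic: it has one thread for each guess in [G], and a thread
   either rejects ([None]) or accepts with a color. *)
Record data_structure (n w : nat) (G : finType) := DataStructure {
  init : memory w;
  update_program : update n -> program w bool;
  query_program : 'I_n -> G -> program w (option bool)
}.

(* A step of an execution: an update, or a query resolved by one thread. *)
Variant step (n : nat) (G : finType) :=
  | UpdateStep of update n
  | QueryStep of 'I_n & G.

Definition step_op (n : nat) (G : finType) (s : step n G) : operation n :=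
  match s with
  | UpdateStep x => Update x
  | QueryStep u _ => GetColor u
  end.

Definition step_answer (n w : nat) (G : finType) (D : data_structure n w G)
    (M : memory w) (s : step n G) : option bool :=
  match s with
  | UpdateStep x => Some (value (update_program D x) M)
  | QueryStep u g => value (query_program D u g) M
  end.

Definition step_final (n w : nat) (G : finType) (D : data_structure n w G)
    (M : memory w) (s : step n G) : memory w :=
  match s with
  | UpdateStep x => final (update_program D x) M
  | QueryStep u g => final (query_program D u g) M
  end.

Definition step_probes (n w : nat) (G : finType) (D : data_structure n w G)
    (M : memory w) (s : step n G) : nat :=
  match s with
  | UpdateStep x => probes (update_program D x) M
  | QueryStep u g => probes (query_program D u g) M
  end.

Definition step_modifications (n w : nat) (G : finType)
    (D : data_structure n w G) (C : pred (word w)) (M : memory w)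
    (s : step n G) : nat :=
  match s with
  | UpdateStep x => modifications C (update_program D x) M
  | QueryStep _ _ => 0
  end.

(* Each step paired with the memory in which it starts. *)
Fixpoint trace (n w : nat) (G : finType) (D : data_structure n w G)
    (M : memory w) (ss : seq (step n G)) : seq (memory w * step n G) :=
  if ss is s :: ss' then (M, s) :: trace D (step_final D M s) ss' else [::].

Section Executions.

Variables (n w : nat) (G : finType) (D : data_structure n w G).

Definition memory_after (ss : seq (step n G)) : memory w :=
  foldl (step_final D) (init D) ss.

Definition answers (ss : seq (step n G)) : seq (option bool) :=
  [seq step_answer D p.1 p.2 | p <- trace D (init D) ss].

(* No chosen thread rejects. *)
Definition accepted (ss : seq (step n G)) : bool := all isSome (answers ss).

Definition operations (ss : seq (step n G)) : seq (operation n) :=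
  map (@step_op n G) ss.

Definition transcript (ss : seq (step n G)) : seq (operation n * bool) :=
  zip (operations ss) (pmap id (answers ss)).

Definition total_probes (ss : seq (step n G)) : nat :=
  sumn [seq step_probes D p.1 p.2 | p <- trace D (init D) ss].

Definition total_modifications (C : pred (word w)) (ss : seq (step n G)) : nat :=
  sumn [seq step_modifications D C p.1 p.2 | p <- trace D (init D) ss].

(* Every choice of accepting threads yields correct answers, and every query
   that is reached has an accepting thread. *)
Definition correct_on (ops : seq (operation n)) : Prop :=
  (forall ss, operations ss = ops -> accepted ss ->
     correct_transcript (transcript ss)) /\
  (forall ss u ops', ops = operations ss ++ GetColor u :: ops' -> accepted ss ->
     exists g, accepted (rcons ss (QueryStep u g))).

(* The cell at address [a] stores the color of [v]: at all times the color that
   a query of [v] would report is a fixed function of the contents of the cell. *)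
Definition stores_color (cls : graph_class) (a : word w) (v : 'I_n) : Prop :=
  exists decode : word w -> bool,
    forall ss, legal cls (operations ss) -> accepted ss ->
    forall g b, value (query_program D v g) (memory_after ss) = Some b ->
      b = decode (memory_after ss a).

Definition color_cell (cls : graph_class) : pred (word w) :=
  fun a => `[< exists v, stores_color cls a v >].

End Executions.

(** * Randomized data structures and amortized expected costs *)

Local Open Scope ring_scope.

(* [X t] is the set of costs that may occur under the outcome [t]. When the
   largest of them is a measurable function of [t], this says that its
   expectation is at most [b]; in general it bounds the upper expectation. *)
Definition expectation_le (R : realType) (d : measure_display)
    (T : measurableType d) (P : probability T R) (X : T -> nat -> Prop) (b : R) :
    Prop :=
  exists f : T -> \bar R,
    [/\ measurable_fun [set: T]%classic f,
        (forall t, (0 <= f t)%E),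
        (forall t k, X t k -> ((k%:R : R)%:E <= f t)%E)
      & (\int[P]_t f t <= b%:E)%E].

(* A randomized data structure is a random variable [D] whose values are data
   structures, so that all operations share the random outcome; the operation
   sequence is fixed independently of it. *)
Section Randomized.

Variables (R : realType) (n w : nat) (G : finType) (cls : graph_class).
Variables (d : measure_display) (T : measurableType d) (P : probability T R).
Variable D : T -> data_structure n w G.

(* Error probability at most [delta] per operation. *)
Definition correct_with_error (delta : R) : Prop :=
  forall ops, legal cls ops ->
  exists2 B : set T, measurable B /\ (P B <= ((size ops)%:R * delta)%:E)%E
    & forall t, ~ B t -> correct_on (D t) ops.

(* Amortized expected update time [tu] and query time [tq]. *)
Definition amortized_time (tu tq : R) : Prop :=
  forall ops, legal cls ops ->
  expectation_le P
    (fun t k => exists ss, [/\ operations ss = ops, accepted (D t) ss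
                            & total_probes (D t) ss = k])
    (tu * (num_updates ops)%:R + tq * (num_queries ops)%:R).

(* At most [tR] modifications of color cells per update, amortized and
   expected. *)
Definition amortized_recoloring (tR : R) : Prop :=
  forall ops, legal cls ops ->
  expectation_le P
    (fun t k => exists ss,
       [/\ operations ss = ops, accepted (D t) ss
         & total_modifications (D t) (color_cell (D t) cls) ss = k])
    (tR * (num_updates ops)%:R).

End Randomized.

Definition log2 (R : realType) (x : R) : R := ln x / ln 2.

(* The logarithm of a ratio in a lower-bound trade-off, with the customary
   convention lg x = log2 (2 + x), so that lg x >= 1 for all x >= 0. With
   the plain logarithm one of lg (tu / tq) and lg (tq / tu) would never be
   positive, and the two bounds could not hold together. *)
Definition lg (R : realType) (x : R) : R := log2 (2 + x).

(* Main.v *)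
Require Import Defs.
From mathcomp Require Import all_boot all_fingroup zify.
From mathcomp Require boolp.

Set Implicit Arguments.
Unset Strict Implicit.
Unset Printing Implicit Defensive.

(** The lower bounds come from information transfer (Patrascu and Demaine),
    with nothing but color queries as tests. Braid [k] tracks through layers of
    permutations and back through the inverse permutations: each track then
    returns to its starting position, so the tracks can be joined into one
    Hamiltonian path without knowledge of the permutations. Its coloring is
    forced up to a global flip. Splicing one spare vertex before and one after
    the track [a] flips the colors of this track only; so among the [k] positions
    of a layer, exactly the one on the track [a] has the unexpected color, and
    one accepted query for that position carries [log k] bits about the
    composed permutation.

    In each round some layers receive fresh permutations, and then the positions
    of all tracks in some layers are verified. In the hierarchy of time
    intervals of branching factor about the ratio of the two time bounds, each
    interval together with the rest of its parent interval must transfer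
    information: the later queries determine the earlier permutations. The cells
    probed in both parts and their contents, together with a function that
    separates the cells probed only later from those probed only earlier, encode
    the permutations, because only the right candidate passes a simulated
    verification. Hence a constant fraction of the [k log k] bits per layer passes
    through common cells at every time scale, while each probe is charged to only
    one scale. Digit reversal interleaves updated and queried layers at all
    scales simultaneously. *)

(** * Probed cells and canonical executions *)

(** The branching factor [Dl] may cost only its logarithm. A child interval is paired with its
    earlier or later siblings, which may probe [Dl] times as many cells. A separator with [Dl]
    values that is [0] on the small side and nonzero on the large one costs [ln Dl] per cell of the
    small side but only about [1 / Dl] per cell of the large side, so the total stays [O(ln Dl)] per
    cell of the small side.

    Nondeterminism is the obstacle to simulation: a rejecting thread may probe any cell, so the
    decoder cannot discard it by running it. Only accepting threads are compared: each execution
    takes its first accepting thread, and two first accepting threads whose probes lie in commonly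
    known cells coincide.

    Randomization is removed by fixing one outcome under which few tests fail and the total cost is
    near its mean. Every pair of a test and a candidate, right or wrong, adds to the expected number
    of failures, so with error [n ^ -eps] the number of tracks and layers can only be a small power
    of [n].

    The bound on the maximum follows from the first trade-off, because
    [tq * ln (2 + tu / tq) <= tq + tu] and [tu = tD + tR]. *)

Fixpoint touched (w : nat) (A : Type) (p : program w A) (M : memory w) :
    seq (word w) :=
  match p with
  | Ret _ => [::]
  | Read a k => a :: touched (k (M a)) M
  | Write a x p' => a :: touched p' (store M a x)
  end.

Lemma size_touched (w : nat) (A : Type) (p : program w A) (M : memory w) :
  size (touched p M) = probes p M.
Proof. by elim: p M => //= [a k IH|a x p IH] M; rewrite IH. Qed.

Lemma final_untouched (w : nat) (A : Type) (p : program w A) (M : memory w) a :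
  a \notin touched p M -> final p M a = M a.
Proof.
elim: p M => //= [b k IH|b x p IH] M; rewrite inE negb_or => /andP[ab].
  by move/IH.
by move/IH->; rewrite ffunE (negPf ab).
Qed.

Definition agree (w : nat) (S : pred (word w)) (M M' : memory w) :=
  forall a, S a -> M a = M' a.

Lemma agree_sym w (S : pred (word w)) M M' : agree S M M' -> agree S M' M.
Proof. by move=> h a /h. Qed.

Lemma agree_run (w : nat) (A : Type) (S : pred (word w)) (p : program w A) M M' :
  agree S M M' -> all S (touched p M) ->
  [/\ touched p M' = touched p M, value p M' = value p M
    & agree S (final p M) (final p M')].
Proof.
elim: p M M' => //= [b k IH|b x p IH] M M' MM' /andP[Sb Sp].
  by rewrite -(MM' _ Sb); have [-> ->] := IH _ _ _ MM' Sp.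
have MM1 : agree S (store M b x) (store M' b x).
  by move=> a Sa; rewrite !ffunE; case: eqP => // _; apply: MM'.
by have [-> ->] := IH _ _ MM1 Sp.
Qed.

(** Each head satisfies the other predicate, so neither can precede the other. The predicates may
    disagree everywhere else, as the rejecting threads of two executions may. *)
Lemma ohead_filter_min (T : eqType) (P Q : pred T) (s : seq T) x y :
  ohead [seq z <- s | P z] = Some x -> ohead [seq z <- s | Q z] = Some y ->
  P y -> Q x -> x = y.
Proof.
elim: s => //= z s IH; case Pz: (P z); case Qz: (Q z) => //=.
- by move=> [<-] [<-].
- by move=> [<-] _ _; rewrite Qz.
- by move=> _ [<-]; rewrite Pz.
Qed.

Lemma ohead_filterP (T : eqType) (P : pred T) (s : seq T) x :
  ohead [seq z <- s | P z] = Some x -> P x.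
Proof. by elim: s => //= z s IH; case Pz: (P z) => //= -[<-]. Qed.

Lemma ohead_filter_ex (T : finType) (P : pred T) x :
  P x -> exists y, ohead [seq z <- enum T | P z] = Some y.
Proof.
move=> Px; have: x \in [seq z <- enum T | P z] by rewrite mem_filter Px mem_enum.
by case: [seq z <- _ | _] => //= y; exists y.
Qed.

Section Canonical.

Variables (n w : nat) (G : finType) (D : data_structure n w G).
Implicit Types (M : memory w) (o : operation n) (ops : seq (operation n)).
Implicit Types (s : step n G) (ss : seq (step n G)).

Definition step_touched M s : seq (word w) :=
  match s with
  | UpdateStep x => touched (update_program D x) M
  | QueryStep u g => touched (query_program D u g) M
  end.

Lemma size_step_touched M s : size (step_touched M s) = step_probes D M s.
Proof. by case: s => *; apply: size_touched. Qed.

Definition first_accept M (u : 'I_n) : option G :=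
  ohead [seq g <- enum G | value (query_program D u g) M].

Definition canonical_step M o : option (step n G) :=
  match o with
  | Update x => Some (UpdateStep G x)
  | GetColor u => omap (QueryStep u) (first_accept M u)
  end.

(* A query without accepting thread is skipped. *)
Fixpoint canonical_steps M ops : seq (step n G) :=
  if ops is o :: ops' then
    if canonical_step M o is Some s then s :: canonical_steps (step_final D M s) ops'
    else canonical_steps M ops'
  else [::].

Definition run M ops : memory w := foldl (step_final D) M (canonical_steps M ops).

Definition run_touched M ops : seq (word w) :=
  flatten [seq step_touched p.1 p.2 | p <- trace D M (canonical_steps M ops)].

Lemma canonical_cat M ops1 ops2 :
  canonical_steps M (ops1 ++ ops2) = canonical_steps M ops1 ++ canonical_steps (run M ops1) ops2.
Proof.
rewrite /run; elim: ops1 M => //= o ops IH M.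
by case: canonical_step => [s|] //=; rewrite IH.
Qed.

Lemma run_cat M ops1 ops2 : run M (ops1 ++ ops2) = run (run M ops1) ops2.
Proof. by rewrite /run canonical_cat foldl_cat. Qed.

Lemma trace_cat M ss1 ss2 :
  trace D M (ss1 ++ ss2) = trace D M ss1 ++ trace D (foldl (step_final D) M ss1) ss2.
Proof. by elim: ss1 M => //= s ss IH M; rewrite IH. Qed.

Lemma run_touched_cat M ops1 ops2 :
  run_touched M (ops1 ++ ops2) = run_touched M ops1 ++ run_touched (run M ops1) ops2.
Proof. by rewrite /run_touched canonical_cat trace_cat map_cat flatten_cat. Qed.

Lemma size_run_touched ops :
  size (run_touched (init D) ops) = total_probes D (canonical_steps (init D) ops).
Proof.
rewrite /run_touched /total_probes size_flatten /shape -map_comp.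
by congr sumn; apply: eq_map => p /=; apply: size_step_touched.
Qed.

Lemma step_final_untouched M s a :
  a \notin step_touched M s -> step_final D M s a = M a.
Proof. by case: s => *; apply: final_untouched. Qed.

Lemma run_untouched M ops a : a \notin run_touched M ops -> run M ops a = M a.
Proof.
rewrite /run_touched /run; move: (canonical_steps M ops) => ss; elim: ss M => //= s ss IH M.
by rewrite mem_cat negb_or => /andP[as_ /IH->]; apply: step_final_untouched.
Qed.

Lemma agree_step (S : pred (word w)) M M' s :
  agree S M M' -> all S (step_touched M s) ->
  [/\ step_touched M' s = step_touched M s, step_answer D M' s = step_answer D M s
    & agree S (step_final D M s) (step_final D M' s)].
Proof. by case: s => [x|u g] /= MM' St; have [-> ->] := agree_run MM' St. Qed.

Lemma agree_updates (S : pred (word w)) M M' (us : seq (update n)) :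
  agree S M M' -> all S (run_touched M [seq Update x | x <- us]) ->
  agree S (run M [seq Update x | x <- us]) (run M' [seq Update x | x <- us]).
Proof.
rewrite /run_touched /run; elim: us M M' => //= x us IH M M' MM'.
rewrite all_cat => /andP[Sx Sus].
by apply: IH => //; have [] := agree_step (s := UpdateStep G x) MM' Sx.
Qed.

End Canonical.

(** * Test queries and their simulation *)

Section Atoms.

Variables (n k w : nat) (G : finType) (D : data_structure n w G).
Variables (ref : 'I_n) (vx : nat -> 'I_k -> 'I_n) (par : nat -> bool).

(* [Test l b] asks for the colors of [ref] and of the [b]-th candidate of [l];
   it is passed when the two colors have the parity [par l], and only the right
   candidate passes. *)
Variant atom := Updates of seq (update n) | Test of nat & 'I_k.

Definition atom_ops (x : atom) : seq (operation n) :=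
  match x with
  | Updates us => [seq Update y | y <- us]
  | Test l b => [:: GetColor ref; GetColor (vx l b)]
  end.

Definition atoms_ops (xs : seq atom) : seq (operation n) := flatten (map atom_ops xs).

Lemma atoms_ops_cat xs ys : atoms_ops (xs ++ ys) = atoms_ops xs ++ atoms_ops ys.
Proof. by rewrite /atoms_ops map_cat flatten_cat. Qed.

(** The second query starts from the memory left by the first, since queries may write. The last
    clause covers all candidates and all accepting threads, so that a candidate taken from another
    execution can be refuted. *)
Definition test_ok (M : memory w) (l : nat) (b : 'I_k) : Prop :=
  exists g0 c0 g1,
    let M1 := final (query_program D ref g0) M in
    [/\ first_accept D M ref = Some g0,
        value (query_program D ref g0) M = Some c0,
        first_accept D M1 (vx l b) = Some g1
      & forall b' g c, value (query_program D (vx l b') g) M1 = Some c ->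
          (c0 (+) c == par l) = (b' == b)].

Fixpoint run_ok (M : memory w) (xs : seq atom) : Prop :=
  if xs is x :: xs' then
    (if x is Test l b then test_ok M l b else True) /\
    run_ok (run D M (atom_ops x)) xs'
  else True.

Lemma run_ok_cat M xs ys :
  run_ok M (xs ++ ys) <-> run_ok M xs /\ run_ok (run D M (atoms_ops xs)) ys.
Proof.
elim: xs M => [|x xs IH] M /=; first by split=> [|[]].
rewrite IH /atoms_ops /= run_cat.
by split=> [[? [? ?]]|[[? ?] ?]].
Qed.

(** What the decoder knows of the later operations in advance: the updates and the tested layers,
    but not the candidates. *)
Definition similar (x y : atom) : Prop :=
  match x, y with
  | Updates us, Updates vs => us = vs
  | Test l _, Test l' _ => l = l'
  | _, _ => False
  end.

Fixpoint all_similar (xs ys : seq atom) : Prop :=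
  match xs, ys with
  | [::], [::] => True
  | x :: xs', y :: ys' => similar x y /\ all_similar xs' ys'
  | _, _ => False
  end.

Lemma all_similar_cat xs ys xs' ys' :
  all_similar xs ys -> all_similar xs' ys' -> all_similar (xs ++ xs') (ys ++ ys').
Proof.
by elim: xs ys => [|x xs IH] [|y ys] //= [? ?] ?; split=> //; apply: IH.
Qed.

Lemma all_similar_map (I : Type) (f g : I -> atom) s :
  (forall i, similar (f i) (g i)) -> all_similar (map f s) (map g s).
Proof. by move=> h; elim: s => //= i s IH; split. Qed.

(* Two executions that agree on all the cells they probe ask for the same
   candidates: the candidate of the one passes in the other. *)
Lemma similar_eq (S : pred (word w)) M M' xs ys :
  all_similar xs ys -> agree S M M' -> run_ok M xs -> run_ok M' ys ->
  all S (run_touched D M (atoms_ops xs)) ->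
  all S (run_touched D M' (atoms_ops ys)) -> xs = ys.
Proof.
elim: xs ys M M' => [|x xs IH] [|y ys] M M' //= [xy sxy] MM' [okx okxs] [oky okys].
rewrite /atoms_ops /= -!/(atoms_ops _) !run_touched_cat !all_cat.
move=> /andP[Sx Sxs] /andP[Sy Sys].
suff [exy agr] : x = y /\ agree S (run D M (atom_ops x)) (run D M' (atom_ops y)).
  by rewrite exy in okxs Sxs agr *; congr cons; apply: IH sxy agr okxs okys Sxs Sys.
case: x y xy okx oky {okxs okys Sxs Sys} Sx Sy => [us|l b] [vs|l' b'] //=.
  by move=> <- _ _ Sx _; split=> //; apply: agree_updates.
move=> <- [g0 [c0 [g1 [f0 v0 f1 H1]]]] [g0' [c0' [g1' [f0' v0' f1' H1']]]].
set M1 := final _ _ in f1 H1; set M1' := final _ _ in f1' H1'.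
rewrite /run_touched /run /= f0 f0' /= -/M1 -/M1' f1 f1' /= !cats0 !all_cat.
move=> /andP[S0 S1] /andP[S0' S1'].
have a0 : value (query_program D ref g0) M by exact: ohead_filterP f0.
have a0' : value (query_program D ref g0') M' by exact: ohead_filterP f0'.
(* The thread chosen in each memory accepts in the other memory as well; both being first among the
   accepting threads, they coincide. *)
have [_ e0 _] := agree_run MM' S0.
have [_ e0' _] := agree_run (agree_sym MM') S0'.
have eg0 : g0 = g0'.
  by apply: (ohead_filter_min f0 f0'); rewrite /= ?e0 ?e0'.
subst g0'; have [_ _ MM1] := agree_run MM' S0; rewrite -/M1 -/M1' in MM1.
have ec0 : c0 = c0' by move: v0'; rewrite e0 v0 => -[].
subst c0'.
have a1 := ohead_filterP f1; have a1' := ohead_filterP f1'.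
have [_ e1 _] := agree_run MM1 S1.
have [_ e1' _] := agree_run (agree_sym MM1) S1'.
(* The thread chosen for [b] runs identically from [M1'], and there its color has the parity that
   only [b'] can have. *)
have ebb : b = b'.
  apply/eqP; case E: (value (query_program D (vx l b) g1) M1) => [c|]; last by rewrite E in a1.
  rewrite -(H1' b g1 c) ?e1 //.
  by rewrite (H1 b g1 c) // eqxx.
subst b'.
have eg1 : g1 = g1'.
  by apply: (ohead_filter_min f1 f1'); rewrite /= ?e1 ?e1'.
subst g1'; split=> //.
by have [_ _] := agree_run MM1 S1.
Qed.

End Atoms.

(** * Counting by separators *)

Lemma expn_card_prod (I : finType) (A : {set I}) (m : nat) :
  m ^ #|A| = \prod_i (if i \in A then m else 1).
Proof. by rewrite -big_mkcond prod_nat_const. Qed.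

Lemma card_fixed_ffun (I T : finType) (A : {set I}) (x0 : T) :
  #|[set X : {ffun I -> T} | [forall i in A, X i == x0]]| * #|T| ^ #|A| =
  #|T| ^ #|I|.
Proof.
pose F (i : I) : pred T := if i \in A then pred1 x0 else predT.
have -> : #|[set X : {ffun I -> T} | [forall i in A, X i == x0]]| = #|family F|.
  apply: eq_card => X; rewrite inE; apply/forall_inP/familyP => h i.
    by rewrite /F; case: ifP => // iA; rewrite inE h.
  by move=> iA; have := h i; rewrite /F iA inE.
rewrite card_family foldrE big_map big_enum /= expn_card_prod.
rewrite (_ : #|T| ^ #|I| = \prod_(i : I) #|T|); last by rewrite prod_nat_const.
rewrite -big_split /=; apply: eq_bigr => i _.
by rewrite /F; case: ifP => _; rewrite ?card1 ?mul1n ?muln1.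
Qed.

(** A uniform function with [Q.+1] values separates [A] from [B] with probability
    [(1 / Q.+1) ^ #|A| * (Q / Q.+1) ^ #|B|]; for large [Q] the set [B] is cheap. The statement is
    cleared of denominators. *)
Lemma card_separators (W : finType) (Q : nat) (A B : {set W}) :
  [disjoint A & B] ->
  #|[set h : {ffun W -> 'I_Q.+1} |
      [forall a in A, h a == ord0] && [forall a in B, h a != ord0]]|
    * Q.+1 ^ (#|A| + #|B|) = Q ^ #|B| * Q.+1 ^ #|W|.
Proof.
move=> dAB.
pose F (a : W) : pred 'I_Q.+1 :=
  if a \in A then pred1 ord0 else if a \in B then predC1 ord0 else predT.
have -> : #|[set h : {ffun W -> 'I_Q.+1} |
      [forall a in A, h a == ord0] && [forall a in B, h a != ord0]]| = #|family F|.
  apply: eq_card => X; rewrite inE; apply/andP/familyP => [[/forall_inP h1 /forall_inP h2] i|h].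
    rewrite /F; case: ifP => iA; first by rewrite inE h1.
    by case: ifP => // iB; rewrite inE h2.
  split; apply/forall_inP => i iA; have := h i; rewrite /F ?iA ?inE //.
  by rewrite ifN ?inE //; apply/negP => iA'; have := disjointFr dAB iA'; rewrite iA.
rewrite card_family foldrE big_map big_enum /= expnD !expn_card_prod.
rewrite (_ : Q.+1 ^ #|W| = \prod_(i : W) Q.+1); last by rewrite prod_nat_const.
rewrite -!big_split /=; apply: eq_bigr => i _; rewrite /F; case: ifP => iA.
  by rewrite (disjointFr dAB iA) card1 mul1n muln1 mul1n.
by case: ifP => iB; rewrite ?cardC1 ?card_ord ?mul1n ?muln1.
Qed.

(** A partial function with support at most [m.+1] arises from one with support at most [m] by
    setting at most one value, which gives one factor per cell. *)
Lemma card_small_codes (W C : finType) (m : nat) :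
  #|[set f : {ffun W -> option C} | #|[set a | f a != None]| <= m]|
    <= (#|W| * #|C|).+1 ^ m.
Proof.
elim: m => [|m IH].
  rewrite expn0 -(cards1 ([ffun=> None] : {ffun W -> option C})); apply: subset_leq_card.
  apply/subsetP => f; rewrite !inE leqn0 cards_eq0 => /eqP f0.
  by apply/eqP/ffunP => a; have := in_set0 a; rewrite -f0 inE ffunE => /negbFE/eqP.
pose upd (x : {ffun W -> option C} * option (W * C)) : {ffun W -> option C} :=
  if x.2 is Some (b, c) then [ffun a => if a == b then Some c else x.1 a] else x.1.
set S := [set f | _ <= m] in IH *.
apply: (@leq_trans #|upd @: (setX S [set: option (W * C)])|); last first.
  apply: leq_trans (leq_imset_card _ _) _.
  by rewrite cardsX cardsT card_option card_prod expnSr leq_mul2r IH orbT.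
apply: subset_leq_card; apply/subsetP => f; rewrite inE => fm.
case: (pickP (fun a => f a != None)) => [b fb|f0].
  case E: (f b) fb => [c|] // _.
  apply/imsetP; exists ([ffun a => if a == b then None else f a], Some (b, c)).
    rewrite !inE andbT -ltnS; apply: leq_trans fm.
    rewrite (cardsD1 b [set a | f a != None]) inE E /= add1n ltnS subset_leq_card //.
    by apply/subsetP => a; rewrite !inE ffunE; case: (a =P b).
  by apply/ffunP => a; rewrite /upd !ffunE /=; case: eqP => [->|].
apply/imsetP; exists (f, None) => //; rewrite !inE andbT.
by rewrite (_ : [set a | _] = set0) ?cards0 //; apply/setP => a; rewrite !inE; apply: f0.
Qed.

(** * Encoding the secrets of two adjacent time intervals *)

Section Rectangle.

Variables (Omega : finType) (n k w : nat) (G : finType) (D : data_structure n w G).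
Variables (ref : 'I_n) (vx : nat -> 'I_k -> 'I_n) (par : nat -> bool).
Variables (ctx : Omega -> Omega) (C : {set Omega}) (ML : Omega -> memory w).
Variables (opsL : Omega -> seq (operation n)) (atsR : Omega -> seq (atom n k)).

Hypothesis ctxC : forall X, ctx X \in C.
Hypothesis ctx_ML : forall X X', ctx X = ctx X' -> ML X = ML X'.
Hypothesis ctx_sim : forall X X', ctx X = ctx X' -> all_similar (atsR X) (atsR X').
Hypothesis ctx_inj : forall X X', ctx X = ctx X' -> atsR X = atsR X' -> X = X'.

Let MR X := run D (ML X) (opsL X).
Let tL X := [set a in run_touched D (ML X) (opsL X)].
Let tR X := [set a in run_touched D (MR X) (atoms_ops ref vx (atsR X))].

Variables (md : bool) (Q x y m : nat) (Gd : {set Omega}).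

(** The child interval, which probes few cells, is the later part when [md = true] and the earlier
    part otherwise. *)
Let sm X := if md then tR X else tL X.
Let bg X := if md then tL X else tR X.

Hypothesis Gd_ok : forall X, X \in Gd ->
  [/\ run_ok D ref vx par (MR X) (atsR X), #|sm X| <= x, #|bg X| <= y
    & #|tL X :&: tR X| <= m].

Let sep (h : {ffun word w -> 'I_Q.+1}) X :=
  [forall a in sm X :\: bg X, h a == ord0] && [forall a in bg X :\: sm X, h a != ord0].

Let code X : {ffun word w -> option (word w)} :=
  [ffun a => if a \in tL X :&: tR X then Some (MR X a) else None].

(** For a fixed separator the pair of [ctx X] and [code X] determines [X]: by [ctx_inj] it suffices
    to recover the later atoms, and [similar_eq] does this on a set of cells that contains all later
    probes of both candidates. *)
Let card_sep_good h :
  #|[set X in Gd | sep h X]| <= #|C| * (2 ^ w * 2 ^ w).+1 ^ m.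
Proof.
have -> : 2 ^ w = #|{: word w}| by rewrite card_tuple card_bool.
apply: leq_trans (leq_mul (leqnn _) (card_small_codes (word w) (word w) m)).
rewrite -cardsX -(card_in_imset (f := fun X => (ctx X, code X))).
  apply: subset_leq_card; apply/subsetP => _ /imsetP[X + ->].
  rewrite inE => /andP[/Gd_ok[_ _ _ Xm] _]; rewrite !inE ctxC /=.
  apply: leq_trans Xm; apply: subset_leq_card; apply/subsetP => a.
  by rewrite inE ffunE; case: ifP.
move=> X X'; rewrite !inE => /andP[/Gd_ok[okX _ _ _] sX] /andP[/Gd_ok[okX' _ _ _] sX'].
move=> [cXX' /ffunP eco]; apply: (ctx_inj cXX').
have eT a : (a \in tL X :&: tR X) = (a \in tL X' :&: tR X').
  by have := eco a; rewrite !ffunE; case: ifP; case: ifP.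
(* The transferred cells and those on the later side of [h]. All later probes lie in [S] ([SR]); a
   cell on the later side that was probed earlier is a transferred one ([SL]), so every other cell
   of [S] still has its contents from [ML]. *)
pose S a := (a \in tL X :&: tR X) || ((h a == ord0) == md).
have SR Y : sep h Y -> {subset tR Y <= [pred a | (a \in tL Y :&: tR Y) || ((h a == ord0) == md)]}.
  rewrite /sep /sm /bg => /andP[/forall_inP h1 /forall_inP h2] a aR.
  rewrite !inE; rewrite inE in aR; rewrite aR andbT.
  case aL: (a \in run_touched D (ML Y) (opsL Y)) => //=.
  move: h1 h2; case: (md) => h1 h2; first by rewrite h1 // !inE aL aR.
  by rewrite (negPf (h2 a _)) // !inE aL aR.
have SL Y a : sep h Y -> a \in tL Y -> (h a == ord0) == md -> a \in tL Y :&: tR Y.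
  rewrite /sep /sm /bg => /andP[/forall_inP h1 /forall_inP h2] aL.
  rewrite in_setI aL /=; apply: contraTT => aR.
  move: h1 h2; case: (md) => h1 h2; first by rewrite (negPf (h2 a _)) // in_setD aL aR.
  by rewrite h1 // in_setD aL aR.
apply: (similar_eq (ctx_sim cXX') (S := S) (M := MR X) (M' := MR X') _ okX okX').
- move=> a; case aT: (a \in tL X :&: tR X).
    by move=> _; have := eco a; rewrite !ffunE -eT aT => -[].
  rewrite /S aT /= => ha.
  rewrite /MR run_untouched; last first.
    by apply/negP => aL; move: aT; rewrite SL // inE.
  rewrite run_untouched ?(ctx_ML cXX') //.
  by apply/negP => aL; move: aT; rewrite eT SL // inE.
- by apply/allP => a aR; apply: (SR X) => //; rewrite inE.
- apply/allP => a aR; rewrite /S eT.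
  by apply: (SR X') => //; rewrite inE.
Qed.

(** Double counting of the pairs of a good secret and a separator that fits it: each secret has many
    separators, each separator few secrets. *)
Lemma rectangle_count :
  #|Gd| * Q ^ y <= #|C| * (2 ^ w * 2 ^ w).+1 ^ m * Q.+1 ^ (x + y).
Proof.
set K := #|C| * _.
have pW : 0 < Q.+1 ^ #|{: word w}| by rewrite expn_gt0.
rewrite -(leq_pmul2r pW).
apply: (@leq_trans ((\sum_(X in Gd) #|[set h | sep h X]|) * Q.+1 ^ (x + y))).
  rewrite -mulnA -sum_nat_const big_distrl /=; apply: leq_sum => X XG.
  have [_ sx sy _] := Gd_ok XG.
  have dis : [disjoint (sm X :\: bg X) & (bg X :\: sm X)].
    by rewrite -setI_eq0; apply/eqP/setP => a; rewrite !inE; case: (a \in sm X); case: (a \in bg X).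
  have := card_separators Q dis; set c := #|[set h | _]|.
  set p := #|sm X :\: bg X|; set q := #|bg X :\: sm X| => E.
  have px : p <= x by apply: leq_trans sx; rewrite subset_leq_card // subsetDl.
  have qy : q <= y by apply: leq_trans sy; rewrite subset_leq_card // subsetDl.
  have -> : x + y = (p + q) + ((x - p) + (y - q)) by lia.
  rewrite expnD mulnA E -{1}(subnKC qy) !expnD.
  have h1 : 0 < Q.+1 ^ (x - p) by rewrite expn_gt0.
  have h2 : Q ^ (y - q) <= Q.+1 ^ (y - q) by case: (y - q) => // j; rewrite leq_exp2r.
  rewrite -!mulnA leq_mul2l; apply/orP; right.
  rewrite mulnC leq_mul2l; apply/orP; right.
  by apply: leq_trans h2 _; rewrite leq_pmull.
have -> : \sum_(X in Gd) #|[set h | sep h X]| =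
          \sum_(h : {ffun word w -> 'I_Q.+1}) #|[set X in Gd | sep h X]|.
  under eq_bigr do rewrite -sum1_card.
  rewrite (exchange_big_dep predT) //=; apply: eq_bigr => h _.
  by rewrite -sum1_card; apply: eq_bigl => X; rewrite !inE.
rewrite [leqRHS]mulnAC leq_mul2r; apply/orP; right.
apply: leq_trans (_ : \sum_(h : {ffun word w -> 'I_Q.+1}) K <= _).
  by apply: leq_sum => h _; apply: card_sep_good.
by rewrite sum_nat_const card_ffun card_ord mulnC.
Qed.

End Rectangle.

(** * The time hierarchy *)

Lemma sum_nat_blocks (m d : nat) (f : nat -> nat) :
  \sum_(0 <= P < m) \sum_(0 <= c < d) f (P * d + c) = \sum_(0 <= i < m * d) f i.
Proof.
elim: m => [|m IH]; first by rewrite !big_geq.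
have h : m * d <= m.+1 * d by rewrite leq_mul2r leqnSn orbT.
rewrite big_nat_recr //= IH [RHS](big_cat_nat (leq0n _) h) /=; congr (_ + _).
rewrite -{2}[m * d]add0n big_addn mulSn addnK.
by apply: eq_bigr => i _; rewrite addnC.
Qed.

Section Spans.

Variables (W : finType) (t : nat -> {set W}).

Definition span (s e : nat) : {set W} := \bigcup_(s <= i < e) t i.

Lemma span_cat s m e : s <= m -> m <= e -> span s e = span s m :|: span m e.
Proof. by move=> sm me; rewrite /span (big_cat_nat sm me). Qed.

Lemma span_nil s : span s s = set0.
Proof. by rewrite /span big_geq. Qed.

Lemma span_sub s m e : s <= m -> m <= e -> span s m \subset span s e.
Proof. by move=> sm me; rewrite (span_cat sm me) subsetUl. Qed.

Lemma span_sub2 s m e : s <= m -> m <= e -> span m e \subset span s e.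
Proof. by move=> sm me; rewrite (span_cat sm me) subsetUr. Qed.

Lemma card_span s e : #|span s e| <= \sum_(s <= i < e) #|t i|.
Proof.
rewrite /span; elim/big_rec2: _ => [|i m A _ IH]; first by rewrite cards0.
by apply: leq_trans (leq_card_setU _ _) _; rewrite leq_add2l.
Qed.

(** Each child adds to the union its cells not seen in the preceding children; inclusion-exclusion,
    telescoped. *)
Lemma sum_before s l d :
  \sum_(0 <= c < d) #|span (s + c * l) (s + c.+1 * l) :&: span s (s + c * l)|
    + #|span s (s + d * l)| = \sum_(0 <= c < d) #|span (s + c * l) (s + c.+1 * l)|.
Proof.
elim: d => [|d IH]; first by rewrite !big_geq // mul0n addn0 span_nil cards0.
have h1 : s <= s + d * l by lia.
have h2 : s + d * l <= s + d.+1 * l by rewrite mulSn; lia.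
rewrite !big_nat_recr //= -IH (span_cat h1 h2).
by have := cardsUI (span s (s + d * l)) (span (s + d * l) (s + d.+1 * l)); rewrite setIC; lia.
Qed.

Lemma sum_after s l d :
  \sum_(0 <= c < d) #|span (s + c * l) (s + c.+1 * l) :&: span (s + c.+1 * l) (s + d * l)|
    + #|span s (s + d * l)| = \sum_(0 <= c < d) #|span (s + c * l) (s + c.+1 * l)|.
Proof.
elim: d s => [|d IH] s; first by rewrite !big_geq // mul0n addn0 span_nil cards0.
rewrite !big_nat_recl //= mul0n addn0 mul1n.
have := IH (s + l).
have E c : s + l + c * l = s + c.+1 * l by rewrite mulSn; lia.
rewrite E; under eq_bigr do rewrite !E; under [X in _ = X -> _]eq_bigr do rewrite !E.
have h1 : s <= s + l by lia.
have h2 : s + l <= s + d.+1 * l by rewrite mulSn; lia.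
move=> <-; rewrite (span_cat h1 h2).
by have := cardsUI (span s (s + l)) (span (s + l) (s + d.+1 * l)); lia.
Qed.

Variables (Dl H : nat).

Definition child j P c := span (P * Dl ^ j.+1 + c * Dl ^ j) (P * Dl ^ j.+1 + c.+1 * Dl ^ j).

(** With [md = true] the queries of a child reveal what its earlier siblings updated; with
    [md = false] the later siblings query what the child updated. *)
Definition others (md : bool) j P c :=
  if md then span (P * Dl ^ j.+1) (P * Dl ^ j.+1 + c * Dl ^ j)
  else span (P * Dl ^ j.+1 + c.+1 * Dl ^ j) (P.+1 * Dl ^ j.+1).

Let level j := \sum_(0 <= P < Dl ^ (H - j)) #|span (P * Dl ^ j) (P.+1 * Dl ^ j)|.

Let level_child j : j < H ->
  \sum_(0 <= P < Dl ^ (H - j.+1)) \sum_(0 <= c < Dl) #|child j P c| = level j.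
Proof.
move=> jH; rewrite /level (_ : H - j = (H - j.+1).+1); last lia.
rewrite expnSr -sum_nat_blocks; apply: eq_bigr => P _; apply: eq_bigr => c _.
by congr #|pred_of_set (span _ _)|; rewrite expnS; lia.
Qed.

(** By [sum_before] and [sum_after] the transfer at scale [j] is exactly the drop from [level j] to
    [level j.+1], so the sum over all scales telescopes. *)
Lemma transfer_sum md :
  \sum_(0 <= j < H) \sum_(0 <= P < Dl ^ (H - j.+1)) \sum_(0 <= c < Dl)
     #|child j P c :&: others md j P c| <= \sum_(0 <= i < Dl ^ H) #|t i|.
Proof.
suff E i : i <= H -> \sum_(0 <= j < i) \sum_(0 <= P < Dl ^ (H - j.+1)) \sum_(0 <= c < Dl)
     #|child j P c :&: others md j P c| + level i = level 0.
  have := E H (leqnn _); rewrite {2}/level subn0 expn0.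
  have -> : \sum_(0 <= P < Dl ^ H) #|span (P * 1) (P.+1 * 1)| = \sum_(0 <= i < Dl ^ H) #|t i|.
    by apply: eq_bigr => i _; rewrite !muln1 /span big_nat1.
  by lia.
elim: i => [|i IH] iH; first by rewrite big_geq.
rewrite big_nat_recr //= -(IH (ltnW iH)) -addnA; congr (_ + _).
rewrite -(level_child iH) /level -big_split /=; apply: eq_bigr => P _.
have e : P.+1 * Dl ^ i.+1 = P * Dl ^ i.+1 + Dl * Dl ^ i by rewrite expnS; lia.
rewrite e /child /others; case: (md); first exact: sum_before.
by rewrite e; apply: sum_after.
Qed.

Lemma child_sum j : j < H ->
  \sum_(0 <= P < Dl ^ (H - j.+1)) \sum_(0 <= c < Dl) #|child j P c|
    <= \sum_(0 <= i < Dl ^ H) #|t i|.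
Proof.
move=> jH; rewrite (level_child jH) /level.
have -> : Dl ^ H = Dl ^ (H - j) * Dl ^ j by rewrite -expnD subnK // ltnW.
rewrite -sum_nat_blocks; apply: leq_sum => P _; apply: leq_trans (card_span _ _) _.
rewrite -{1}[P * Dl ^ j]add0n big_addn mulSn addnK.
by apply: leq_sum => i _; rewrite addnC.
Qed.

(** Each [others] lies inside its parent, which has [Dl] children. This is why the threshold for
    [others] will be [Dl] times that for [child]. *)
Lemma others_sum md j : j < H ->
  \sum_(0 <= P < Dl ^ (H - j.+1)) \sum_(0 <= c < Dl) #|others md j P c|
    <= Dl * \sum_(0 <= i < Dl ^ H) #|t i|.
Proof.
move=> jH; have -> : Dl ^ H = Dl ^ (H - j.+1) * Dl ^ j.+1 by rewrite -expnD subnK.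
rewrite -sum_nat_blocks big_distrr /=; apply: leq_sum => P _.
rewrite -[X in X * _]subn0 -sum_nat_const_nat big_nat [X in _ <= X]big_nat.
apply: leq_sum => c /andP[_ cD].
apply: (@leq_trans #|span (P * Dl ^ j.+1) (P.+1 * Dl ^ j.+1)|).
  have h : c.+1 * Dl ^ j <= Dl ^ j.+1 by rewrite expnS leq_mul2r cD orbT.
  have h' : c * Dl ^ j <= c.+1 * Dl ^ j by rewrite leq_mul2r leqnSn orbT.
  rewrite /others; apply: subset_leq_card; case: (md).
    by apply: span_sub; rewrite ?mulSn; lia.
  by apply: span_sub2; rewrite ?[P.+1 * _]mulSn; lia.
apply: leq_trans (card_span _ _) _.
rewrite -{1}[P * Dl ^ j.+1]add0n big_addn mulSn addnK.
by apply: leq_sum => i _; rewrite addnC.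
Qed.

End Spans.

(** * Evolution of the graph *)

Definition graph_step (n : nat) (E : graph n) (o : operation n) : graph n :=
  if o is Update x then apply_update E x else E.

Definition graph_after (n : nat) (E : graph n) (ops : seq (operation n)) : graph n :=
  foldl (@graph_step n) E ops.

Lemma graph_after_cat n (E : graph n) ops1 ops2 :
  graph_after E (ops1 ++ ops2) = graph_after (graph_after E ops1) ops2.
Proof. exact: foldl_cat. Qed.

Lemma correct_from_cat n (E : graph n) c ops1 bs1 tr :
  size ops1 = size bs1 -> Defs.proper c E ->
  correct_from E c (zip ops1 bs1 ++ tr) ->
  exists2 c', Defs.proper c' (graph_after E ops1) & correct_from (graph_after E ops1) c' tr.
Proof.
elim: ops1 bs1 E c => [|o ops IH] [|b bs] E c //= => [_ cE tE|[sz] cE]; first by exists c.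
by case: o => [x|u] /= [_]; [case=> c' [c'E] |]; apply: IH.
Qed.

(** Legality is put in continuation form, so that [leads] composes along concatenations. *)
Definition leads (cls : graph_class) (n : nat) (E : graph n)
    (ops : seq (operation n)) (E' : graph n) : Prop :=
  graph_after E ops = E' /\
  forall ops', legal_from cls E' ops' -> legal_from cls E (ops ++ ops').

Lemma leads_nil cls n (E : graph n) : leads cls E [::] E.
Proof. by []. Qed.

Lemma leads_cat cls n (E1 E2 E3 : graph n) ops1 ops2 :
  leads cls E1 ops1 E2 -> leads cls E2 ops2 E3 -> leads cls E1 (ops1 ++ ops2) E3.
Proof.
move=> [g1 l1] [g2 l2]; split; first by rewrite graph_after_cat g1.
by move=> ops' h; rewrite -catA; apply/l1/l2.
Qed.

Lemma mem_path_edges n (p1 p2 : seq 'I_n) x y :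
  [set x; y] \in path_edges (p1 ++ x :: y :: p2).
Proof.
rewrite /path_edges; case: p1 => [|z p1] /=; first by rewrite inE eqxx.
elim: p1 z => [|z' p1 IH] z /=; first by rewrite !inE eqxx orbT.
by rewrite inE IH orbT.
Qed.

(** Removing edges cuts a path into pieces whose concatenation is the same vertex list. In the
    induction a missing first edge makes [x] a piece of its own; a present one prepends [x] to the
    first nonempty piece. *)
Lemma sub_path_union n (p : seq 'I_n) (E : graph n) :
  uniq p -> E \subset [set e in path_edges p] -> path_union E.
Proof.
move=> up Ep.
suff [ps [fps Eps]] : exists ps : seq (seq 'I_n), flatten ps = p /\
    E = [set e in flatten (map (@path_edges n) ps)] by exists ps; rewrite fps.
elim: p E {up} Ep => [|x [|y p] IH] E Ep.
- exists [::]; split=> //; apply/setP => e; rewrite !inE.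
  by apply/negP => /(subsetP Ep); rewrite inE.
- exists [:: [:: x]]; split=> //; apply/setP => e; rewrite !inE.
  by apply/negP => /(subsetP Ep); rewrite inE.
have [|ps [fps Eps]] := IH (E :&: [set e in path_edges (y :: p)]); first exact: subsetIr.
have Ee e : (e \in E) = ((e == [set x; y]) && (e \in E))
                     || (e \in flatten (map (@path_edges n) ps)).
  have := congr1 (fun A : graph n => e \in A) Eps; rewrite /= in_setI !in_set => <-.
  case eE: (e \in E); rewrite ?andbF //= andbT; apply/esym.
  by have := subsetP Ep e eE; rewrite inE /path_edges /= inE.
case: (boolP ([set x; y] \in E)) => xyE; last first.
  exists ([:: x] :: ps); rewrite /= fps; split=> //; apply/setP => e.
  rewrite in_set Ee /path_edges /=.
  by case: (e =P [set x; y]) => [->|_] //; rewrite (negPf xyE).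
elim: ps fps {Eps} Ee => [|[|z q] ps IHps] //=.
move=> [zy f] Ee; subst z; exists ((x :: y :: q) :: ps); rewrite /= f; split=> //.
apply/setP => e; rewrite in_set /path_edges /= inE Ee.
by case: (e =P [set x; y]) => [->|_] //; rewrite xyE.
Qed.

Section Chains.

Variables (n : nat) (V : finType) (emb : V -> 'I_n).
Hypothesis emb_inj : injective emb.
Implicit Types (f : V -> option V) (P : {set V}) (cls : graph_class).

Definition edge (x y : V) : {set 'I_n} := [set emb x; emb y].

(** [P] holds the vertices whose outgoing edge is present; a partial [P] describes the graph in the
    middle of a rebuilding. *)
Definition edges f P : graph n :=
  [set e | [exists x, (x \in P) && (if f x is Some y then e == edge x y else false)]].

(** The numbering excludes cycles and merging branches at once, and its parity is a proper
    coloring. *)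
Definition chain f : Prop :=
  exists2 idx : V -> nat, injective idx & forall x y, f x = Some y -> idx y = (idx x).+1.

Lemma edgesP f P e :
  reflect (exists x y, [/\ x \in P, f x = Some y & e = edge x y]) (e \in edges f P).
Proof.
rewrite inE; apply: (iffP existsP) => [[x /andP[xP]]|[x [y [xP fx ->]]]].
  by case fx: (f x) => [y|] // /eqP ->; exists x, y.
by exists x; rewrite xP fx eqxx.
Qed.

Lemma edge_cases x y u v : edge x y = [set u; v] ->
  (u = emb x /\ v = emb y) \/ (u = emb y /\ v = emb x) \/ (u = v) \/ x = y.
Proof.
rewrite /edge => e.
have: u \in [set emb x; emb y] by rewrite e set21.
have: v \in [set emb x; emb y] by rewrite e set22.
rewrite !inE => /orP[] /eqP-> /orP[] /eqP->; auto.
Qed.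

Lemma edge_inj f x y x' y' : chain f -> f x = Some y -> f x' = Some y' ->
  edge x y = edge x' y' -> x = x'.
Proof.
move=> [idx ii hi] fx fx' e; have hx := hi _ _ fx; have hx' := hi _ _ fx'.
have nxy : x <> y by move=> exy; rewrite exy in hx; lia.
have nxy' : x' <> y' by move=> exy; rewrite exy in hx'; lia.
case: (edge_cases e) => [[/emb_inj -> _]|[[/emb_inj ? /emb_inj ?]|[/emb_inj|]]] //.
by subst; lia.
Qed.

Lemma edges_path_union f P : chain f -> path_union (edges f P).
Proof.
move=> [idx ii hi].
pose inv i := [pick v | idx v == i]; pose m := (\max_v idx v).+1.
have invE v : inv (idx v) = Some v.
  by rewrite /inv; case: pickP => [z /eqP/ii->|/(_ v)/eqP] //.
apply: (@sub_path_union _ (map emb (pmap inv (iota 0 m)))).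
  rewrite map_inj_uniq //; apply: (@pmap_uniq _ _ inv idx); last exact: iota_uniq.
  by move=> i; rewrite /inv; case: pickP => //= v /eqP.
apply/subsetP => e /edgesP[x [y [_ fx ->]]]; rewrite inE.
have hy := hi _ _ fx.
have ym : idx y < m by rewrite ltnS; apply: leq_bigmax.
have -> : iota 0 m = iota 0 (idx x) ++ idx x :: idx y :: iota (idx y).+1 (m - (idx y).+1).
  rewrite -{1}(subnKC ym) hy -addn2 -addnA iotaD add0n iotaD /= -addn2.
  by congr (_ ++ _ :: _ :: iota _ _); lia.
rewrite pmap_cat /= !invE /= map_cat /=; exact: mem_path_edges.
Qed.

Lemma edges_bipartite f P : chain f -> bipartite (edges f P).
Proof.
move=> [idx ii hi]; apply/existsP.
exists [ffun u => if [pick v | emb v == u] is Some v then odd (idx v) else false].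
have cE v : (if [pick v' | emb v' == emb v] is Some v' then odd (idx v') else false) = odd (idx v).
  by case: pickP => [v' /eqP/emb_inj->|/(_ v)/eqP].
apply/'forall_forallP => u v; apply/implyP => /edgesP[x [y [_ fx e]]].
have hy := hi _ _ fx.
have nxy : x <> y by move=> exy; rewrite exy in hy; lia.
rewrite !ffunE; case: (edge_cases (esym e)) => [[-> ->]|[[-> ->]|[|//]]].
- by rewrite !cE hy /=; case: odd.
- by rewrite !cE hy /=; case: odd.
move=> uv; case: nxy; apply: emb_inj; move: e; rewrite uv setUid /edge => /setP e.
have := e (emb x); have := e (emb y); rewrite !inE !eqxx ?orbT.
by move=> /eqP -> /eqP ->.
Qed.

Lemma edges_in_class cls f P : chain f -> in_class cls (edges f P).
Proof. by move=> ch; case: cls; [apply: edges_bipartite|apply: edges_path_union]. Qed.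

Definition delete_ops f (xs : seq V) : seq (update n) :=
  pmap (fun x => omap (fun y => Delete (emb x) (emb y)) (f x)) xs.

Definition insert_ops f (xs : seq V) : seq (update n) :=
  pmap (fun x => omap (fun y => Insert (emb x) (emb y)) (f x)) xs.

Lemma edgesD1 f P x : chain f -> x \in P ->
  edges f (P :\ x) = if f x is Some y then edges f P :\ edge x y else edges f P.
Proof.
move=> ch xP; case fx: (f x) => [y|].
  apply/setP => e; rewrite in_setD1; apply/edgesP/andP => [[z [t [+ fz ->]]]|[ne /edgesP[z [t [zP fz ez]]]]].
    rewrite in_setD1 => /andP[zx zP]; split; last by apply/edgesP; exists z, t.
    by apply: contra zx => /eqP/(edge_inj ch fz fx)->.
  exists z, t; split=> //; rewrite in_setD1 zP andbT; apply: contra ne => /eqP zx.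
  by rewrite ez zx; move: fz; rewrite zx fx => -[->].
apply/setP => e; apply/edgesP/edgesP => -[z [t [zP fz ez]]]; exists z, t; split=> //.
  by move: zP; rewrite in_setD1 => /andP[].
by rewrite in_setD1 zP andbT; apply/eqP => zx; move: fz; rewrite zx fx.
Qed.

Lemma leads_delete cls f P xs : chain f -> uniq xs -> {subset xs <= P} ->
  leads cls (edges f P) [seq Update x | x <- delete_ops f xs]
    (edges f (P :\: [set x in xs])).
Proof.
move=> ch; elim: xs P => [|x xs IH] P /=.
  move=> _ _; rewrite (_ : P :\: _ = P); first exact: leads_nil.
  by apply/setP => x; rewrite !inE.
move=> /andP[xxs uxs] sP; have xP : x \in P by apply: sP; rewrite inE eqxx.
have := edgesD1 ch xP.
have sP' : {subset xs <= P :\ x}.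
  move=> z zs; rewrite in_setD1 sP ?inE ?zs ?orbT // andbT.
  by apply: contraNneq xxs => <-.
have := IH _ uxs sP'.
have -> : (P :\ x) :\: [set z in xs] = P :\: [set z in x :: xs].
  by apply/setP => z; rewrite !inE negb_or; case: (z == x); rewrite /= ?andbF.
rewrite /delete_ops /=; case fx: (f x) => [y|] /= [g l] eD; last by rewrite -eD; split.
rewrite /leads /= -/(edge x y) -eD; split=> // ops' h; split; last exact: l.
  by apply/edgesP; exists x, y.
exact: edges_in_class.
Qed.

Lemma leads_insert cls f P xs : chain f -> uniq xs -> {subset xs <= ~: P} ->
  leads cls (edges f P) [seq Update x | x <- insert_ops f xs]
    (edges f (P :|: [set x in xs])).
Proof.
move=> ch; elim: xs P => [|x xs IH] P /=.
  move=> _ _; rewrite (_ : P :|: _ = P); first exact: leads_nil.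
  by apply/setP => x; rewrite !inE orbF.
move=> /andP[xxs uxs] sP; have xP : x \notin P.
  by have := sP x; rewrite !inE eqxx => /(_ isT).
have xxP : x \in x |: P by rewrite setU11.
have := edgesD1 ch xxP; rewrite setU1K //.
have sP' : {subset xs <= ~: (x |: P)}.
  move=> z zs; have := sP z; rewrite !inE zs orbT negb_or => /(_ isT) ->.
  by rewrite andbT; apply: contraNneq xxs => <-.
have := IH _ uxs sP'.
have -> : (x |: P) :|: [set z in xs] = P :|: [set z in x :: xs].
  by apply/setP => z; rewrite !inE; case: (z == x); rewrite /= ?orbT.
rewrite /insert_ops /=; case fx: (f x) => [y|] /= [g l] eD; last by rewrite eD; split.
have ein : edge x y \in edges f (x |: P) by apply/edgesP; exists x, y.
have eU : [set emb x; emb y] |: edges f P = edges f (x |: P).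
  by rewrite eD -/(edge x y) setD1K.
have nv : violates (edges f P) (Insert (emb x) (emb y)) = false.
  by rewrite /violates eU edges_bipartite.
have ap : apply_update (edges f P) (Insert (emb x) (emb y)) = edges f (x |: P).
  by rewrite /apply_update nv eU.
split; first by rewrite -g -ap.
have cl := edges_in_class cls (x |: P) ch.
move=> ops' /l h'; rewrite -ap in cl h'; split; [|exact: cl|exact: h'].
apply/andP; split; last by rewrite eD !inE eqxx.
apply/eqP => /emb_inj exy; have [idx _ hi] := ch.
by have := hi _ _ fx; rewrite exy; lia.
Qed.

(** All obsolete edges are deleted before a new one is inserted, so every intermediate graph is part
    of a single chain and stays in the class. *)
Definition transition f f' : seq (update n) :=
  let xs := enum [pred x | f x != f' x] in delete_ops f xs ++ insert_ops f' xs.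

Lemma leads_transition cls f f' : chain f -> chain f' ->
  leads cls (edges f setT) [seq Update x | x <- transition f f'] (edges f' setT).
Proof.
move=> ch ch'; rewrite /transition map_cat; set xs := enum _.
have uxs : uniq xs by apply: enum_uniq.
apply: (leads_cat (E2 := edges f (setT :\: [set x in xs]))).
  by apply: leads_delete => // x; rewrite inE.
have -> : edges f (setT :\: [set x in xs]) = edges f' (setT :\: [set x in xs]).
  apply/setP => e; apply/edgesP/edgesP => -[x [y [xP fx ->]]]; exists x, y; split=> //;
  by move: xP; rewrite !inE mem_enum inE andbT negbK => /eqP; rewrite fx => <-.
have {2}-> : setT = (setT :\: [set x in xs]) :|: [set x in xs].
  by apply/setP => x; rewrite !inE andbT orNb.
by apply: leads_insert => // x; rewrite !inE andbT negbK.
Qed.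

Lemma size_transition f f' :
  size (transition f f') <= 2 * #|[pred x | f x != f' x]|.
Proof.
rewrite /transition size_cat mul2n -addnn !size_pmap cardE.
by rewrite leq_add // (leq_trans (count_size _ _)) ?size_map.
Qed.

End Chains.

(** * Braided Hamiltonian paths *)

Section Braid.

Variables (N k0 : nat).

(* [inl (s, l, b)] is the position [b] of layer [l], on the way out when
   [s = false] and on the way back when [s = true]; [inr false] and [inr true]
   are the spare vertices that are spliced in before and after one track. *)
Definition vertex : finType := ((bool * 'I_N.+1 * 'I_k0.+1) + bool)%type.

Definition vtx (s : bool) (l : nat) (b : 'I_k0.+1) : vertex := inl (s, inord l, b).

Section State.

Variables (pi : nat -> {perm 'I_k0.+1}) (a : 'I_k0.+1).

(* The track [t] visits the position [track l t] of layer [l]. *)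
Fixpoint track (l : nat) : {perm 'I_k0.+1} :=
  (if l is l'.+1 then track l' * pi l' else 1)%g.

(* The path runs through the tracks one after the other, each time through the
   layers 0, ..., N and back: so the tracks are joined at layer 0, where the
   position is the track, whatever the permutations are. *)
Definition follow (v : vertex) : option vertex :=
  match v with
  | inl (false, l, b) =>
      if l < N then Some (vtx false l.+1 (pi l b)) else Some (vtx true N b)
  | inl (true, l, b) =>
      if 0 < l then Some (vtx true l.-1 ((pi l.-1)^-1%g b))
      else if b == a then Some (inr true)
      else if b.+1 == a :> nat then Some (inr false)
      else if b < k0 then Some (vtx false 0 (inord b.+1)) else None
  | inr false => Some (vtx false 0 a)
  | inr true => if a < k0 then Some (vtx false 0 (inord a.+1)) else None
  end.

(** The number of spare vertices ahead of the track [t] on the path; it is odd for [t = a] only. *)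
Definition shift (t : nat) : nat := (a <= t) + (a < t).

Definition offset (s : bool) (l : nat) : nat := if s then (N + N).+1 - l else l.

(** A track fills [(N + N).+2] consecutive ranks, the layers out and back; this length is even, so
    all tracks would start with the same parity without [shift]. *)
Definition place (t o : nat) : nat := t * (N + N).+2 + o + shift t.

Definition rank (v : vertex) : nat :=
  match v with
  | inl (s, l, b) => place ((track l)^-1%g b) (offset s l)
  | inr false => a * (N + N).+2
  | inr true => a.+1 * (N + N).+2 + 1
  end.

Lemma place_inj t o t' o' : o < (N + N).+2 -> o' < (N + N).+2 ->
  place t o = place t' o' -> t = t' /\ o = o'.
Proof.
rewrite /place /shift => oW oW'; set W := (N + N).+2 in oW oW' *.
case: (ltngtP t t') => [tt|tt|->] e; last by split=> //; lia.
  have : t.+1 * W <= t' * W by rewrite leq_mul2r tt orbT.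
  by rewrite mulSn; lia.
have : t'.+1 * W <= t * W by rewrite leq_mul2r tt orbT.
by rewrite mulSn; lia.
Qed.

Lemma offset_lt s (l : 'I_N.+1) : offset s l < (N + N).+2.
Proof. by have := ltn_ord l; rewrite /offset; case: s; lia. Qed.

Lemma place_neq1 t o : o < (N + N).+2 -> place t o <> a * (N + N).+2.
Proof.
rewrite /place /shift => oW e; set W := (N + N).+2 in oW e *.
case: (ltnP t a) => ta.
  have : t.+1 * W <= a * W by rewrite leq_mul2r ta orbT.
  by rewrite mulSn; lia.
have : a * W <= t * W by rewrite leq_mul2r ta orbT.
by lia.
Qed.

Lemma place_neq2 t o : o < (N + N).+2 -> place t o <> a.+1 * (N + N).+2 + 1.
Proof.
rewrite /place /shift => oW e; set W := (N + N).+2 in oW e *.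
case: (ltnP a t) => ta.
  have : a.+1 * W <= t * W by rewrite leq_mul2r ta orbT.
  by lia.
have : t * W <= a * W by rewrite leq_mul2r ta orbT.
by move: e; rewrite mulSn; lia.
Qed.

Lemma rank_inj : injective rank.
Proof.
move=> [[[s l] b]|[]] [[[s' l'] b']|[]] //=.
- move=> /(place_inj (offset_lt _ _) (offset_lt _ _))[tt].
  rewrite /offset; have := ltn_ord l; have := ltn_ord l' => lN lN' oo.
  have ss : s = s' by case: (s) (s') oo => [] [] //=; lia.
  have ll : l = l' by apply: val_inj => /=; rewrite ss in oo; case: (s') oo => /=; lia.
  by subst; congr (inl (_, _)); apply: (@perm_inj _ (track l')^-1%g); apply: val_inj.
- by move=> /place_neq2[]; apply: offset_lt.
- by move=> /place_neq1[]; apply: offset_lt.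
- by move/esym => /place_neq2[]; apply: offset_lt.
- by rewrite mulSn; lia.
- by move/esym => /place_neq1[]; apply: offset_lt.
- by rewrite mulSn; lia.
Qed.

Lemma trackV0 (b : 'I_k0.+1) : (track 0)^-1%g b = b.
Proof. by rewrite /= invg1 perm1. Qed.

Lemma rank_vtx s l b : l <= N -> rank (vtx s l b) = place ((track l)^-1%g b) (offset s l).
Proof. by move=> lN; rewrite /= inordK. Qed.

Lemma rank_follow v v' : follow v = Some v' -> rank v' = (rank v).+1.
Proof.
case: v => [[[[] l] b]|[]] /=.
- case: ifP => [l0 [<-]|l0].
    have lN := ltn_ord l.
    rewrite rank_vtx; last lia.
    have -> : (track l)^-1%g b = (track l.-1)^-1%g ((pi l.-1)^-1%g b).
      by rewrite -{1}(prednK l0) /= invMg permM.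
    by rewrite /place /offset; lia.
  have -> : (l : nat) = 0 by lia.
  rewrite trackV0 /place /offset /shift.
  case: eqP => [-> [<-]|ba] /=; first by rewrite mulSn; lia.
  case: eqP => [ba1 [<-]|ba1] /=; first by rewrite -ba1 mulSn; lia.
  have {}ba : b <> a :> nat by move=> /val_inj.
  case: ifP => // bk [<-]; rewrite rank_vtx // trackV0 inordK ?ltnS // /place /offset /shift mulSn.
  by lia.
- case: ifP => [lN [<-]|lN [<-]]; rewrite rank_vtx //.
    have -> : (track l.+1)^-1%g (pi l b) = (track l)^-1%g b by rewrite /= invMg permM permK.
    by rewrite /place /offset; lia.
  have -> : (l : nat) = N by have := ltn_ord l; lia.
  by rewrite /place /offset; lia.
- case: ifP => // ak [<-]; rewrite rank_vtx // trackV0 inordK ?ltnS // /place /offset /shift mulSn.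
  by lia.
- by move=> [<-]; rewrite rank_vtx // trackV0 /place /offset /shift; lia.
Qed.

Lemma chain_follow : chain follow.
Proof. by exists rank; [apply: rank_inj|apply: rank_follow]. Qed.

Variables (n : nat) (emb : vertex -> 'I_n).

(* Along the path the color alternates, so the color of the spare vertex
   determines all the others; only the track [a] is shifted by one. *)
Lemma forced_color (c : coloring n) l b : l <= N ->
  Defs.proper c (edges emb follow setT) ->
  c (emb (inr false)) (+) c (emb (vtx false l b)) = odd l (+) (b == track l a).
Proof.
move=> lN /forallP pc.
(* [d] is constant along the path. It is followed out along a track ([dl]), back ([dr]), on to the
   next track ([d1]), and from the spare vertex ([ds]). *)
pose d v := c (emb v) (+) odd (rank v).
have dn v v' : follow v = Some v' -> d v' = d v.
  move=> nv; have := forallP (pc (emb v)) (emb v').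
  have -> : [set emb v; emb v'] \in edges emb follow setT.
    by apply/edgesP; exists v, v'; rewrite inE.
  by rewrite /d (rank_follow nv) /=; case: (c _); case: (c _); case: odd.
have dl t j : j <= N -> d (vtx false j (track j t)) = d (vtx false 0 t).
  elim: j => [|j IH] jN; first by rewrite /= perm1.
  rewrite -IH; last exact: ltnW.
  apply: dn; rewrite /= inordK; last by rewrite ltnS ltnW.
  by rewrite jN permM.
have dr t j : j <= N -> d (vtx true (N - j) (track (N - j) t)) = d (vtx false 0 t).
  elim: j => [|j IH] jN.
    rewrite subn0 -(dl t N) //; apply: dn.
    by rewrite /= inordK // ltnn.
  rewrite -IH; last exact: ltnW.
  apply: dn; rewrite /= inordK; last lia.
  rewrite (_ : N - j = (N - j.+1).+1) /=; last lia.
  by rewrite permM permK.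
have d1 t : t <= k0 -> d (vtx false 0 (inord t)) = d (vtx false 0 ord0).
  elim: t => [|t IH] tk; first by congr (d (vtx _ _ _)); apply: val_inj; rewrite /= inordK.
  have tk1 : (inord t : 'I_k0.+1) < k0 by rewrite inordK //; lia.
  rewrite -IH; last lia.
  have := dr (inord t) N (leqnn _); rewrite subnn /= perm1 => <-.
  have e : inord (inord t : 'I_k0.+1).+1 = inord t.+1 :> 'I_k0.+1 by rewrite inordK //; lia.
  have := @dn (vtx true 0 (inord t)); rewrite /= inordK //.
  case: eqP => [ta|_]; last case: eqP => [ta|_].
  - move=> /(_ _ erefl) <-; apply: dn => /=; rewrite -ta tk1; congr Some.
    by rewrite e.
  - move=> /(_ _ erefl) <-; apply: dn => /=; congr (Some (vtx _ _ _)); apply: val_inj => /=.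
    by rewrite -ta inordK ?inordK //; lia.
  - by rewrite tk1 e => /(_ _ erefl).
have ds : d (inr false) = d (vtx false 0 ord0).
  rewrite -(@d1 a); last by rewrite -ltnS ltn_ord.
  by rewrite inord_val; apply/esym/dn.
have dv : d (vtx false l b) = d (inr false).
  rewrite ds -(permKV (track l) b) dl // -(@d1 ((track l)^-1%g b)) ?inord_val //.
  by rewrite -ltnS ltn_ord.
move: dv; rewrite {1 2}/d rank_vtx // /=.
rewrite -(canF_eq (permKV (track l))) -val_eqE /place /offset /shift /=.
set t := nat_of_ord ((track l)^-1%g b).
have -> : odd (a * (N + N).+2) = false by rewrite oddM /= oddD addbb andbF.
have -> : odd (t * (N + N).+2 + l + ((a <= t) + (a < t))) = odd l (+) (t == a).
  rewrite !oddD oddM /= oddD addbb andbF /= !oddb.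
  by congr (_ (+) _); case: (ltngtP a t).
by rewrite addbF; case: (c _); case: (c _); case: odd; case: eqP.
Qed.

End State.

(** Cancellation in the symmetric group: with all other factors known, the product determines the
    factor at [l]. *)
Lemma track_inj (pi pi' : nat -> {perm 'I_k0.+1}) (l m : nat) :
  l < m -> (forall i, i < m -> i != l -> pi i = pi' i) ->
  track pi m = track pi' m -> pi l = pi' l.
Proof.
move=> lm eqpi.
have tr i : i <= l -> track pi i = track pi' i.
  by elim: i => //= i IH il; rewrite IH ?(ltnW il) // eqpi //; lia.
elim: m lm eqpi => // m IH; rewrite ltnS leq_eqVlt => /orP[/eqP <-|lm] eqpi /=.
  by rewrite tr // => /mulgI.
rewrite (eqpi m) //; last by lia.
move=> /mulIg; apply: IH => // i im; apply: eqpi; lia.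
Qed.

Lemma card_vertex : #|vertex| = 2 * (N.+1 * k0.+1) + 2.
Proof. by rewrite card_sum !card_prod !card_ord card_bool mulnA. Qed.

(** Moving the splice rewires only the spare vertices, the returning ends of the tracks [a] and
    [a'], and those of the tracks just before them. This constant cost makes it affordable to splice
    every track in turn. *)
Lemma follow_diff_flip pi (a a' : 'I_k0.+1) :
  #|[pred v | follow pi a v != follow pi a' v]| <= 6.
Proof.
pose A := [:: inr false; inr true; vtx true 0 a; vtx true 0 a';
              vtx true 0 (inord a.-1); vtx true 0 (inord a'.-1)] : seq vertex.
apply: (@leq_trans (size A)) => //; apply: leq_trans (card_size A).
apply: subset_leq_card; apply/subsetP => -[[[s l] b]|[]]; rewrite !inE //=.
case: s; last by rewrite eqxx.
case: ifP => [_|l0]; first by rewrite eqxx.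
have -> : l = inord 0 by apply: val_inj; rewrite /= inordK //; lia.
have P c : (inl (true, inord 0, b) == vtx true 0 c :> vertex) = (b == c).
  by apply/eqP/eqP => [[]|->].
rewrite !P; case: (b =P a) => //= _; case: (b =P a') => //= _; rewrite ?orbT //.
case: (b.+1 =P a) => [e1|_]; first by rewrite -e1 /= inord_val eqxx.
case: (b.+1 =P a') => [e1|_]; first by rewrite -e1 /= inord_val eqxx orbT.
by rewrite eqxx.
Qed.

Lemma follow_diff_layers (pi pi' : nat -> {perm 'I_k0.+1}) (a : 'I_k0.+1) (L : seq nat) :
  (forall i, i < N -> i \notin L -> pi i = pi' i) ->
  #|[pred v | follow pi a v != follow pi' a v]| <= 2 * (k0.+1 * size L).
Proof.
move=> eqpi.
pose A := [seq vtx x.1.1 (x.1.1 + x.2) x.1.2 | x <- [seq (p, l) | p <- enum {: bool * 'I_k0.+1}, l <- L]].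
have sA : size A = 2 * (k0.+1 * size L).
  by rewrite size_map size_allpairs -cardE card_prod card_bool card_ord mulnA.
rewrite -sA; apply: leq_trans (card_size A).
apply: subset_leq_card; apply/subsetP => -[[[s l] b]|[]]; rewrite !inE //= ?eqxx //.
have inA i : s + i = l -> i \in L -> (inl (s, l, b) : vertex) \in A.
  move=> e iL; apply/mapP; exists ((s, b), i); last by rewrite /= /vtx e inord_val.
  by apply/allpairsP; exists ((s, b), i); rewrite mem_enum.
have lN := ltn_ord l.
case: s inA => inA; case: ifP => l0; rewrite ?eqxx //.
  case iL: (l.-1 \in L); first by move=> _; apply: (inA l.-1) => //=; lia.
  by rewrite eqpi ?iL ?eqxx //; lia.
case iL: ((l : nat) \in L); first by move=> _; apply: (inA l).
by rewrite eqpi ?iL ?eqxx.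
Qed.

End Braid.

(** * The schedule *)

Section DigitReversal.

Variable Dl : nat.
Hypothesis Dl_gt0 : 0 < Dl.

Fixpoint drev (h x : nat) : nat :=
  if h is h'.+1 then (x %% Dl) * Dl ^ h' + drev h' (x %/ Dl) else 0.

Lemma drev_lt h x : drev h x < Dl ^ h.
Proof.
elim: h x => //= h IH x; have := IH (x %/ Dl); have := ltn_pmod x Dl_gt0.
rewrite expnS; move: (x %% Dl) (drev _ _) (Dl ^ h) => r d p rD dp.
have : r.+1 * p <= Dl * p by rewrite leq_mul2r rD orbT.
by rewrite mulSn; lia.
Qed.

(** The low [j] digits become the leading ones; hence the times of an interval of length [Dl ^ j]
    are spread over all blocks of [Dl ^ i] layers, one in each block. *)
Lemma drev_add i j a b : b < Dl ^ j ->
  drev (j + i) (a * Dl ^ j + b) = drev j b * Dl ^ i + drev i a.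
Proof.
elim: j a b => [|j IH] a b.
  by rewrite expn0 ltnS leqn0 => /eqP->; rewrite muln1 addn0.
rewrite expnSr => bD; rewrite addSn /= mulnA modnMDl divnMDl //.
rewrite IH; last by rewrite ltn_divLR.
by rewrite mulnDl expnD addnA mulnA.
Qed.

Lemma drevK h x : x < Dl ^ h -> drev h (drev h x) = x.
Proof.
elim: h x => [|h IH] x; first by rewrite expn0 ltnS leqn0 => /eqP->.
rewrite expnSr => xD /=.
have xd : x %/ Dl < Dl ^ h by rewrite ltn_divLR.
have := @drev_add 1 h (x %% Dl) _ (drev_lt h (x %/ Dl)).
rewrite addn1 /= => ->; rewrite IH // muln1 addn0 modn_mod expn1.
by rewrite -divn_eq.
Qed.

Lemma drev_top j y d : y < Dl ^ j -> d < Dl ->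
  drev j.+1 (d * Dl ^ j + drev j y) = y * Dl + d.
Proof.
move=> yD dD; have := @drev_add 1 j d _ (drev_lt j y); rewrite addn1 => ->.
by rewrite drevK // expn1 /= muln1 addn0 modn_small.
Qed.

End DigitReversal.

Section Schedule.

Variables (D : nat) (H : nat) (md : bool).
Hypothesis D_gt0 : 0 < D.

Notation Dl := (4 * D).

(* [md = true] schedules one update and [Dl] queries per round, [md = false]
   schedules [Dl] updates and one query. *)
Definition upds : nat := if md then 1 else Dl.
Definition qrys : nat := if md then Dl else 1.
Definition hgt : nat := if md then H else H.+1.
Definition layers : nat := Dl ^ hgt.

(** With [md = true] there are [Dl] times as many queries as layers, and the last digit of the
    reversed query number is dropped; with [md = false] there are [Dl] times as many layers as
    queries, and a digit [0] is appended. *)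
Definition query_layer (tau e : nat) : nat :=
  if md then drev Dl H.+1 (tau * Dl + e) %/ Dl else drev Dl H tau * Dl.

Let Dl_gt0 : 0 < Dl. Proof. lia. Qed.

Lemma layersE : layers = Dl ^ H * upds.
Proof. by rewrite /layers /upds /hgt; case: md; rewrite ?muln1 // expnSr. Qed.

Lemma query_layer_lt tau e : query_layer tau e < layers.
Proof.
rewrite /query_layer /layers /hgt; case: md.
  by rewrite ltn_divLR // -expnSr drev_lt.
by rewrite expnSr ltn_mul2r Dl_gt0 drev_lt.
Qed.

Variables (j P c : nat).
Hypothesis jH : j < H.
Hypothesis PD : P < Dl ^ (H - j.+1).
Hypothesis cD : if md then 2 * D <= c < Dl else c < 2 * D.

Let cDl : c < Dl. Proof. by move: cD; case: md; lia. Qed.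

Definition left_start := P * Dl ^ j.+1 + (if md then 0 else c * Dl ^ j).
Definition middle := P * Dl ^ j.+1 + (if md then c else c.+1) * Dl ^ j.
Definition right_end := if md then P * Dl ^ j.+1 + c.+1 * Dl ^ j else P.+1 * Dl ^ j.+1.

Let width := Dl ^ (hgt - j.+1).
(** The trailing digits shared by all secret layers: reversed, they are the leading digits of the
    update times and so place these in the parent [P] ([md = true]) or in its child [c]
    ([md = false]). *)
Let off := if md then drev Dl (H - j.+1) P else drev Dl (H - j) (P * Dl + c).
(** The last digit is the index of the child that performs the update ([md = true], in the first
    half, hence before [c]), or its successor is the index of the child that performs the query
    ([md = false], in the second half, hence after [c]). *)
Let cell y i := y * Dl + ((if md then 0 else 2 * D) + 2 * i).

(* The secret layers: in each cell of even index (the cells being the ranges of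
   layers with the same [j + 1] leading digits) the one updated before
   [middle]; the next cell contains a layer queried after [middle]. *)
Definition secret_layer (y i : nat) : nat := cell y i * width + off.

Let hgtE : hgt = j.+1 + (hgt - j.+1).
Proof. by rewrite /hgt; case: md; lia. Qed.

Let width_gt0 : 0 < width. Proof. by rewrite expn_gt0 Dl_gt0. Qed.

Let off_lt : off < width.
Proof. by rewrite /off /width /hgt; case: md; apply: drev_lt. Qed.

Let cell_lt y i : y < Dl ^ j -> i < D -> (cell y i).+1 < Dl ^ j.+1.
Proof.
move=> yD iD; have : y.+1 * Dl <= Dl ^ j * Dl by rewrite leq_mul2r yD orbT.
by rewrite expnSr mulSn /cell; case: md; lia.
Qed.

Lemma secret_layer_lt y i : y < Dl ^ j -> i < D -> secret_layer y i < layers.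
Proof.
move=> yD iD; have := cell_lt yD iD; rewrite /layers hgtE expnD -/width /secret_layer.
move: (cell y i) (Dl ^ j.+1) => z p zp.
have : z.+1 * width <= p * width by rewrite leq_mul2r ltnW ?orbT.
by rewrite mulSn; have := off_lt; lia.
Qed.

Lemma secret_layer_inj y i y' i' : i < D -> i' < D ->
  secret_layer y i = secret_layer y' i' -> y = y' /\ i = i'.
Proof.
move=> iD iD' /addIn/eqP; rewrite eqn_mul2r eqn0Ngt width_gt0 /= => /eqP e.
set s := (if md then 0 else 2 * D) + 2 * i; set s' := (if md then 0 else 2 * D) + 2 * i'.
have sD : s < Dl by rewrite /s; case: md; lia.
have sD' : s' < Dl by rewrite /s'; case: md; lia.
have es : s = s'.
  by have := congr1 (modn^~ Dl) e; rewrite /cell -/s -/s' !modnMDl !modn_small.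
have ey : y = y'.
  by have := congr1 (divn^~ Dl) e; rewrite /cell -/s -/s' !divnMDl // !divn_small // !addn0.
by split=> //; move: es; rewrite /s /s'; lia.
Qed.

Lemma middle_gt0 : 0 < middle.
Proof.
have p : 0 < Dl ^ j by rewrite expn_gt0 Dl_gt0.
have : 0 < (if md then c else c.+1) by move: cD; case: md; lia.
rewrite /middle; move: (if _ then _ else _) => z z0.
have : 0 < z * Dl ^ j by rewrite muln_gt0 z0.
by lia.
Qed.

Let leq_cDl : c.+1 * Dl ^ j <= Dl ^ j.+1.
Proof. by rewrite expnS leq_mul2r cDl orbT. Qed.

Lemma left_middle : left_start <= middle.
Proof.
rewrite /left_start /middle leq_add2l; case: md; first by [].
by rewrite leq_mul2r leqnSn orbT.
Qed.

Lemma middle_right : middle <= right_end.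
Proof.
rewrite /middle /right_end; case: md.
  by rewrite leq_add2l leq_mul2r leqnSn orbT.
by have := leq_cDl; rewrite (mulSn P); lia.
Qed.

Lemma right_end_le : right_end <= Dl ^ H.
Proof.
apply: (@leq_trans (P.+1 * Dl ^ j.+1)).
  by rewrite /right_end; case: md; rewrite // (mulSn P); have := leq_cDl; lia.
by rewrite -(subnK jH) expnD leq_mul2r PD orbT.
Qed.

Let PcD : P * Dl + c < Dl ^ (H - j).
Proof.
have : P.+1 * Dl <= Dl ^ (H - j.+1) * Dl by rewrite leq_mul2r PD orbT.
by rewrite -expnSr -subSn // subSS mulSn; have := cDl; lia.
Qed.

Lemma secret_layer_time y i : y < Dl ^ j -> i < D ->
  left_start * upds <= drev Dl hgt (secret_layer y i) < middle * upds.
Proof.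
move=> yD iD; have E : hgt = hgt - j.+1 + j.+1 by rewrite {1}hgtE addnC.
have -> : drev Dl hgt (secret_layer y i) =
    drev Dl (hgt - j.+1) off * Dl ^ j.+1 + drev Dl j.+1 (cell y i).
  by rewrite {1}E /secret_layer drev_add.
have zD := cell_lt yD iD; have dj := drev_lt Dl_gt0 j y.
have dj1 := drev_lt Dl_gt0 j.+1 (cell y i).
move: cD zD dj1; rewrite /off /left_start /middle /upds /hgt /cell; case: md => cD' zD dj1.
  rewrite drevK // !muln1 addn0 add0n /= modnMDl modn_small; last lia.
  rewrite divnMDl // divn_small ?addn0; last lia.
  have : (2 * i).+1 * Dl ^ j <= c * Dl ^ j by rewrite leq_mul2r; apply/orP; right; lia.
  by rewrite mulSn; lia.
rewrite subSS drevK //; move: dj1; set d := drev _ _ _; rewrite !expnSr mulnDl mulSn => dj1.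
by rewrite -!mulnA; nia.
Qed.

(** Among the secret layers up to the queried one, the given layer is the last; so the queried
    composition reveals it once the lower secrets are known. *)
Lemma secret_layer_witness y i : y < Dl ^ j -> i < D ->
  exists tau e, [/\ middle <= tau < right_end, e < qrys,
    secret_layer y i <= query_layer tau e
    & forall y' i', y' < Dl ^ j -> i' < D ->
        secret_layer y' i' <= secret_layer y i \/ query_layer tau e < secret_layer y' i'].
Proof.
move=> yD iD; have zD := cell_lt yD iD; set z := cell y i in zD *.
suff [tau [e [tR eq lo hi]]] : exists tau e, [/\ middle <= tau < right_end, e < qrys,
    z.+1 * width <= query_layer tau e & query_layer tau e < z.+2 * width].
  exists tau, e; split=> //.
    by rewrite /secret_layer -/z; move: lo; rewrite mulSn; have := off_lt; lia.
  move=> y' i' yD' iD'; rewrite /secret_layer -/z; set z' := cell y' i'.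
  case: (leqP z' z) => zz; [left|right].
    by rewrite leq_add2r leq_mul2r zz orbT.
  have z2 : z.+2 <= z' by move: zz; rewrite /z /z' /cell; case: md; lia.
  apply: leq_trans hi _; apply: (@leq_trans (z' * width)); last exact: leq_addr.
  by rewrite leq_mul2r z2 orbT.
move: cD zD; rewrite /middle /right_end /qrys /query_layer /width /hgt /z /cell.
case: md => cD'.
  rewrite add0n; set v := (y * Dl + _).+1 => vD.
  pose v' := drev Dl j.+1 v; have v'D : v' < Dl ^ j.+1 by apply: drev_lt.
  (* The [Dl ^ j] rounds of the child, with [Dl] queries each, run through all strings of [j.+1]
     digits; [v'] is the one whose reversal is the cell [v]. *)
  exists (P * Dl ^ j.+1 + c * Dl ^ j + v' %/ Dl), (v' %% Dl).
  have vq : v' %/ Dl < Dl ^ j by rewrite ltn_divLR // -expnSr.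
  have E : (P * Dl ^ j.+1 + c * Dl ^ j + v' %/ Dl) * Dl + v' %% Dl = (P * Dl + c) * Dl ^ j.+1 + v'.
    by rewrite mulnDl -addnA -divn_eq expnSr; lia.
  rewrite E (_ : H.+1 = j.+1 + (H - j)); last lia.
  rewrite drev_add // drevK //.
  have := drev_lt Dl_gt0 (H - j) (P * Dl + c); set r := drev _ _ _.
  have -> : H - j = (H - j.+1).+1 by lia.
  rewrite [Dl ^ (H - j.+1).+1]expnSr => rD.
  have -> : v * (Dl ^ (H - j.+1) * Dl) + r = v * Dl ^ (H - j.+1) * Dl + r by rewrite mulnA.
  rewrite divnMDl //.
  have : r %/ Dl < Dl ^ (H - j.+1) by rewrite ltn_divLR.
  have := ltn_pmod v' Dl_gt0.
  move: (r %/ Dl) (Dl ^ (H - j.+1)) => r' p mD rp; split=> //.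
  - move: vq; move: (v' %/ Dl) => vv vq; rewrite (mulSn c) -addnA !leq_add2l leq_addr /=.
    by rewrite ltn_add2l addnC ltn_add2r.
  - exact: leq_addr.
  - by rewrite (mulSn v) addnC ltn_add2r.
move=> zD; set d := 2 * D + 2 * i.
have dD : d.+1 < Dl by rewrite /d; lia.
(* A round of the child [d.+1], which comes after [c] because [c < 2 * D <= d]. *)
exists (P * Dl ^ j.+1 + (d.+1 * Dl ^ j + drev Dl j y)), 0.
have dy := drev_lt Dl_gt0 j y.
have h1 : d.+2 * Dl ^ j <= Dl ^ j.+1 by rewrite expnS leq_mul2r dD orbT.
have h2 : c.+1 * Dl ^ j <= d.+1 * Dl ^ j.
  by rewrite leq_mul2r; apply/orP; right; rewrite /d; lia.
have h3 : d.+1 * Dl ^ j + drev Dl j y < Dl ^ j.+1 by move: h1; rewrite (mulSn d.+1); lia.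
rewrite (_ : drev Dl H _ = drev Dl (j.+1 + (H - j.+1)) (P * Dl ^ j.+1 + (d.+1 * Dl ^ j + drev Dl j y))); last first.
  by congr (drev _ _ _); lia.
rewrite drev_add // drev_top //.
have := drev_lt Dl_gt0 (H - j.+1) P; set r := drev _ _ _ => rD.
have -> : H.+1 - j.+1 = (H - j.+1).+1 by lia.
rewrite [Dl ^ (H - j.+1).+1]expnSr [y * Dl + d.+1]addnS.
move: rD; move: (Dl ^ (H - j.+1)) (y * Dl + d).+1 => p z' rD; split=> //.
- by rewrite leq_add2l (leq_trans h2 (leq_addr _ _)) (mulSn P) addnC ltn_add2r.
- by rewrite mulnA leq_mul2r leq_addr orbT.
- by rewrite [_ * (p * _)]mulnA ltn_mul2r Dl_gt0 mulSn addnC ltn_add2r.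
Qed.

End Schedule.

(** * Correct data structures pass the tests *)

Section Correctness.

Variables (n k w : nat) (G : finType) (D : data_structure n w G).
Variables (ref : 'I_n) (vx : nat -> 'I_k -> 'I_n) (par : nat -> bool).
Implicit Types (ss : seq (step n G)).

Definition complete (ops : seq (operation n)) : Prop :=
  operations (canonical_steps D (init D) ops) = ops /\ accepted D (canonical_steps D (init D) ops).

Lemma accepted_cat ss ts : accepted D (ss ++ ts) =
  accepted D ss && all isSome [seq step_answer D p.1 p.2 | p <- trace D (memory_after D ss) ts].
Proof. by rewrite /accepted /answers trace_cat map_cat all_cat. Qed.

Lemma complete_updates ops us : complete ops -> complete (ops ++ [seq Update x | x <- us]).
Proof.
rewrite /complete canonical_cat accepted_cat /operations map_cat => -[-> ->] /=; split.
  by congr (_ ++ _); elim: us (run _ _ _) => //= x us IH M; rewrite IH.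
by rewrite /memory_after -/(run _ _ _); elim: us (run _ _ _) => //= x us IH M; rewrite IH.
Qed.

Lemma complete_query ops u ops' : complete ops -> correct_on D (ops ++ GetColor u :: ops') ->
  exists2 g, first_accept D (run D (init D) ops) u = Some g &
    complete (ops ++ [:: GetColor u]).
Proof.
move=> [e acc] [_ H]; have := H (canonical_steps D (init D) ops) u ops'; rewrite e => /(_ erefl acc)[g].
rewrite -cats1 accepted_cat acc /= andbT => hg.
pose Acc g := isSome (value (query_program D u g) (memory_after D (canonical_steps D (init D) ops))).
have [g' hg'] : exists y, ohead [seq z <- enum G | Acc z] = Some y by apply: (@ohead_filter_ex _ _ g).
have fa : first_accept D (run D (init D) ops) u = Some g' by [].
exists g' => //; rewrite /complete canonical_cat accepted_cat acc /= fa /operations map_cat /=.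
by rewrite -/(operations _) e andbT; split=> //; apply: ohead_filterP hg'.
Qed.

Lemma pmap_id_size (T : Type) (s : seq (option T)) : all isSome s -> size (pmap id s) = size s.
Proof. by rewrite size_pmap all_count => /eqP. Qed.

(** The canonical execution extended by any two accepting threads is accepted, and [correct_on]
    speaks of all such executions. With no update in between, both answers come from one
    coloring. *)
Lemma query_pair_correct ops u v g0 c0 g c : complete ops ->
  correct_on D (ops ++ [:: GetColor u; GetColor v]) ->
  value (query_program D u g0) (run D (init D) ops) = Some c0 ->
  value (query_program D v g) (final (query_program D u g0) (run D (init D) ops)) = Some c ->
  exists2 f : coloring n, Defs.proper f (graph_after finset.set0 ops) & c0 = f u /\ c = f v.
Proof.
move=> [e acc] [H _] v0 v1; set ss := canonical_steps _ _ _ in e acc.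
have := H (ss ++ [:: QueryStep u g0; QueryStep v g]).
rewrite /operations map_cat -/(operations ss) e => /(_ erefl).
rewrite accepted_cat acc /= v0 v1 => /(_ isT) [f [f0]].
rewrite /transcript /operations map_cat /= -/(operations ss) e /answers trace_cat map_cat /=.
rewrite pmap_cat zip_cat /=; last first.
  rewrite pmap_id_size // -/(answers D ss) size_map -e /operations size_map.
  by elim: (ss) (init D) => //= s ss' IH M; rewrite -(IH (step_final D M s)).
rewrite v0 /= v1 /= => /correct_from_cat[|//|f' f'E [-> [-> _]]]; last by exists f'.
rewrite pmap_id_size // -/(answers D ss) size_map -e /operations size_map.
by elim: (ss) (init D) => //= s ss' IH M; rewrite -(IH (step_final D M s)).
Qed.

Lemma run_ok_of_correct (xs : seq (atom n k)) :
  (forall ys l b zs, xs = ys ++ Test n l b :: zs ->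
     (forall f : coloring n, Defs.proper f (graph_after finset.set0 (atoms_ops ref vx ys)) ->
        forall b', (f ref (+) f (vx l b') == par l) = (b' == b)) /\
     (forall b', correct_on D (atoms_ops ref vx ys ++ [:: GetColor ref; GetColor (vx l b')]))) ->
  run_ok D ref vx par (init D) xs /\ complete (atoms_ops ref vx xs).
Proof.
elim/last_ind: xs => [|xs x IH] H; first by [].
have [okxs cxs] : run_ok D ref vx par (init D) xs /\ complete (atoms_ops ref vx xs).
  by apply: IH => ys l b zs e; apply: (H ys l b (rcons zs x)); rewrite e rcons_cat.
rewrite -cats1 run_ok_cat atoms_ops_cat.
case: x H => [us|l b] H /=; rewrite /(atoms_ops _ _ [:: _]) /= ?cats0.
  by split=> //; apply: complete_updates.
have [fo co] := H xs l b [::] (esym (cats1 _ _)).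
have [g0 f0 c0] := complete_query cxs (co b).
have := co b; rewrite -cat1s catA => cob.
have [g1 f1 c1] := complete_query c0 cob.
move: f1; rewrite run_cat {1}/run /= f0 /= => f1.
have a0 := ohead_filterP f0; rewrite /= in a0.
case v0: (value _ _) a0 => [d0|] // _.
split; last by move: c1; rewrite -catA.
split=> //; split=> //; exists g0, d0, g1; split=> // b' g c v1.
have [f fE [-> ->]] := query_pair_correct cxs (co b') v0 v1.
exact: fo.
Qed.

End Correctness.

(** * The hard operation sequences *)

Lemma iota0S m : iota 0 m.+1 = iota 0 m ++ [:: m].
Proof. by rewrite -addn1 iotaD. Qed.

Lemma cat_injl (T : Type) (s1 s2 t1 t2 : seq T) :
  size s1 = size t1 -> s1 ++ s2 = t1 ++ t2 -> s1 = t1 /\ s2 = t2.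
Proof.
elim: s1 t1 => [|x s1 IH] [|y t1] //= [sz] [-> /(IH _ sz)[-> ->]] //.
Qed.

Lemma cat_eq_cons (T : Type) (A B ys zs : seq T) x : A ++ B = ys ++ x :: zs ->
  (exists zs', A = ys ++ x :: zs') \/ (exists2 ys', ys = A ++ ys' & B = ys' ++ x :: zs).
Proof.
elim: A ys => [|a A IH] ys /=; first by move=> ->; right; exists ys.
case: ys => [|y ys] /= [-> e]; first by left; exists A.
by case: (IH _ e) => [[zs' ->]|[ys' -> ->]]; [left; exists zs'|right; exists ys'].
Qed.

Lemma flatten_map_inj (I T : Type) (f g : I -> seq T) (s : seq I) :
  (forall i, size (f i) = size (g i)) ->
  flatten (map f s) = flatten (map g s) -> map f s = map g s.
Proof. by move=> sz; elim: s => //= i s IH /(cat_injl (sz i))[-> /IH ->]. Qed.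

(** The updates depend only on the vertices whose successor changes; where the two pairs of states
    differ, neither changes anything. *)
Lemma transition_ext n (V : finType) (emb : V -> 'I_n) (f f' g g' : V -> option V) :
  (forall v, (f v = g v /\ f' v = g' v) \/ (f v = f' v /\ g v = g' v)) ->
  transition emb f f' = transition emb g g'.
Proof.
move=> h; rewrite /transition.
have -> : enum [pred x | f x != f' x] = enum [pred x | g x != g' x].
  by apply: eq_enum => v; rewrite !inE; case: (h v) => [[-> ->]|[-> ->]]; rewrite ?eqxx.
have inl_ v : v \in enum [pred x | g x != g' x] -> f v = g v /\ f' v = g' v.
  by rewrite mem_enum inE; case: (h v) => // -[_ ->]; rewrite eqxx.
congr (_ ++ _); rewrite /delete_ops /insert_ops; move: (enum _) inl_ => t.
  by elim: t => //= v s IH hs; rewrite (hs v _).1 ?inE ?eqxx // IH // => z zs; apply: hs; rewrite inE zs orbT.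
by elim: t => //= v s IH hs; rewrite (hs v _).2 ?inE ?eqxx // IH // => z zs; apply: hs; rewrite inE zs orbT.
Qed.

Lemma card_diff_trans (V : finType) (T : eqType) (f g h : V -> T) :
  #|[pred x | f x != h x]| <= #|[pred x | f x != g x]| + #|[pred x | g x != h x]|.
Proof.
apply: leq_trans (_ : #|[predU [pred x | f x != g x] & [pred x | g x != h x]]| <= _).
  by apply: subset_leq_card; apply/subsetP => x; rewrite !inE; case: (f x =P g x) => [->|].
by rewrite -cardUI leq_addr.
Qed.

Section Hard.

Variables (D0 H k0 : nat) (md : bool).
Hypothesis D0_gt0 : 0 < D0.

Notation Dl := (4 * D0).
Notation N := (layers D0 H md).
Notation k := k0.+1.
Notation hg := (hgt H md).
Notation us := (upds D0 md).
Notation qs := (qrys D0 md).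
Notation M := (Dl ^ H).

Definition secret : finType := {ffun 'I_N -> {perm 'I_k}}.

Let Dl_gt0 : 0 < Dl. Proof. lia. Qed.
Let us_gt0 : 0 < us. Proof. by rewrite /upds; case: md. Qed.
Let M_gt0 : 0 < M. Proof. by rewrite expn_gt0 Dl_gt0. Qed.

Implicit Types (X : secret).

(* The permutation of the layer [p] after the round [tau]. *)
Definition perm_at X (tau p : nat) : {perm 'I_k} :=
  if insub p is Some i then if drev Dl hg p < tau.+1 * us then X i else 1%g else 1%g.

Definition ftrack X (tau l : nat) (a : 'I_k) : 'I_k := track (perm_at X tau) l a.

Definition phase_state X (i : nat) : vertex N k0 -> option (vertex N k0) :=
  @follow N k0 (perm_at X (i %/ k)) (inord (i %% k)).

Definition prev_state X (i : nat) : vertex N k0 -> option (vertex N k0) :=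
  if i is i'.+1 then phase_state X i' else fun=> None.

Lemma chain_phase X i : chain (phase_state X i).
Proof. exact: chain_follow. Qed.

Lemma chain_prev X i : chain (prev_state X i).
Proof.
case: i => [|i]; last exact: chain_phase.
by have [idx ii _] := chain_phase X 0; exists idx.
Qed.

Variables (n : nat) (emb : vertex N k0 -> 'I_n).
Hypothesis emb_inj : injective emb.

Definition ref_vertex : 'I_n := emb (inr false).
Definition test_vertex (l : nat) (b : 'I_k) : 'I_n := emb (vtx N false l b).
Definition test_parity (l : nat) : bool := ~~ odd l.

Notation ops_of := (atoms_ops ref_vertex test_vertex).

(** Phase [i] belongs to round [i %/ k] and tests the track [i %% k]. The successor in [l] makes
    [track l] include the permutation of the queried layer. *)
Definition test_of X (i e : nat) : atom n k :=
  let l := (query_layer D0 H md (i %/ k) e).+1 in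
  Test n l (ftrack X (i %/ k) l (inord (i %% k))).

Definition phase_updates X i := transition emb (prev_state X i) (phase_state X i).

Definition phase X (i : nat) : seq (atom n k) :=
  Updates k (phase_updates X i) :: [seq test_of X i e | e <- iota 0 qs].

Definition atoms X (s e : nat) : seq (atom n k) :=
  flatten [seq phase X i | i <- iota (s * k) ((e - s) * k)].

Lemma atoms_cat X s m e : s <= m -> m <= e -> atoms X s e = atoms X s m ++ atoms X m e.
Proof.
move=> sm me; rewrite /atoms -flatten_cat -map_cat.
have -> : (e - s) * k = (m - s) * k + (e - m) * k by rewrite -mulnDl; congr (_ * _); lia.
by rewrite iotaD -mulnDl subnKC.
Qed.

Lemma leads_tests cls E X i s : leads cls E (ops_of [seq test_of X i e | e <- s]) E.
Proof.
elim: s => [|e s IH]; first exact: leads_nil.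
rewrite /= -cat1s atoms_ops_cat; apply: leads_cat IH.
by rewrite /atoms_ops /=.
Qed.

Lemma leads_updates cls X i : leads cls (edges emb (prev_state X i) setT)
  (ops_of [:: Updates k (phase_updates X i)]) (edges emb (phase_state X i) setT).
Proof.
rewrite /atoms_ops /= cats0; apply: leads_transition => //.
  exact: chain_prev.
exact: chain_phase.
Qed.

Lemma leads_phases cls X m : leads cls finset.set0
  (ops_of (flatten [seq phase X i | i <- iota 0 m])) (edges emb (prev_state X m) setT).
Proof.
elim: m => [|m IH].
  rewrite (_ : edges _ _ _ = finset.set0); first exact: leads_nil.
  by apply/setP => e; rewrite [RHS]in_set0; apply/negP => /edgesP[x [y []]].
rewrite iota0S map_cat flatten_cat atoms_ops_cat; apply: leads_cat IH _.
rewrite /= cats0 /phase -cat1s atoms_ops_cat.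
exact: leads_cat (leads_updates _ _ _) (leads_tests _ _ _ _ _).
Qed.

Lemma test_position cls X m ys l b zs :
  flatten [seq phase X i | i <- iota 0 m] = ys ++ Test n l b :: zs ->
  exists i, [/\ leads cls finset.set0 (ops_of ys) (edges emb (phase_state X i) setT),
    l <= N & b = ftrack X (i %/ k) l (inord (i %% k))].
Proof.
elim: m zs => [|m IH] zs; first by case: ys.
rewrite iota0S map_cat flatten_cat /= cats0.
move=> /(@cat_eq_cons (atom n k))[[zs' e]|[ys' -> e]]; first exact: IH e.
case: ys' e => [|x ys'] //= [<- e]; exists m.
rewrite -cat1s catA !atoms_ops_cat.
have [s1 [s2 [-> [-> ->]]]] : exists s1 s2, [/\ ys' = [seq test_of X m e | e <- s1],
   l = (query_layer D0 H md (m %/ k) s2).+1 & b = ftrack X (m %/ k) l (inord (m %% k))].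
  elim: (iota 0 qs) ys' e => [|e0 s IHs] [|x' ys'] //=.
    by case=> <- <- _; exists [::], e0.
  by case=> <- /IHs[s1 [s2 [-> -> ->]]]; exists (e0 :: s1), s2.
split=> //; last exact: query_layer_lt.
apply: leads_cat (leads_tests _ _ _ _ _); apply: leads_cat (leads_phases cls X m) _.
exact: leads_updates.
Qed.

Definition full X := atoms X 0 M.

Lemma fullE X : full X = flatten [seq phase X i | i <- iota 0 (M * k)].
Proof. by rewrite /full /atoms mul0n subn0. Qed.

Lemma legal_full cls X : legal cls (ops_of (full X)).
Proof.
rewrite fullE /legal; have [_ h] := leads_phases cls X (M * k).
by have := h [::]; rewrite cats0; apply.
Qed.

(** The sequence stops at its [i]-th atom and asks there for an arbitrary candidate. Wrong
    candidates are covered too, because [test_ok] must refute them. *)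
Definition test_seq X (i : nat) (b : 'I_k) : seq (operation n) :=
  if drop i (full X) is Test l _ :: _ then
    ops_of (take i (full X)) ++ [:: GetColor ref_vertex; GetColor (test_vertex l b)]
  else [::].

Lemma legal_test_seq cls X i b : legal cls (test_seq X i b).
Proof.
rewrite /test_seq; case E: (drop i (full X)) => [|[|l b'] zs] //.
have e : full X = take i (full X) ++ Test n l b' :: zs by rewrite -E cat_take_drop.
move: e; rewrite {1}fullE => /(test_position cls)[j [[_ h] _ _]].
exact: h.
Qed.

Lemma size_test_seq X i b : size (test_seq X i b) <= size (ops_of (full X)).
Proof.
rewrite /test_seq; case E: (drop i (full X)) => [|[|l b'] zs] //.
rewrite -[X in _ <= size (ops_of X)](cat_take_drop i) E atoms_ops_cat !size_cat leq_add2l.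
by rewrite /atoms_ops.
Qed.

Variables (w : nat) (G : finType) (D : data_structure n w G).

Definition ok X : Prop := forall i b, i < size (full X) -> correct_on D (test_seq X i b).

Lemma ok_run X : ok X ->
  run_ok D ref_vertex test_vertex test_parity (init D) (full X) /\ complete D (ops_of (full X)).
Proof.
move=> okX; apply: run_ok_of_correct => ys l b zs e; split.
  move=> f; move: (e); rewrite fullE => /(test_position PathUnions)[i [[-> _] lN ->]] pf b'.
  have := forced_color b' lN pf; rewrite /ref_vertex /test_vertex /test_parity => ->.
  by rewrite /ftrack; case: (odd l); case: (b' == _).
move=> b'; have := okX (size ys) b'; rewrite /test_seq e take_size_cat // drop_size_cat //.
by apply; rewrite size_cat /=; lia.
Qed.

Lemma num_updates_cat (s1 s2 : seq (operation n)) :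
  num_updates (s1 ++ s2) = num_updates s1 + num_updates s2.
Proof. exact: count_cat. Qed.

Lemma num_queries_cat (s1 s2 : seq (operation n)) :
  num_queries (s1 ++ s2) = num_queries s1 + num_queries s2.
Proof. exact: count_cat. Qed.

Lemma num_queries_full X : num_queries (ops_of (full X)) = M * k * (2 * qs).
Proof.
rewrite fullE; elim: (M * k) => [|m IH] //.
rewrite iota0S map_cat flatten_cat atoms_ops_cat num_queries_cat IH /= cats0.
rewrite mulSn addnC; congr (_ + _); rewrite /phase -cat1s atoms_ops_cat num_queries_cat.
rewrite /(atoms_ops _ _ [:: _]) /= cats0 {1}/num_queries count_map.
rewrite (@eq_count _ _ pred0) // count_pred0 add0n -[qs in RHS](size_iota 0).
by elim: (iota 0 qs) => // e s; rewrite /num_queries /atoms_ops /=; lia.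
Qed.

(** Two operations per changed successor: phase [0] builds the whole path, each later phase moves
    the splice, and the first phase of each later round also replaces [us] layers. *)
Lemma phase_updates_le X i :
  size (phase_updates X i) <=
  (if i == 0 then 2 * #|vertex N k0| else 0) + (12 + (if i %% k == 0 then 4 * (k * us) else 0)).
Proof.
apply: leq_trans (size_transition _ _ _) _; case: i => [|i].
  by apply: leq_trans (leq_addr _ _); rewrite leq_mul2l max_card.
rewrite add0n; set c := #|_|.
suff : c <= 6 + (if i.+1 %% k == 0 then 2 * (k * us) else 0) by case: ifP => _; lia.
rewrite {}/c; change (prev_state X i.+1) with (phase_state X i).
case: eqP => e.
  apply: leq_trans (card_diff_trans _ (@follow N k0 (perm_at X (i.+1 %/ k)) (inord (i %% k))) _) _.
  rewrite addnC leq_add //; first exact: follow_diff_flip.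
  have et : i.+1 %/ k = (i %/ k).+1.
    have := divn_eq i.+1 k; rewrite e addn0 => e1.
    have := divn_eq i k; have := ltn_pmod i (ltn0Sn k0) => h1 h2.
    have : i.+1 %/ k * k = i %/ k * k + (i %% k).+1 by lia.
    move: (i.+1 %/ k) (i %/ k) (i %% k) h1 => A B r h1 h.
    have AB : A <= B.+1 by rewrite -(leq_pmul2r (ltn0Sn k0)) mulSn; lia.
    have BA : B < A by rewrite -(ltn_pmul2r (ltn0Sn k0)); lia.
    by lia.
  have := @follow_diff_layers N k0 (perm_at X (i %/ k)) (perm_at X (i.+1 %/ k)) (inord (i %% k))
    [seq drev Dl hg t | t <- iota ((i %/ k).+1 * us) us].
  rewrite size_map size_iota; apply => p pN pL; rewrite /perm_at et; case: insubP => // q _ qp.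
  case: ltnP => h1; case: ltnP => h2 //; first by rewrite mulSn in h2; lia.
  case/negP: pL; apply/mapP; exists (drev Dl hg p); last by rewrite drevK.
  by rewrite mem_iota h1 [_ + us]addnC -mulSn.
rewrite addn0 /phase_state.
have -> : i.+1 %/ k = i %/ k.
  rewrite divnS // (_ : (k %| i.+1) = false) ?add0n //.
  by apply/negP => /eqP.
exact: follow_diff_flip.
Qed.

(** [28 = 12 + 12 + 4], for the initial path, the moves of the splice and the fresh permutations. *)
Lemma num_updates_full X : num_updates (ops_of (full X)) <= 28 * (M * us * k).
Proof.
have -> : num_updates (ops_of (full X)) = \sum_(0 <= i < M * k) size (phase_updates X i).
  rewrite fullE; elim: (M * k) => [|m IH]; first by rewrite big_geq.
  rewrite iota0S map_cat flatten_cat atoms_ops_cat num_updates_cat IH /= cats0.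
  rewrite big_nat_recr //=; congr (_ + _); rewrite /phase -cat1s atoms_ops_cat num_updates_cat.
  rewrite /(atoms_ops _ _ [:: _]) /= cats0 {1}/num_updates count_map.
  rewrite (@eq_count _ _ predT) // count_predT.
  by rewrite (_ : num_updates _ = 0) ?addn0 //; elim: (iota 0 qs).
apply: (@leq_trans (2 * #|vertex N k0| + (12 * (M * k) + M * (4 * (k * us))))).
  apply: leq_trans (leq_sum _ (fun i _ => phase_updates_le X i)) _.
  rewrite !big_split /=; apply: leq_add.
    have : 0 < M * k by rewrite muln_gt0 M_gt0.
    case: (M * k) => // m _; rewrite big_nat_recl //= big1 ?addn0 // => i _.
  apply: leq_add; first by rewrite sum_nat_const_nat subn0 mulnC.
  rewrite -sum_nat_blocks (eq_bigr (fun=> 4 * (k * us))); last first.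
    move=> P _; rewrite big_nat_recl //= modnMDl mod0n eqxx big_nat big1 ?addn0 // => c /andP[_ ck].
    by rewrite modnMDl modn_small.
  by rewrite sum_nat_const_nat subn0.
rewrite card_vertex layersE.
have h1 : k <= M * us * k by rewrite leq_pmull // muln_gt0 M_gt0.
have h2 : M * k <= M * us * k by rewrite -mulnA leq_mul2l leq_pmull ?orbT.
have h3 : M * (4 * (k * us)) = 4 * (M * us * k) by lia.
by lia.
Qed.

Definition mem_at X (s : nat) : memory w := run D (init D) (ops_of (atoms X 0 s)).

Definition round_cells X (tau : nat) : {set word w} :=
  [set a in run_touched D (mem_at X tau) (ops_of (atoms X tau tau.+1))].

Lemma mem_at_run X s e : s <= e -> mem_at X e = run D (mem_at X s) (ops_of (atoms X s e)).
Proof. by move=> se; rewrite /mem_at (atoms_cat X (leq0n s) se) atoms_ops_cat run_cat. Qed.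

Lemma atoms_nil X s : atoms X s s = [::].
Proof. by rewrite /atoms subnn. Qed.

Lemma span_round_cells X s e : s <= e ->
  span (round_cells X) s e = [set a in run_touched D (mem_at X s) (ops_of (atoms X s e))].
Proof.
move=> se; rewrite -(subnKC se); elim: (e - s) => [|d IH].
  by rewrite addn0 span_nil atoms_nil; apply/setP => a; rewrite !inE.
have h1 : s <= s + d by lia.
have h2 : s + d <= s + d.+1 by lia.
rewrite (span_cat _ h1 h2) IH (atoms_cat X h1 h2) atoms_ops_cat run_touched_cat.
rewrite addnS {1}/span big_nat1 /round_cells -mem_at_run //.
by apply/setP => a; rewrite !inE mem_cat.
Qed.

Lemma sum_round_cells X m : \sum_(0 <= tau < m) #|round_cells X tau| <=
  size (run_touched D (init D) (ops_of (atoms X 0 m))).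
Proof.
elim: m => [|m IH]; first by rewrite big_geq.
rewrite big_nat_recr //= (atoms_cat X (leq0n m) (leqnSn m)) atoms_ops_cat run_touched_cat.
rewrite size_cat leq_add // /round_cells -/(mem_at X m) cardsE; exact: card_size.
Qed.

(** * Recovering the secret permutations from the later tests *)

Section Rect.

Variables (j P c : nat).
Hypothesis jH : j < H.
Hypothesis PD : P < Dl ^ (H - j.+1).
Hypothesis cD : if md then 2 * D0 <= c < Dl else c < 2 * D0.

Notation sL := (left_start D0 md j P c).
Notation mm := (middle D0 md j P c).
Notation eR := (right_end D0 md j P c).
Notation slay := (secret_layer D0 H md j P c).

Let sLmm : sL <= mm. Proof. exact: left_middle. Qed.
Let mmeR : mm <= eR. Proof. exact (middle_right D0_gt0 jH PD cD). Qed.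
Let eRM : eR <= M. Proof. exact (right_end_le D0_gt0 jH PD cD). Qed.

Let lay (x : 'I_(Dl ^ j) * 'I_D0) : 'I_N :=
  Ordinal (secret_layer_lt D0_gt0 jH PD cD (ltn_ord x.1) (ltn_ord x.2)).

Definition secrets : {set 'I_N} := lay @: setT.

(** The context given to the decoder: all permutations except the secret ones. *)
Definition reset X : secret := [ffun p => if p \in secrets then 1%g else X p].

Lemma card_secrets : #|secrets| = D0 * Dl ^ j.
Proof.
rewrite card_imset ?cardsT ?card_prod ?card_ord 1?mulnC //.
move=> [y i] [y' i'] /(congr1 val) /=.
case/(secret_layer_inj D0_gt0 jH PD cD (ltn_ord i) (ltn_ord i')) => /val_inj -> /val_inj -> //.
Qed.

Let reset_out X X' p : reset X = reset X' -> p \notin secrets -> X p = X' p.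
Proof. by move=> /ffunP/(_ p) e /negPf h; move: e; rewrite !ffunE h. Qed.

Let secrets_time p : p \in secrets -> sL * us <= drev Dl hg p < mm * us.
Proof.
by move=> /imsetP[[y i] _ ->]; apply: secret_layer_time => //; apply: ltn_ord.
Qed.

Let perm_at_before X X' tau : reset X = reset X' -> tau < sL -> perm_at X tau = perm_at X' tau.
Proof.
move=> e ts; apply: boolp.funext => p; rewrite /perm_at; case: insubP => // q _ qp.
case: ifP => // h; apply: reset_out e _; apply/negP => /secrets_time/andP[+ _].
have : tau.+1 * us <= sL * us by rewrite leq_mul2r ts orbT.
by rewrite qp; move: h; lia.
Qed.

Let before_eq X X' : reset X = reset X' -> atoms X 0 sL = atoms X' 0 sL.
Proof.
move=> e; rewrite /atoms subn0 mul0n; congr flatten; apply/eq_in_map => i.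
rewrite mem_iota add0n => /andP[_ ik].
have dk : i %/ k < sL by rewrite ltn_divLR.
have dk' : i.-1 %/ k < sL by rewrite ltn_divLR //; lia.
rewrite /phase /phase_updates /test_of /ftrack /phase_state (perm_at_before e dk).
by case: i {ik dk} dk' => [|i] //= dk'; rewrite /phase_state (perm_at_before e dk').
Qed.

Let perm_at_after X X' tau tau' (p : nat) : reset X = reset X' -> mm <= tau'.+1 -> mm <= tau.+1 ->
  (perm_at X tau' p = perm_at X' tau' p /\ perm_at X tau p = perm_at X' tau p) \/
  (perm_at X tau' p = perm_at X tau p /\ perm_at X' tau' p = perm_at X' tau p).
Proof.
move=> e h h'; rewrite /perm_at; case: insubP => [q _ qp|_]; last by left.
case qI: (q \in secrets); last by left; rewrite (reset_out e) ?qI.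
have /andP[_] := secrets_time qI; rewrite qp => t; right.
have -> : drev Dl hg p < tau.+1 * us by apply: leq_trans t _; rewrite leq_mul2r h' orbT.
by have -> : drev Dl hg p < tau'.+1 * us by apply: leq_trans t _; rewrite leq_mul2r h orbT.
Qed.

(** All secrets are in force by [middle], so later updates change only layers on which [X] and [X']
    agree. The round just before [middle] is included because the first later phase starts from its
    state. *)
Let after_updates X X' i : reset X = reset X' -> mm * k <= i ->
  phase_updates X i = phase_updates X' i.
Proof.
move=> e; case: i => [|i] mi.
  by have := middle_gt0 D0_gt0 jH PD cD; move: mi; lia.
have t1 : mm <= (i %/ k).+1.
  by rewrite -(leq_pmul2r (ltn0Sn k0)) (leq_trans mi) // ltn_ceil.
have t2 : mm <= (i.+1 %/ k).+1.
  by apply: leq_trans t1 _; rewrite ltnS leq_div2r.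
have LP p := perm_at_after p e t1 t2.
apply: transition_ext => -[[[s l] b]|s]; last by left; case: s.
rewrite /prev_state /phase_state /follow; case: s.
  case: ifP => _; last by left.
  by case: (LP l.-1) => [[-> ->]|[-> ->]]; [left|right].
case: ifP => _; last by left.
by case: (LP l) => [[-> ->]|[-> ->]]; [left|right].
Qed.

Let after_similar X X' : reset X = reset X' -> all_similar (atoms X mm eR) (atoms X' mm eR).
Proof.
move=> e; rewrite /atoms.
have : {in iota (mm * k) ((eR - mm) * k), forall i, mm * k <= i}.
  by move=> i; rewrite mem_iota => /andP[].
elim: iota => // i s IH hs.
change (all_similar (phase X i ++ flatten (map (phase X) s))
                    (phase X' i ++ flatten (map (phase X') s))).
apply: all_similar_cat.
  rewrite /phase /=; split; last by apply: all_similar_map.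
  by apply: after_updates => //; apply: hs; rewrite inE eqxx.
by apply: IH => z zs; apply: hs; rewrite inE zs orbT.
Qed.

(** At the lowest layer where [X] and [X'] differ, the witness query composes its permutation with
    factors that agree: the lower ones by minimality, the higher ones because they are not secret.
    [track_inj] then refutes the difference. *)
Let after_inj X X' : reset X = reset X' -> atoms X mm eR = atoms X' mm eR -> X = X'.
Proof.
move=> e /flatten_map_inj eqp.
have {eqp}/eq_in_map eqp := eqp (fun i => etrans (congr1 S (size_map _ _)) (esym (congr1 S (size_map _ _)))).
apply/ffunP => p0; apply/eqP; apply: contraT => ne0.
pose p := [arg min_(p < p0 | X p != X' p) (p : nat)].
have [{}ne pmin] : X p != X' p /\ forall q, X q != X' q -> p <= q.
  by rewrite /p; case: arg_minnP.
have pI : p \in secrets by apply: contraNT ne => /(reset_out e)->.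
case/imsetP: (pI) => -[y i] _ pE.
have pEn : p = slay y i :> nat by rewrite pE.
have [tau [f [tR fq lo hi]]] := secret_layer_witness D0_gt0 jH PD cD (ltn_ord y) (ltn_ord i).
set l := query_layer _ _ _ _ _ in lo hi.
have et : track (perm_at X tau) l.+1 = track (perm_at X' tau) l.+1.
  (* The [k] phases of round [tau] test one track each, and their candidates are the values of the
     composed permutation. *)
  apply/permP => a.
  have ii : tau * k + a \in iota (mm * k) ((eR - mm) * k).
    rewrite mem_iota -mulnDl subnKC //.
    case/andP: tR => t1 t2; rewrite (leq_trans _ (leq_addr _ _)) ?leq_mul2r ?t1 ?orbT //=.
    apply: (@leq_trans (tau.+1 * k)); last by rewrite leq_mul2r t2 orbT.
    by rewrite mulSn addnC ltn_add2r.
  have [_ /eq_in_map/(_ f)] := eqp _ ii.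
  rewrite mem_iota /= fq => /(_ isT).
  rewrite /test_of divnMDl // divn_small // addn0 modnMDl modn_small // inord_val => -[].
  by [].
have : perm_at X tau p = perm_at X' tau p.
  apply: track_inj et => [|q ql qp]; first by rewrite ltnS pEn.
  rewrite /perm_at; case: insubP => // q' _ q'q; case: ifP => // _; subst q.
  case qI: (q' \in secrets); last by apply: reset_out e _; rewrite qI.
  apply/eqP; apply: contraT => /pmin pq.
  case/imsetP: qI => -[y' i'] _ /(congr1 (@nat_of_ord _)) /= q'E.
  have := hi _ _ (ltn_ord y') (ltn_ord i'); rewrite -q'E -pEn.
  by move: ql qp pq; rewrite -![\val q']/(nat_of_ord q'); clear; lia.
have /andP[_ tp] := secrets_time pI.
rewrite /perm_at valK (leq_trans tp) => [/eqP|]; first by rewrite (negPf ne).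
by rewrite leq_mul2r; case/andP: tR => t1 _; rewrite (leq_trans t1) ?orbT.
Qed.

Notation chd X := (child (round_cells X) Dl j P c).
Notation oth X := (others (round_cells X) Dl md j P c).

Lemma rectangle_bound (Q x y m : nat) (Gd : {set secret}) :
  (forall X, X \in Gd -> [/\ ok X, #|chd X| <= x, #|oth X| <= y & #|chd X :&: oth X| <= m]) ->
  #|Gd| * Q ^ y * k`! ^ (D0 * Dl ^ j) <=
  k`! ^ N * (2 ^ w * 2 ^ w).+1 ^ m * Q.+1 ^ (x + y).
Proof.
move=> HG.
pose C := [set X : secret | [forall p in secrets, X p == 1%g]].
have cC : #|C| * k`! ^ (D0 * Dl ^ j) = k`! ^ N.
  have := card_fixed_ffun secrets (1%g : {perm 'I_k}).
  by rewrite card_secrets card_ord -card_Sn cardsE.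
have := @rectangle_count secret n k w G D ref_vertex test_vertex test_parity reset C
  (fun X => mem_at X sL) (fun X => ops_of (atoms X sL mm)) (fun X => atoms X mm eR)
  _ _ after_similar after_inj md Q x y m Gd.
rewrite -cC => h.
suff h' : #|Gd| * Q ^ y <= #|C| * (2 ^ w * 2 ^ w).+1 ^ m * Q.+1 ^ (x + y).
  have := leq_mul h' (leqnn (k`! ^ (D0 * Dl ^ j))); lia.
apply: h.
- move=> X; rewrite inE; apply/forall_inP => p pI; by rewrite ffunE pI.
- by move=> X X' e; rewrite /mem_at (before_eq e).
move=> X /HG[okX cx oy tm].
have [+ _] := ok_run okX; rewrite /full (atoms_cat X (leq0n _) (leq_trans mmeR eRM)).
rewrite (atoms_cat X mmeR eRM) !run_ok_cat -/(mem_at X mm) => -[_ [okR _]].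
rewrite -mem_at_run // -!span_round_cells //.
have E : span (round_cells X) sL mm = (if md then oth X else chd X) /\
         span (round_cells X) mm eR = (if md then chd X else oth X).
  rewrite /others /child /left_start /middle /right_end; case: md; by rewrite ?addn0.
case: E => -> ->; split=> //; move: cx oy tm; case: md => //.
by rewrite setIC.
Qed.

End Rect.

End Hard.

From mathcomp Require Import all_order all_algebra ring lra reals.

Import Order.TTheory GRing.Theory Num.Theory.
Local Open Scope ring_scope.

(** * The information transfer at all time scales *)

Lemma markov_threshold (F : realFieldType) (a r v : F) : 0 < a -> 0 < r ->
  3 * a * v / (48 * a / r) = r * (v / 16).
Proof. by move=> a0 r0; field; rewrite !gt_eqF. Qed.

Lemma markov_threshold_scaled (F : realFieldType) (d a r v : F) : 0 < d -> 0 < a -> 0 < r ->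
  d * (3 * a * v) / (d * (48 * a / r)) = r * (v / 16).
Proof. by move=> d0 a0 r0; field; rewrite !gt_eqF. Qed.

Section Transfer.

Variables (R : realType) (D0 H k0 : nat) (md : bool).
Hypothesis D0_gt0 : (0 < D0)%N.

Notation Dl := (4 * D0)%N.
Notation N := (layers D0 H md).
Notation k := k0.+1.
Notation secret := (secret D0 H k0 md).

Variables (n : nat) (emb : vertex N k0 -> 'I_n).
Hypothesis emb_inj : injective emb.
Variables (w : nat) (G : finType) (D : data_structure n w G).
Variables (Ok : {set secret}) (Tot mu : R).
Hypothesis Tot_gt0 : 0 < Tot.
Hypothesis mu_gt0 : 0 < mu.
Hypothesis Ok_ok : forall X, X \in Ok -> ok emb D X.
Hypothesis Ok_big : (16 * #|~: Ok| <= #|{: secret}|)%N.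

Notation cells := (@round_cells D0 H k0 md n emb w G D).
Notation cost X := (\sum_(0 <= i < Dl ^ H) #|cells X i|)%N.

Hypothesis Ok_cost : \sum_(X in Ok) (cost X)%:R <= 3 * Tot * #|{: secret}|%:R.

(** The number of rectangles at level [j]: all parents, with half of their [Dl] children. *)
Definition rects j : R := (2 * D0 * Dl ^ (H - j.+1))%:R.

(** [48 = 16 * 3]: the first two thresholds are 16 times the averages that [Ok_cost] allows. The
    conclusion says that the code is too short for more than one secret in 16. *)
Hypothesis numeric : forall j (x y m : nat), (j < H)%N ->
  x%:R <= 48 * Tot / rects j -> y%:R <= Dl%:R * (48 * Tot / rects j) ->
  m%:R <= mu * Dl%:R ^+ j.+1 ->
  (16 * ((2 ^ w * 2 ^ w).+1 ^ m * Dl ^ (x + y)) <= Dl.-1 ^ y * k`! ^ (D0 * Dl ^ j))%N.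

Let Dl_gt0 : (0 < Dl)%N. Proof. lia. Qed.
Let DlR_gt0 : 0 < Dl%:R :> R. Proof. by rewrite ltr0n. Qed.

Let rects_gt0 j : 0 < rects j.
Proof. by rewrite ltr0n !muln_gt0 D0_gt0 expn_gt0 Dl_gt0. Qed.

Let base := if md then (2 * D0)%N else 0%N.

Let half_sum (f : nat -> nat) :
  (\sum_(0 <= i < 2 * D0) f (base + i) <= \sum_(0 <= c < Dl) f c)%N.
Proof.
have h1 : (base <= base + 2 * D0)%N by lia.
have h2 : (base + 2 * D0 <= Dl)%N by rewrite /base; case: md; lia.
rewrite (big_cat_nat (leq0n base) (leq_trans h1 h2)) /= (big_cat_nat h1 h2) /=.
have -> : (\sum_(base <= c < base + 2 * D0) f c = \sum_(0 <= i < 2 * D0) f (base + i))%N.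
  rewrite -{1}[base]add0n big_addn addKn; apply: eq_bigr => i _; by rewrite addnC.
by lia.
Qed.

Section Level.

Variable j : nat.
Hypothesis jH : (j < H)%N.

Let x := 48 * Tot / rects j.
Let y := Dl%:R * x.
Let m := mu * Dl%:R ^+ j.+1.

Let x_gt0 : 0 < x. Proof. by rewrite divr_gt0 // mulr_gt0 // ltr0n. Qed.
Let y_gt0 : 0 < y. Proof. by rewrite mulr_gt0. Qed.
Let m_gt0 : 0 < m. Proof. by rewrite mulr_gt0 // exprn_gt0. Qed.

Let ch X P c := #|child (cells X) Dl j P c|.
Let ot X P c := #|others (cells X) Dl md j P c|.
Let tr X P c := #|child (cells X) Dl j P c :&: others (cells X) Dl md j P c|.

(** Markov's inequality in additive form: a secret outside [Gd] exceeds one of the three thresholds,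
    so its summand is at least [1]. In this form the rectangles can be summed before any average is
    taken. *)
Let rect_bound P i c : (P < Dl ^ (H - j.+1))%N -> (i < 2 * D0)%N -> c = (base + i)%N ->
  #|Ok|%:R <= #|{: secret}|%:R / 16 +
    \sum_(X in Ok) ((ch X P c)%:R / x + (ot X P c)%:R / y + (tr X P c)%:R / m).
Proof.
move=> PD iD ce.
pose Gd := [set X in Ok | [&& (ch X P c <= Num.truncn x)%N, (ot X P c <= Num.truncn y)%N
                            & (tr X P c <= Num.truncn m)%N]].
have cD : if md then (2 * D0 <= c < Dl)%N else (c < 2 * D0)%N.
  by rewrite ce /base; case: md; lia.
have GdB : (16 * #|Gd| <= #|{: secret}|)%N.
  have h := @rectangle_bound D0 H k0 md D0_gt0 n emb emb_inj w G D j P c jH PD cD Dl.-1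
    (Num.truncn x) (Num.truncn y) (Num.truncn m) Gd.
  have -> : #|{: secret}| = (k`! ^ N)%N by rewrite card_ffun card_ord -card_Sn.
  have num := @numeric j (Num.truncn x) (Num.truncn y) (Num.truncn m) jH.
  have {}num := num (etrans (truncn_le _) (ltW x_gt0)) (etrans (truncn_le _) (ltW y_gt0))
                    (etrans (truncn_le _) (ltW m_gt0)).
  have {}h : (#|Gd| * Dl.-1 ^ Num.truncn y * k`! ^ (D0 * Dl ^ j) <=
    k`! ^ N * ((2 ^ w * 2 ^ w).+1 ^ Num.truncn m) * Dl ^ (Num.truncn x + Num.truncn y))%N.
    move: h; rewrite (prednK Dl_gt0); apply=> X; rewrite inE => /andP[XO /and3P[h1 h2 h3]].
    by split=> //; apply: Ok_ok.
  have Z0 : (0 < Dl.-1 ^ Num.truncn y * k`! ^ (D0 * Dl ^ j))%N.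
    by rewrite muln_gt0 !expn_gt0 fact_gt0 orTb andbT; apply/orP; left; lia.
  rewrite -(leq_pmul2r Z0).
  move: h num; set a1 := (_ ^ Num.truncn y)%N; set a2 := (k`! ^ (_ * _))%N.
  set a3 := (k`! ^ N)%N; set a4 := (_.+1 ^ _)%N; set a5 := (Dl ^ _)%N => h num.
  have h' : (16 * (#|Gd| * a1 * a2) <= 16 * (a3 * a4 * a5))%N by rewrite leq_mul2l h orbT.
  have num' : (a3 * (16 * (a4 * a5)) <= a3 * (a1 * a2))%N by rewrite leq_mul2l num orbT.
  by lia.
have -> : #|Ok|%:R = #|Gd|%:R + #|Ok :\: Gd|%:R :> R.
  rewrite -natrD; congr _%:R; rewrite -[LHS](cardsID Gd); congr (_ + _)%N.
  by congr #|pred_of_set _|; apply/setP => X; rewrite !inE; case: (X \in Ok).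
apply: lerD.
  by rewrite ler_pdivlMr ?ltr0n // mulrC -natrM ler_nat.
apply: (@le_trans _ _ (\sum_(X in Ok :\: Gd)
    ((ch X P c)%:R / x + (ot X P c)%:R / y + (tr X P c)%:R / m))).
  rewrite -sum1_card natr_sum; apply: ler_sum => X; rewrite !inE => /andP[+ XO].
  rewrite XO /= !negb_and -!ltnNge.
  have c0 : 0 <= (ch X P c)%:R / x by rewrite divr_ge0 // ltW.
  have o0 : 0 <= (ot X P c)%:R / y by rewrite divr_ge0 // ltW.
  have t0 : 0 <= (tr X P c)%:R / m by rewrite divr_ge0 // ltW.
  have K (z : R) (q : nat) : 0 < z -> (Num.truncn z < q)%N -> 1 <= q%:R / z.
    by move=> z0; rewrite (truncn_lt_nat _ (ltW z0)) => h; rewrite ler_pdivlMr // mul1r ltW.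
  by case/or3P => [/(K _ _ x_gt0)|/(K _ _ y_gt0)|/(K _ _ m_gt0)] h; lra.
rewrite [leRHS](big_setID (Ok :&: Gd)) /= addrC.
have -> : Ok :\: (Ok :&: Gd) = Ok :\: Gd.
  by apply/setP => X; rewrite !inE; case: (X \in Ok); rewrite ?andbF.
rewrite lerDl sumr_ge0 // => X _.
by rewrite !addr_ge0 // divr_ge0 // ltW.
Qed.

Let TR := \sum_(X in Ok) (\sum_(0 <= P < Dl ^ (H - j.+1)) \sum_(0 <= c < Dl) tr X P c)%:R : R.

(** Of the fraction [15 / 16] of good secrets, [1 / 16] each is lost to [Gd] and to too many probes
    on either side; more than half must exceed the transfer threshold. *)
Lemma level_transfer : m * rects j * #|{: secret}|%:R / 2 <= TR.
Proof.
pose W := #|{: secret}|%:R : R.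
have sum3 : rects j * #|Ok|%:R <= rects j * (W / 16) +
   \sum_(X in Ok) (\sum_(0 <= P < Dl ^ (H - j.+1)) \sum_(0 <= c < Dl) ch X P c)%:R / x +
   \sum_(X in Ok) (\sum_(0 <= P < Dl ^ (H - j.+1)) \sum_(0 <= c < Dl) ot X P c)%:R / y +
   TR / m.
  have E (z : R) : rects j * z = \sum_(0 <= P < Dl ^ (H - j.+1)) \sum_(0 <= i < 2 * D0) z.
    rewrite !sumr_const_nat !subn0 -[_ *+ (2 * D0)]mulr_natr -[_ *+ (Dl ^ _)]mulr_natr.
    by rewrite /rects natrM; ring.
  rewrite !E.
  apply: (@le_trans _ _ (\sum_(0 <= P < Dl ^ (H - j.+1)) \sum_(0 <= i < 2 * D0)
    (W / 16 + \sum_(X in Ok) ((ch X P (base + i)%N)%:R / x + (ot X P (base + i)%N)%:R / y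
                              + (tr X P (base + i)%N)%:R / m)))).
    rewrite big_nat [leRHS]big_nat; apply: ler_sum => P /andP[_ PD].
    rewrite big_nat [leRHS]big_nat; apply: ler_sum => i /andP[_ iD].
    exact: (rect_bound PD iD).
  have S (f : secret -> nat -> nat -> nat) (z : R) : 0 < z ->
     \sum_(0 <= P < Dl ^ (H - j.+1)) \sum_(0 <= i < 2 * D0) \sum_(X in Ok) (f X P (base + i)%N)%:R / z
     <= \sum_(X in Ok) (\sum_(0 <= P < Dl ^ (H - j.+1)) \sum_(0 <= c < Dl) f X P c)%:R / z.
    move=> z0; under eq_bigr do rewrite exchange_big /=.
    rewrite exchange_big /=; apply: ler_sum => X _.
    rewrite natr_sum mulr_suml; apply: ler_sum => P _.
    rewrite -mulr_suml -natr_sum; apply: ler_wpM2r; first by rewrite invr_ge0 ltW.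
    by rewrite ler_nat; apply: half_sum.
  under eq_bigr do rewrite big_split /=.
  rewrite big_split /= -!addrA lerD2l.
  under eq_bigr do under eq_bigr do rewrite big_split /= big_split /=.
  under eq_bigr do rewrite big_split /= big_split /=.
  rewrite big_split /= big_split /= -addrA.
  apply: lerD; first exact: S.
  apply: lerD; first exact: S.
  by rewrite /TR mulr_suml; apply: S.
have W0 : 0 <= W by [].
have r0 := rects_gt0 j.
have S1 : \sum_(X in Ok) (\sum_(0 <= P < Dl ^ (H - j.+1)) \sum_(0 <= c < Dl) ch X P c)%:R / x
   <= rects j * (W / 16).
  apply: (@le_trans _ _ ((3 * Tot * W) / x)).
    rewrite -mulr_suml; apply: ler_wpM2r; first by rewrite invr_ge0 ltW.
    apply: le_trans Ok_cost.
    by apply: ler_sum => X _; rewrite ler_nat; apply: child_sum.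
  by rewrite /x markov_threshold.
have S2 : \sum_(X in Ok) (\sum_(0 <= P < Dl ^ (H - j.+1)) \sum_(0 <= c < Dl) ot X P c)%:R / y
   <= rects j * (W / 16).
  apply: (@le_trans _ _ ((Dl%:R * (3 * Tot * W)) / y)).
    rewrite -mulr_suml; apply: ler_wpM2r; first by rewrite invr_ge0 ltW.
    apply: le_trans (ler_wpM2l (ltW DlR_gt0) Ok_cost); rewrite mulr_sumr.
    by apply: ler_sum => X _; rewrite -natrM ler_nat; apply: others_sum.
  by rewrite /y /x markov_threshold_scaled.
have okW : 15 / 16 * W <= #|Ok|%:R.
  have : (16 * #|~: Ok|)%:R <= W by rewrite ler_nat.
  have : #|Ok|%:R + #|~: Ok|%:R = W by rewrite -natrD cardsC.
  by rewrite natrM => <-; lra.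
have : rects j * (15 / 16 * W) <= rects j * #|Ok|%:R by rewrite ler_wpM2l // ltW.
have rW0 : 0 <= rects j * W by rewrite mulr_ge0 // ltW.
move=> h; have {h} : rects j * W / 2 <= TR / m by lra.
rewrite ler_pdivlMr // => h; apply: le_trans h; rewrite le_eqVlt; apply/orP; left; apply/eqP.
by rewrite /W; field.
Qed.

End Level.

(** [m * rects j] does not depend on the level, so all [H] levels contribute equally to the sum
    bounded by [transfer_sum]. *)
Lemma transfer_bound : H%:R * mu * Dl%:R ^+ H.+1 <= 12 * Tot.
Proof.
pose W := #|{: secret}|%:R : R.
have W0 : 0 < W by rewrite ltr0n; apply/card_gt0P; exists [ffun=> 1%g].
have h1 : \sum_(0 <= j < H) mu * Dl%:R ^+ j.+1 * rects j * W / 2 <= 3 * Tot * W.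
  apply: le_trans Ok_cost.
  apply: (@le_trans _ _ (\sum_(0 <= j < H) \sum_(X in Ok) (\sum_(0 <= P < Dl ^ (H - j.+1))
     \sum_(0 <= c < Dl) #|child (cells X) Dl j P c :&: others (cells X) Dl md j P c|)%:R)).
    rewrite big_nat [leRHS]big_nat; apply: ler_sum => j /andP[_ jH].
    exact: level_transfer.
  rewrite exchange_big /=; apply: ler_sum => X _.
  by rewrite -natr_sum ler_nat; apply: transfer_sum.
have E : \sum_(0 <= j < H) mu * Dl%:R ^+ j.+1 * rects j * W / 2 =
    H%:R * mu * Dl%:R ^+ H.+1 * W / 4.
  rewrite (eq_big_nat _ _ (F2 := fun=> mu * Dl%:R ^+ H.+1 * W / 4)).
    by rewrite sumr_const_nat subn0 -[_ *+ H]mulr_natr; field.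
  move=> j /andP[_ jH].
  have -> : rects j = Dl%:R / 2 * Dl%:R ^+ (H - j.+1).
    by rewrite /rects natrM natrX; congr (_ * _); rewrite !natrM; field.
  have -> : Dl%:R ^+ H.+1 = Dl%:R ^+ j.+1 * Dl%:R ^+ (H - j.+1) * Dl%:R :> R.
    by rewrite -exprD subnKC // -exprSr.
  set A := _ ^+ j.+1; set B := _ ^+ (H - _); set C := Dl%:R; clearbody A B C.
  by field.
rewrite E in h1.
have : H%:R * mu * Dl%:R ^+ H.+1 * W <= 12 * Tot * W by lra.
by rewrite ler_pM2r.
Qed.

End Transfer.

From mathcomp Require Import all_classical all_reals all_analysis.
From mathcomp Require Import measurable_realfun.

Import Order.TTheory GRing.Theory Num.Theory.

(** * Averaging over the random outcome *)

Section Derandomize.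

Variables (R : realType) (d : measure_display) (T : measurableType d) (P : probability T R).

Lemma exists_below_expectation (f : T -> \bar R) (c : R) :
  measurable_fun [set: T]%classic f -> (forall t, (0 <= f t)%E) ->
  (\int[P]_t f t < c%:E)%E -> exists t, (f t < c%:E)%E.
Proof.
move=> mf f0 fc; apply: contrapT => nex.
have c0 : 0 <= c.
  rewrite -lee_fin; apply: le_trans (ltW fc); exact: integral_ge0.
suff : (c%:E <= \int[P]_t f t)%E by rewrite leNgt fc.
have -> : c%:E = (\int[P]_t (cst c%:E t))%E.
  by rewrite integral_cst //= probability_setT mule1.
apply: ge0_le_integral => //=.
move=> t _; rewrite leNgt; apply/negP => h; apply: nex; by exists t.
Qed.

(** Failures and costs must be small under the same outcome, hence a single weighted sum. The choice
    [g k = 0] serves indices where no accepted execution is at hand. *)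
Lemma exists_good_outcome (J K : finType) (B : J -> set T) (p : R)
    (X : K -> T -> nat -> Prop) (b : R) (alpha beta c : R) :
  0 <= alpha -> 0 <= beta ->
  (forall j, measurable (B j) /\ (P (B j) <= p%:E)%E) ->
  (forall k, Defs.expectation_le P (X k) b) ->
  alpha * (#|J|%:R * p) + beta * (#|K|%:R * b) < c ->
  exists t, forall (S : {set J}) (g : K -> nat),
    (forall j, j \in S -> B j t) -> (forall k, g k = 0%N \/ X k t (g k)) ->
    alpha * #|S|%:R + beta * \sum_k (g k)%:R < c.
Proof.
move=> a0 b0 HB HX Hc.
have /choice[f Hf] : forall k, exists f : T -> \bar R,
    [/\ measurable_fun [set: T]%classic f, (forall t, (0 <= f t)%E),
        (forall t i, X k t i -> ((i%:R : R)%:E <= f t)%E) & (\int[P]_t f t <= b%:E)%E].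
  exact: HX.
pose F1 t := (\sum_(j <- enum J) (alpha%:E * (\1_(B j) t)%:E))%E.
pose F2 t := (\sum_(k <- enum K) (beta%:E * f k t))%E.
have m1 j : measurable_fun [set: T]%classic (fun t => (alpha%:E * (\1_(B j) t)%:E)%E).
  apply: emeasurable_funM => //; apply/measurable_EFinP.
  by apply: measurable_indic; case: (HB j).
have m2 k : measurable_fun [set: T]%classic (fun t => (beta%:E * f k t)%E).
  by apply: emeasurable_funM => //; case: (Hf k).
have p1 j t : (0 <= alpha%:E * (\1_(B j) t)%:E)%E.
  by rewrite mule_ge0 // ?lee_fin.
have p2 k t : (0 <= beta%:E * f k t)%E.
  by rewrite mule_ge0 // ?lee_fin //; case: (Hf k).
have I1 : (\int[P]_t F1 t <= (alpha * (#|J|%:R * p))%:E)%E.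
  rewrite /F1 ge0_integral_sum //.
  apply: (@le_trans _ _ (\sum_(j <- enum J) (alpha * p)%:E)%E).
    apply: lee_sum => j _; rewrite ge0_integralZl //; last first.
      by apply/measurable_EFinP; apply: measurable_indic; case: (HB j).
    rewrite integral_indic ?setIT //; last by case: (HB j).
    rewrite EFinM; apply: lee_wpmul2l; first by rewrite lee_fin.
    by case: (HB j).
  by rewrite sumEFin lee_fin big_enum /= sumr_const cardT -cardE -[in X in X <= _]mulr_natl mulrCA.
have I2 : (\int[P]_t F2 t <= (beta * (#|K|%:R * b))%:E)%E.
  rewrite /F2 ge0_integral_sum //.
  apply: (@le_trans _ _ (\sum_(k <- enum K) (beta * b)%:E)%E).
    apply: lee_sum => k _; have [mf f0 _ fb] := Hf k; rewrite ge0_integralZl //.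
    by rewrite EFinM; apply: lee_wpmul2l; rewrite ?lee_fin.
  by rewrite sumEFin lee_fin big_enum /= sumr_const cardT -cardE -[in X in X <= _]mulr_natl mulrCA.
have mF1 : measurable_fun [set: T]%classic F1 by apply: emeasurable_sum.
have mF2 : measurable_fun [set: T]%classic F2 by apply: emeasurable_sum.
have F10 t : (0 <= F1 t)%E by apply: sume_ge0 => j _.
have F20 t : (0 <= F2 t)%E by apply: sume_ge0 => k _.
have [|t||t Ht] := @exists_below_expectation (F1 \+ F2)%E c.
- exact: emeasurable_funD.
- exact: adde_ge0.
- rewrite ge0_integralD //.
  by apply: le_lt_trans (leeD I1 I2) _; rewrite -EFinD lte_fin.
exists t => S g hS hg; rewrite -lte_fin; apply: le_lt_trans Ht.
rewrite EFinD /=; apply: leeD.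
  rewrite /F1 big_enum /= (bigID (mem S)) /=.
  rewrite -[X in (X <= _)%E]adde0; apply: leeD; last by apply: sume_ge0.
  rewrite (eq_bigr (fun=> alpha%:E)).
    by rewrite sumEFin lee_fin sumr_const mulr_natr.
  by move=> j jS; rewrite indicE mem_set ?mule1 //; apply: hS.
rewrite /F2 big_enum /= mulr_sumr -sumEFin; apply: lee_sum => k _.
rewrite EFinM; apply: lee_wpmul2l; first by rewrite lee_fin.
have [_ f0 fX _] := Hf k; case: (hg k) => [->|/fX //].
exact: f0.
Qed.

End Derandomize.

(** * The trade-off for randomized data structures *)

Lemma le_ln_sub1 (R : realType) (x : R) : 0 < x -> ln x <= x - 1.
Proof.
move=> x0; have := expR_ge1Dx (ln x); rewrite lnK ?posrE //; lra.
Qed.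

Lemma ln_succ_le (R : realType) (a : R) : 0 < a -> a * (ln (a + 1) - ln a) <= 1.
Proof.
move=> a0; have a1 : 0 < a + 1 by rewrite addr_gt0.
have := le_ln_sub1 (divr_gt0 a1 a0); rewrite ln_div ?posrE //.
have -> : (a + 1) / a - 1 = a^-1 by field; rewrite gt_eqF.
by move=> /(ler_wpM2l (ltW a0)); rewrite divff ?gt_eqF.
Qed.

(** The elementary half of Stirling's formula, from [k * ln (1 + 1 / k) <= 1]. *)
Lemma ln_fact_ge (R : realType) (k : nat) :
  (0 < k)%N -> k%:R * ln (k%:R : R) - k%:R <= ln (k`!%:R).
Proof.
elim: k => // -[|k] IH _; first by rewrite /= ln1; lra.
rewrite factS natrM lnM ?posrE ?ltr0n ?fact_gt0 //.
have {}IH := IH isT; have a0 : 0 < k.+1%:R :> R by rewrite ltr0n.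
have := ln_succ_le a0; have -> : k.+2%:R = k.+1%:R + 1 :> R by rewrite -natr1.
move: (k.+1%:R) (k.+1`!%:R) IH a0 => a b; rewrite mulrBr mulrDl mul1r.
by lra.
Qed.

Lemma ln2_le1 (R : realType) : ln (2 : R) <= 1.
Proof. by have := @le_ln_sub1 R 2 (ltr0Sn _ _); lra. Qed.

Lemma ln_exprn (R : realType) (x : R) (m : nat) : 0 < x -> ln (x ^+ m) = m%:R * ln x.
Proof. by move=> x0; rewrite lnXn // mulr_natl. Qed.

Lemma ln_Dl_ge (R : realType) (D0 : nat) : (0 < D0)%N -> 1 <= ln ((4 * D0)%:R : R).
Proof.
move=> h; have l4 : 1 <= ln (4 : R).
  have h2 := @le_ln_sub1 R (2^-1); rewrite lnV ?posrE ?ltr0n // in h2.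
  have e4 : (4 : R) = 2 ^+ 2 by rewrite expr2; lra.
  rewrite e4 ln_exprn //; have : (0 : R) < 2^-1 by rewrite invr_gt0.
  move=> /h2; lra.
apply: le_trans l4 _; rewrite ler_ln ?posrE ?ltr0n ?muln_gt0 ?h //.
by rewrite ler_nat; lia.
Qed.

(** In logarithms the right side is at least [k * E * lk / 8] with [E = Dl ^ j.+1]. In units of
    [k * E * lk] the left side spends [1 / 64] on the factor 16, [1 / 24] on the transferred cells
    and, net of the factor [Dl.-1 ^ y], [1 / 16] on the separators: in total [23 / 192]. *)
Lemma numeric_ok (R : realType) (D0 j k w x y m : nat) (t c0 z : R) :
  (0 < D0)%N -> (32 <= k)%N -> 2 <= ln (k%:R : R) -> 0 <= t -> 0 <= c0 ->
  48 * 60 * 48 * (t * ln ((4 * D0)%:R : R)) <= ln (k%:R : R) ->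
  24 * (c0 * (2 * w%:R + 1)) <= ln (k%:R : R) ->
  z = 48 * 60 * k%:R * (4 * D0)%:R ^+ j.+1 * t ->
  x%:R <= z -> y%:R <= (4 * D0)%:R * z -> m%:R <= c0 * k%:R * (4 * D0)%:R ^+ j.+1 ->
  (16 * ((2 ^ w * 2 ^ w).+1 ^ m * (4 * D0) ^ (x + y)) <=
   (4 * D0).-1 ^ y * k`! ^ (D0 * (4 * D0) ^ j))%N.
Proof.
move=> D00 k16 lk2 t0 c00 hD hw zE hx hy hm.
set Dl := (4 * D0)%N in hD hx hy hm zE *.
have Dl4 : (4 <= Dl)%N by rewrite /Dl; lia.
have L1 : 1 <= ln (Dl%:R : R) by apply: ln_Dl_ge.
have k0 : 0 < k%:R :> R by rewrite ltr0n; lia.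
have DlR : 4 <= Dl%:R :> R by rewrite ler_nat.
set E := Dl%:R ^+ j.+1 : R.
have E4 : 4 <= E.
  apply: le_trans DlR _; rewrite /E exprS ler_peMr ?ler0n //; apply: exprn_ege1.
  by rewrite ler1n; lia.
have kR : 32 <= k%:R :> R by rewrite ler_nat.
set lk := ln (k%:R : R) in lk2 hD hw *.
have z0 : 0 <= z by rewrite zE !mulr_ge0 // exprn_ge0 //; lra.
have ln_pow a b : (0 < a)%N -> ln ((a ^ b)%:R : R) = b%:R * ln a%:R.
  by move=> a0; rewrite natrX ln_exprn // ltr0n.
have ln_mul (a b : nat) : (0 < a)%N -> (0 < b)%N -> ln ((a * b)%:R : R) = ln a%:R + ln b%:R.
  by move=> a0 b0; rewrite natrM lnM ?posrE ?ltr0n.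
have Dl0 : (0 < Dl)%N by rewrite (leq_trans _ Dl4).
have Dl1 : (0 < Dl.-1)%N by rewrite -ltnS prednK // (leq_trans _ Dl4).
have p1 : (0 < (2 ^ w * 2 ^ w).+1 ^ m)%N by rewrite expn_gt0.
have p2 : (0 < Dl ^ (x + y))%N by rewrite expn_gt0 Dl0.
have p3 : (0 < Dl.-1 ^ y)%N by rewrite expn_gt0 Dl1.
have p4 : (0 < k`! ^ (D0 * Dl ^ j))%N by rewrite expn_gt0 fact_gt0.
have p5 : (0 < (2 ^ w * 2 ^ w).+1 ^ m * Dl ^ (x + y))%N by rewrite muln_gt0 p1 p2.
have p6 : (0 < 16 * ((2 ^ w * 2 ^ w).+1 ^ m * Dl ^ (x + y)))%N by rewrite muln_gt0 p5.
have p7 : (0 < Dl.-1 ^ y * k`! ^ (D0 * Dl ^ j))%N by rewrite muln_gt0 p3 p4.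
rewrite -(ler_nat R) -ler_ln ?posrE ?(ltr0n R) //.
rewrite (ln_mul 16%N _ isT p5) (ln_mul _ _ p1 p2) (ln_mul _ _ p3 p4).
rewrite (ln_pow _ m (ltn0Sn _)) (ln_pow _ _ Dl0) (ln_pow _ _ Dl1) (ln_pow _ _ (fact_gt0 k)).
have b16 : ln (16 : R) <= 4.
  have -> : (16 : R) = 2 ^+ 4 by rewrite -natrX.
  by rewrite ln_exprn //; have := ln2_le1 R; lra.
have bw : ln ((2 ^ w * 2 ^ w).+1%:R : R) <= 2 * w%:R + 1.
  apply: (@le_trans _ _ (ln (2 ^+ (w + w).+1 : R))).
    rewrite ler_ln ?posrE ?ltr0n ?exprn_gt0 // -natrX ler_nat -expnD expnS mul2n -addnn.
    by rewrite -addn1 leq_add2l expn_gt0.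
  rewrite ln_exprn // -[leRHS]mulr1 -addn1 !natrD.
  have -> : w%:R + w%:R + 1%:R = 2 * w%:R + 1 :> R by ring.
  by apply: ler_wpM2l; [rewrite addr_ge0 // mulr_ge0|apply: ln2_le1].
(* The price of one cell on the large side, small enough for a bound [y] that is [Dl] times as large
   as [x]. *)
have bD : ln (Dl%:R : R) - ln (Dl.-1%:R : R) <= (Dl%:R - 1)^-1.
  have e : Dl.-1%:R = Dl%:R - 1 :> R by rewrite -subn1 natrB.
  have d0 : 0 < Dl%:R - 1 :> R by lra.
  have q : 0 < Dl%:R / (Dl%:R - 1) :> R by rewrite divr_gt0 //; lra.
  have := le_ln_sub1 q; rewrite ln_div ?posrE //; last by lra.
  rewrite e; have -> : Dl%:R / (Dl%:R - 1) - 1 = (Dl%:R - 1)^-1 :> R.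
    by field; rewrite gt_eqF.
  by [].
have bk : k%:R * lk / 2 <= ln (k`!%:R : R).
  have h := @ln_fact_ge R k (leq_trans _ k16).
  apply: le_trans (h isT); rewrite -/lk.
  have : k%:R * 2 <= k%:R * lk by rewrite ler_wpM2l // ltW.
  lra.
have yD : y%:R * (ln (Dl%:R : R) - ln (Dl.-1%:R : R)) <= 2 * z.
  apply: (@le_trans _ _ (Dl%:R * z * (Dl%:R - 1)^-1)).
    apply: ler_pM => //; rewrite subr_ge0 ler_ln ?posrE ?ltr0n //.
    by rewrite ler_nat leq_pred.
  have d0 : 0 < Dl%:R - 1 :> R by lra.
  rewrite ler_pdivrMr //.
  have : 0 <= z * (Dl%:R - 4) by rewrite mulr_ge0 //; lra.
  by nra.
have xD : x%:R * ln (Dl%:R : R) <= z * ln (Dl%:R : R) by rewrite ler_wpM2r //; lra.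
have zD : z * (ln (Dl%:R : R) + 2) <= k%:R * E * lk / 16.
  apply: (@le_trans _ _ (z * (3 * ln (Dl%:R : R)))).
    by apply: ler_wpM2l => //; lra.
  have -> : z * (3 * ln (Dl%:R : R)) = k%:R * E * (3 * 48 * 60 * (t * ln (Dl%:R : R))) by rewrite zE -/E; ring.
  rewrite -!mulrA; apply: ler_wpM2l; first exact: ltW.
  by apply: ler_wpM2l; lra.
have mD : m%:R * ln ((2 ^ w * 2 ^ w).+1%:R : R) <= k%:R * E * lk / 24.
  apply: (@le_trans _ _ (c0 * k%:R * E * (2 * w%:R + 1))).
    by apply: ler_pM => //; apply: ln_ge0; rewrite ler1n.
  have -> : c0 * k%:R * E * (2 * w%:R + 1) = k%:R * E * (c0 * (2 * w%:R + 1)) by ring.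
  rewrite -!mulrA; apply: ler_wpM2l; first exact: ltW.
  by apply: ler_wpM2l; lra.
have kE : 128 <= k%:R * E by apply: (@le_trans _ _ (32 * 4)); [lra|apply: ler_pM => //; lra].
have kEl : k%:R * E * 2 <= k%:R * E * lk by apply: ler_wpM2l => //; lra.
have last_ : (D0 * Dl ^ j)%:R * ln (k`!%:R : R) >= E / 4 * (k%:R * lk / 2).
  have -> : (D0 * Dl ^ j)%:R = E / 4 :> R.
    rewrite /E exprS (natrM _ D0) natrX.
    have -> : Dl%:R = 4 * D0%:R :> R by rewrite /Dl natrM.
    by move: (_ ^+ j) => F; field.
  by apply: ler_wpM2l => //; lra.
rewrite natrD.
have e : E / 4 * (k%:R * lk / 2) = k%:R * E * lk / 8 by field.
rewrite e in last_.
move: mD xD yD zD last_ kEl kE b16; rewrite [(x%:R + y%:R) * _]mulrDl [z * (_ + _)]mulrDr [y%:R * (_ - _)]mulrBr.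
set A1 := m%:R * _; set A2 := x%:R * _; set A3 := y%:R * ln Dl%:R; set A4 := y%:R * ln _.
set A5 := _%:R * ln k`!%:R; set A6 := z * ln _; set A7 := k%:R * E * lk; set A8 := k%:R * E.
lra.
Qed.

Lemma expectation_le_trans (R : realType) (d : measure_display) (T : measurableType d)
    (P : probability T R) (X : T -> nat -> Prop) (b b' : R) :
  b <= b' -> Defs.expectation_le P X b -> Defs.expectation_le P X b'.
Proof.
move=> bb' [f [h1 h2 h3 h4]]; exists f; split=> //.
by apply: le_trans h4 _; rewrite lee_fin.
Qed.

Section Tradeoff.

Variables (R : realType) (D0 H k0 : nat) (md : bool).
Hypothesis D0_gt0 : (0 < D0)%N.

Notation Dl := (4 * D0)%N.
Notation N := (layers D0 H md).
Notation k := k0.+1.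
Notation secret := (secret D0 H k0 md).
Notation us := (upds D0 md).
Notation qs := (qrys D0 md).

Variables (n w : nat) (cls : graph_class) (G : finType).
Variables (d : measure_display) (T : measurableType d) (P : probability T R).
Variables (D : T -> data_structure n w G) (tu tq delta t c0 : R).
Hypothesis nV : (#|vertex N k0| <= n)%N.
Hypothesis correct : correct_with_error cls P D delta.
Hypothesis amortized : amortized_time cls P D tu tq.
Hypothesis delta_ge0 : 0 <= delta.
Hypothesis tu_ge0 : 0 <= tu.
Hypothesis tq_ge0 : 0 <= tq.
Hypothesis t_gt0 : 0 < t.
Hypothesis tu_le : us%:R * tu <= Dl%:R * t.
Hypothesis tq_le : qs%:R * tq <= Dl%:R * t.

Let emb (v : vertex N k0) : 'I_n := widen_ord nV (enum_rank v).

Let emb_inj : injective emb.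
Proof.
move=> u v /(congr1 (@nat_of_ord _)) /= e; apply: enum_rank_inj; exact: val_inj.
Qed.

Let ops X := atoms_ops (ref_vertex emb) (test_vertex emb) (full emb X).

Definition num_atoms : nat := Dl ^ H * k * qs.+1.
Definition num_ops : nat := 28 * (Dl ^ H * us * k) + Dl ^ H * k * (2 * qs).

Lemma size_full X : size (full emb X) = num_atoms.
Proof.
rewrite fullE /num_atoms; elim: (Dl ^ H * k)%N => [|m IH] //.
rewrite iota0S map_cat flatten_cat size_cat IH /= cats0 /phase /= size_map size_iota.
by rewrite mulSn addnC.
Qed.

Lemma size_ops X : (size (ops X) <= num_ops)%N.
Proof.
rewrite -(count_predC (@is_update n)) leq_add //.
  exact: num_updates_full.
by rewrite -(num_queries_full D0_gt0 emb X).
Qed.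

Hypothesis small_error : 48 * (num_atoms%:R * k%:R * (num_ops%:R * delta)) <= 1.

(** [30 = 28 + 2], from [num_updates_full] and [num_queries_full]. *)
Let Tot : R := 30 * k%:R * Dl%:R ^+ H.+1 * t.

Let Tot_gt0 : 0 < Tot.
Proof. by rewrite /Tot !mulr_gt0 // exprn_gt0 // ltr0n muln_gt0. Qed.

Let cost_le X : tu * (num_updates (ops X))%:R + tq * (num_queries (ops X))%:R <= Tot.
Proof.
have hu : tu * (num_updates (ops X))%:R <= 28 * (k%:R * Dl%:R ^+ H * (us%:R * tu)).
  apply: (@le_trans _ _ (tu * (28 * (Dl ^ H * us * k))%:R)).
    by apply: ler_wpM2l => //; rewrite ler_nat; apply: num_updates_full.
  rewrite le_eqVlt; apply/orP; left; apply/eqP.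
  rewrite (natrM _ 28) (natrM _ (_ * _)) (natrM _ (_ ^ _)) natrX.
  by move: (_ ^+ H) => F; ring.
have hq : tq * (num_queries (ops X))%:R <= 2 * (k%:R * Dl%:R ^+ H * (qs%:R * tq)).
  rewrite /ops (num_queries_full D0_gt0) le_eqVlt; apply/orP; left; apply/eqP.
  rewrite (natrM _ (_ * _)) (natrM _ 2) (natrM _ (_ ^ _)) natrX.
  by move: (_ ^+ H) => F; ring.
have c1 : 0 <= k%:R * Dl%:R ^+ H :> R by rewrite mulr_ge0 // exprn_ge0.
have := ler_wpM2l c1 tu_le; have := ler_wpM2l c1 tq_le.
have -> : Tot = 30 * (k%:R * Dl%:R ^+ H * (Dl%:R * t)).
  by rewrite /Tot exprSr; set F := _ ^+ H; set E := Dl%:R; clearbody F E; ring.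
move: hu hq; set A := _ * (Dl%:R * t); set A1 := _ * (us%:R * tu); set A2 := _ * (qs%:R * tq).
lra.
Qed.

Hypothesis k_ge : (32 <= k)%N.
Hypothesis lnk_ge : 2 <= ln (k%:R : R).
Hypothesis c0_gt0 : 0 < c0.
Hypothesis small_t : 48 * 60 * 48 * (t * ln (Dl%:R : R)) <= ln (k%:R : R).
Hypothesis small_w : 24 * (c0 * (2 * w%:R + 1)) <= ln (k%:R : R).

Lemma tradeoff : H%:R * c0 <= 360 * t.
Proof.
pose J : finType := (secret * 'I_num_atoms * 'I_k)%type.
have /choice[B HB] : forall j : J, exists B : set T,
    (measurable B /\ (P B <= (num_ops%:R * delta)%:E)%E) /\
    forall o, ~ B o -> correct_on (D o) (test_seq emb j.1.1 j.1.2 j.2).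
  move=> j; have [B [mB pB] cB] := correct (legal_test_seq D0_gt0 emb_inj cls j.1.1 j.1.2 j.2).
  exists B; split=> //; split=> //; apply: le_trans pB _; rewrite lee_fin.
  apply: ler_wpM2r => //; rewrite ler_nat.
  exact: leq_trans (size_test_seq _ _ _ _) (size_ops _).
pose W : R := #|{: secret}|%:R.
have W0 : 0 < W by rewrite ltr0n; apply/card_gt0P; exists [ffun=> 1%g].
(* With these weights each of the two expectations is at most [W]. A sum below [3 * W] leaves at
   most [W / 16] failing tests and a total cost of at most [3 * Tot * W]. *)
have [] := @exists_good_outcome R d T P J secret B (num_ops%:R * delta)
  (fun X o m => exists ss, [/\ operations ss = ops X, accepted (D o) ss
                              & total_probes (D o) ss = m]) Tot 48 Tot^-1 (3 * W).
- by [].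
- by rewrite invr_ge0 ltW.
- by move=> j; have [] := HB j.
- move=> X; apply: expectation_le_trans (cost_le X) _.
  by apply: amortized; apply: legal_full.
- have -> : #|J|%:R = W * num_atoms%:R * k%:R :> R.
    by rewrite /J !card_prod !card_ord (natrM _ (_ * _)) natrM.
  have -> : Tot^-1 * (#|{: secret}|%:R * Tot) = W by rewrite mulrCA mulVf ?mulr1 // gt_eqF.
  have : W * (48 * (num_atoms%:R * k%:R * (num_ops%:R * delta))) <= W * 1.
    by apply: ler_wpM2l => //; apply: ltW.
  move=> h.
  have -> : 48 * (W * num_atoms%:R * k%:R * (num_ops%:R * delta)) =
    W * (48 * (num_atoms%:R * k%:R * (num_ops%:R * delta))) by ring.
  by move: h; move: (W * (48 * _)) => A; lra.
move=> o Ho.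
pose S : {set J} := [set j | `[< B j o >]].
pose Ok : {set secret} := [set X | `[< ok emb (D o) X >]].
pose g (X : secret) := if X \in Ok then total_probes (D o) (canonical_steps (D o) (Defs.init (D o)) (ops X)) else 0%N.
have {}Ho : 48 * #|S|%:R + Tot^-1 * \sum_X (g X)%:R < 3 * W.
  apply: Ho => [j|X]; first by rewrite inE => /asboolP.
  rewrite /g; case: ifP => [|_]; last by left.
  rewrite inE => /asboolP okX; right; have [_ [e acc]] := ok_run D0_gt0 emb_inj okX.
  by exists (canonical_steps (D o) (Defs.init (D o)) (ops X)).
have gs0 : 0 <= \sum_X (g X)%:R :> R by apply: sumr_ge0.
have Ti0 : 0 <= Tot^-1 by rewrite invr_ge0 ltW.
have S3 : 16 * #|S|%:R <= W.
  have : 0 <= Tot^-1 * \sum_X (g X)%:R by rewrite mulr_ge0.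
  by move: Ho; move: (Tot^-1 * _) => A; lra.
have OkS : (#|~: Ok| <= #|S|)%N.
  apply: leq_trans (leq_imset_card (fun j : J => j.1.1) S).
  apply: subset_leq_card; apply/fintype.subsetP => X; rewrite !inE => /asboolP nok.
  apply: contrapT => nS; apply: nok => i b iF.
  have iA : (i < num_atoms)%N by rewrite -(size_full X).
  have := (HB (X, Ordinal iA, b)).2 o; apply => Bo.
  by apply: nS; apply/imsetP; exists (X, Ordinal iA, b) => //; rewrite inE; apply/asboolP.
have Ok_big : (16 * #|~: Ok| <= #|{: secret}|)%N.
  rewrite -(ler_nat R) (natrM _ 16); apply: le_trans S3.
  by apply: ler_wpM2l => //; rewrite ler_nat.
have Ok_ok X : X \in Ok -> ok emb (D o) X by rewrite inE => /asboolP.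
have Ok_cost : \sum_(X in Ok) (\sum_(0 <= i < Dl ^ H) #|round_cells emb (D o) X i|)%:R
    <= 3 * Tot * #|{: secret}|%:R.
  apply: (@le_trans _ _ (\sum_X (g X)%:R)).
    rewrite [leRHS](bigID (mem Ok)) /= -[leLHS]addr0; apply: lerD; last exact: sumr_ge0.
    apply: ler_sum => X XO; rewrite ler_nat /g XO -size_run_touched.
    exact: sum_round_cells.
  have {}Ho : Tot^-1 * \sum_X (g X)%:R <= 3 * W.
    have : 0 <= 48 * #|S|%:R :> R by [].
    by move: Ho; move: (Tot^-1 * _) (48 * _) => A A'; lra.
  have := ler_wpM2l (ltW Tot_gt0) Ho; rewrite mulVKf ?gt_eqF // => h.
  by apply: le_trans h _; rewrite /W le_eqVlt; apply/orP; left; apply/eqP; ring.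
have k0R : 0 < k%:R :> R by rewrite ltr0n.
have := @transfer_bound R D0 H k0 md D0_gt0 n emb emb_inj w G (D o) Ok Tot (c0 * k%:R)
  Tot_gt0 (mulr_gt0 c0_gt0 k0R) Ok_ok Ok_big Ok_cost.
have DlR : 0 < Dl%:R :> R by rewrite ltr0n muln_gt0.
have num j x y m : (j < H)%N ->
  x%:R <= 48 * Tot / rects R D0 H j -> y%:R <= Dl%:R * (48 * Tot / rects R D0 H j) ->
  m%:R <= c0 * k%:R * Dl%:R ^+ j.+1 ->
  (16 * ((2 ^ w * 2 ^ w).+1 ^ m * Dl ^ (x + y)) <= Dl.-1 ^ y * k`! ^ (D0 * Dl ^ j))%N.
  move=> jH.
  have -> : 48 * Tot / rects R D0 H j = 48 * 60 * k%:R * Dl%:R ^+ j.+1 * t.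
    have -> : rects R D0 H j = Dl%:R / 2 * Dl%:R ^+ (H - j.+1).
      by rewrite /rects natrM natrX; congr (_ * _); rewrite !natrM; field.
    rewrite /Tot; have -> : Dl%:R ^+ H.+1 = Dl%:R ^+ j.+1 * Dl%:R ^+ (H - j.+1) * Dl%:R :> R.
      by rewrite -exprD subnKC // -exprSr.
    have B0 : Dl%:R ^+ (H - j.+1) != 0 :> R by rewrite gt_eqF // exprn_gt0.
    have C0 : Dl%:R != 0 :> R by rewrite gt_eqF.
    move: B0 C0; set A' := _ ^+ j.+1; set B' := _ ^+ (H - _); set C' := Dl%:R.
    by clearbody A' B' C' => B0 C0; field; rewrite B0 C0.
  by move=> hx hy hm; apply: (numeric_ok D0_gt0 k_ge lnk_ge (ltW t_gt0) (ltW c0_gt0) small_t small_w erefl hx hy hm).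
move=> /(_ num).
have -> : H%:R * (c0 * k%:R) * Dl%:R ^+ H.+1 = (H%:R * c0) * (k%:R * Dl%:R ^+ H.+1) by ring.
have -> : 12 * Tot = (360 * t) * (k%:R * Dl%:R ^+ H.+1) by rewrite /Tot; ring.
by rewrite ler_pM2r // mulr_gt0 // exprn_gt0.
Qed.

End Tradeoff.

(** * Constant lower bounds *)

Lemma probes0 (w : nat) (A : Type) (p : program w A) (M M' : memory w) :
  probes p M = 0%N -> value p M' = value p M /\ final p M' = M'.
Proof. by case: p. Qed.

Section Constants.

Variables (R : realType) (n w : nat) (cls : graph_class) (G : finType).
Variables (d : measure_display) (T : measurableType d) (P : probability T R).
Variables (D : T -> data_structure n w G) (tu tq delta : R).
Hypothesis n3 : (3 <= n)%N.
Hypothesis correct : correct_with_error cls P D delta.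
Hypothesis amortized : amortized_time cls P D tu tq.
Hypothesis delta_ge0 : 0 <= delta.
Hypothesis delta_le : 32 * delta <= 1.

Let emb (i : 'I_3) : 'I_n := widen_ord n3 i.
Let emb_inj : injective emb.
Proof. by move=> i j /(congr1 (@nat_of_ord _)) /= e; apply: val_inj. Qed.

Let i0 : 'I_3 := @Ordinal 3 0 isT.
Let i1 : 'I_3 := @Ordinal 3 1 isT.
Let i2 : 'I_3 := @Ordinal 3 2 isT.

(** Paths of length 1 and 2 from [i0] to [i2]: the colors of the ends must differ in the one and
    agree in the other. *)
Let f1 (i : 'I_3) : option 'I_3 := if i == i0 then Some i2 else None.
Let f2 (i : 'I_3) : option 'I_3 := if i == i0 then Some i1 else if i == i1 then Some i2 else None.

Let chain1 : chain f1.
Proof.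
exists (fun i : 'I_3 => if i == i0 then 0%N else if i == i2 then 1%N else 2%N).
  by move=> [[|[|[]]] ?] // [[|[|[]]] ?] //= _; apply: val_inj.
by move=> x y; rewrite /f1; case: (x =P i0) => // _ [<-].
Qed.

Let chain2 : chain f2.
Proof.
exists (@nat_of_ord 3); first exact: val_inj.
by move=> x y; rewrite /f2; case: eqP => [-> [<-]|_] //; case: eqP => // -> [<-].
Qed.

Let ins1 : seq (operation n) := [:: Update (Insert (emb i0) (emb i2))].
Let ins2 : seq (operation n) :=
  [:: Update (Insert (emb i0) (emb i1)); Update (Insert (emb i1) (emb i2))].
Let qry : seq (operation n) := [:: GetColor (emb i0); GetColor (emb i2)].

Let edges0 f : edges emb f finset.set0 = finset.set0 :> graph n.
Proof. by apply/finset.setP => e; rewrite [RHS]finset.in_set0; apply/negP => /edgesP[x [y []]]; rewrite finset.in_set0. Qed.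

Let leads1 : leads cls finset.set0 ins1 (edges emb f1 (finset.set0 :|: [set x in [:: i0]])%SET).
Proof.
rewrite -{1}(edges0 f1).
have -> : ins1 = [seq Update x | x <- insert_ops emb f1 [:: i0]] by [].
by apply: leads_insert => // x; rewrite !inE.
Qed.

Let leads2 : leads cls finset.set0 ins2 (edges emb f2 (finset.set0 :|: [set x in [:: i0; i1]])%SET).
Proof.
rewrite -{1}(edges0 f2).
have -> : ins2 = [seq Update x | x <- insert_ops emb f2 [:: i0; i1]] by [].
by apply: leads_insert => // x; rewrite !inE.
Qed.

Let color1 (c : coloring n) :
  Defs.proper c (graph_after finset.set0 ins1) -> c (emb i0) != c (emb i2).
Proof.
rewrite leads1.1 => /forallP/(_ (emb i0))/forallP/(_ (emb i2)).
have -> : [set emb i0; emb i2]%SET \in edges emb f1 (finset.set0 :|: [set x in [:: i0]])%SET; last by [].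
by apply/edgesP; exists i0, i2; rewrite !inE.
Qed.

Let color2 (c : coloring n) :
  Defs.proper c (graph_after finset.set0 ins2) -> c (emb i0) = c (emb i2).
Proof.
rewrite leads2.1 => pc.
have h x y : f2 x = Some y -> x \in [:: i0; i1] -> c (emb x) != c (emb y).
  move=> fx xi; have /forallP/(_ (emb x))/forallP/(_ (emb y)) := pc.
  have -> : [set emb x; emb y]%SET \in edges emb f2 (finset.set0 :|: [set x in [:: i0; i1]])%SET; last by [].
  by apply/edgesP; exists x, y; split=> //; rewrite !inE; rewrite !inE in xi.
have := h i0 i1 erefl isT; have := h i1 i2 erefl isT.
by case: (c _); case: (c _); case: (c _).
Qed.

Let legal1 : legal cls (ins1 ++ qry). Proof. exact: leads1.2. Qed.
Let legal2 : legal cls (ins2 ++ qry). Proof. exact: leads2.2. Qed.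
Let legal1' : legal cls ins1. Proof. by have := leads1.2 [::]; rewrite cats0; apply. Qed.
Let legal2' : legal cls ins2. Proof. by have := leads2.2 [::]; rewrite cats0; apply. Qed.

Let complete1 o : complete (D o) ins1.
Proof. by have := @complete_updates n w G (D o) [::] [:: Insert (emb i0) (emb i2)]; apply. Qed.
Let complete2 o : complete (D o) ins2.
Proof.
by have := @complete_updates n w G (D o) [::]
  [:: Insert (emb i0) (emb i1); Insert (emb i1) (emb i2)]; apply.
Qed.

Let contradiction o g0 c0 g c :
  correct_on (D o) (ins1 ++ qry) -> correct_on (D o) (ins2 ++ qry) ->
  (forall ops, ops = ins1 \/ ops = ins2 ->
    value (query_program (D o) (emb i0) g0) (run (D o) (Defs.init (D o)) ops) = Some c0 /\
    value (query_program (D o) (emb i2) g) (final (query_program (D o) (emb i0) g0)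
      (run (D o) (Defs.init (D o)) ops)) = Some c) -> False.
Proof.
move=> C1 C2 h.
have [v1 v1'] := h ins1 (or_introl erefl); have [v2 v2'] := h ins2 (or_intror erefl).
have [f pf [e1 e2]] := query_pair_correct (complete1 o) C1 v1 v1'.
have [f' pf' [e1' e2']] := query_pair_correct (complete2 o) C2 v2 v2'.
by move: (color1 pf) (color2 pf'); rewrite -e1 -e2 -e1' -e2' => /eqP.
Qed.

Let correct_set (ops : seq (operation n)) : legal cls ops -> (size ops <= 4)%N ->
  exists B : set T, (measurable B /\ (P B <= (4 * delta)%:E)%E) /\
    forall o, ~ B o -> correct_on (D o) ops.
Proof.
move=> l sz; have [B [mB pB] cB] := correct l; exists B; split=> //; split=> //.
by apply: le_trans pB _; rewrite lee_fin; apply: ler_wpM2r => //; rewrite ler_nat.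
Qed.

Let cost_pred (ops : seq (operation n)) o m :=
  exists ss, [/\ operations ss = ops, accepted (D o) ss & total_probes (D o) ss = m].

Let lt1_zero (J K : finType) (S : {set J}) (g : K -> nat) :
  1 * #|S|%:R + 1 * \sum_k (g k)%:R < 1 :> R -> S = finset.set0 /\ forall k, g k = 0%N.
Proof.
rewrite !mul1r -natr_sum -natrD -[ltRHS]/(1%:R) ltr_nat ltnS leqn0 addn_eq0 cards_eq0.
by move=> /andP[/eqP -> ]; rewrite sum_nat_eq0 => /forallP h; split=> // k; have /eqP := h k.
Qed.

(** Otherwise, under some outcome, [i0] and [i2] have accepting threads that probe nothing; these
    answer alike after [ins1] and after [ins2]. *)
Lemma query_time_ge : 1 / 8 <= tq.
Proof.
rewrite leNgt; apply/negP => tq8.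
pose sq (j : bool * bool) := match j with
  | (true, true) => ins1 ++ qry | (true, false) => ins2 ++ qry
  | (false, true) => [:: GetColor (emb i0)] | _ => [:: GetColor (emb i2)] end.
have /choice[B HB] : forall j : bool * bool, exists B : set T,
    (measurable B /\ (P B <= (4 * delta)%:E)%E) /\ forall o, ~ B o -> correct_on (D o) (sq j).
  by move=> [[] []]; apply: correct_set.
pose kq (b : bool) := if b then emb i0 else emb i2.
have [] := @exists_good_outcome R d T P (bool * bool)%type bool B (4 * delta)
  (fun b => cost_pred [:: GetColor (kq b)]) tq 1 1 1.
- by [].
- by [].
- by move=> j; have [] := HB j.
- move=> b; have := @amortized [:: GetColor (kq b)] I; apply: expectation_le_trans.
  by rewrite /num_updates /num_queries /= mulr0 mulr1 add0r.
- by rewrite card_prod card_bool !mul1r (natrM _ 2 2); move: tq8 delta_le; lra.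
move=> o Ho.
pose S : {set bool * bool} := [set j | `[< B j o >]].
pose can b := canonical_steps (D o) (Defs.init (D o)) [:: GetColor (kq b)].
(* The actual costs may be inserted for [g] only if both queries are accepted. This can fail only if
   [S] is nonempty, and then the costs [0] already give the contradiction. *)
have hS0 : (forall k, cost_pred [:: GetColor (kq k)] o (total_probes (D o) (can k))) \/ S != finset.set0.
  case: (boolP (S == finset.set0)) => [/eqP S0|]; [left|by right].
  move=> b; have cB : correct_on (D o) ([::] ++ GetColor (kq b) :: [::]).
    have := HB (false, b) => -[_ /(_ o)]; case: (b) => /=; apply => Bo.
      have : (false, true) \in S by rewrite inE; apply/asboolP.
      by rewrite S0 inE.
    have : (false, false) \in S by rewrite inE; apply/asboolP.
    by rewrite S0 inE.
  have [g _ [e acc]] := complete_query (conj erefl erefl : complete (D o) [::]) cB.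
  by exists (can b).
have {Ho} : S = finset.set0 /\ forall k, total_probes (D o) (can k) = 0%N.
  case: hS0 => [hc|Sn]; last first.
    have := Ho S (fun=> 0%N); move=> /(_ _ _)/lt1_zero[|k|S0 _]; [|by left|by rewrite S0 eqxx in Sn].
    by move=> j; rewrite inE => /asboolP.
  have := Ho S (fun b => total_probes (D o) (can b)).
  move=> /(_ _ _)/lt1_zero[j|k|S0 z]; [by rewrite inE => /asboolP|by right|by split].
case=> S0 z.
have cor j : correct_on (D o) (sq j).
  apply: (HB j).2 => Bo; have : j \in S by rewrite inE; apply/asboolP.
  by rewrite S0 inE.
have thr b : exists g c, forall M', value (query_program (D o) (kq b) g) M' = Some c
      /\ final (query_program (D o) (kq b) g) M' = M'.
  have cB : correct_on (D o) ([::] ++ GetColor (kq b) :: [::]) by case: (b); [apply: (cor (false, true))|apply: (cor (false, false))].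
  have [g fa _] := complete_query (conj erefl erefl : complete (D o) [::]) cB.
  have := z b; rewrite /can /total_probes /= (fa : first_accept _ (Defs.init _) _ = _) /= addn0 => p0.
  have := ohead_filterP fa => /=; case v: (value _ _) => [c|] // _.
  by exists g, c => M'; have [-> ->] := probes0 M' p0.
have [g0 [c0 h0]] := thr true; have [g [c h]] := thr false.
apply: (contradiction (cor (true, true)) (cor (true, false)) (g0 := g0) (c0 := c0) (g := g) (c := c)).
by move=> ops _; split; [case: (h0 (run (D o) (Defs.init (D o)) ops))|apply: (h _).1].
Qed.

(** Otherwise, under some outcome, neither [ins1] nor [ins2] probes a cell; both leave the initial
    memory, and later queries cannot tell them apart. *)
Lemma update_time_ge : 1 / 8 <= tu.
Proof.
have tu0 : 0 <= tu.
  have [f [_ f0 _ fb]] := amortized legal1'.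
  move: fb; rewrite /num_updates /num_queries /= mulr0 addr0 mulr1 => fb.
  by rewrite -lee_fin; apply: le_trans fb; apply: integral_ge0.
rewrite leNgt; apply/negP => tu8.
pose sq (j : bool) := if j then ins1 ++ qry else ins2 ++ qry.
have /choice[B HB] : forall j : bool, exists B : set T,
    (measurable B /\ (P B <= (4 * delta)%:E)%E) /\ forall o, ~ B o -> correct_on (D o) (sq j).
  by move=> []; apply: correct_set.
pose kq (b : bool) := if b then ins1 else ins2.
have [] := @exists_good_outcome R d T P bool bool B (4 * delta)
  (fun b => cost_pred (kq b)) (2 * tu) 1 1 1.
- by [].
- by [].
- by move=> j; have [] := HB j.
- move=> b; have lb : legal cls (kq b) by case: (b).
  have := amortized lb; apply: expectation_le_trans.
  by case: (b); rewrite /num_updates /num_queries /= mulr0; lra.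
- by rewrite card_bool; move: tu8 delta_le; lra.
move=> o Ho.
pose S : {set bool} := [set j | `[< B j o >]].
pose can b := canonical_steps (D o) (Defs.init (D o)) (kq b).
have := Ho S (fun b => total_probes (D o) (can b)).
move=> /(_ _ _)/lt1_zero[j|b|S0 z].
- by rewrite inE => /asboolP.
- have [e acc] : complete (D o) (kq b) by case: (b); [apply: complete1|apply: complete2].
  by right; exists (can b).
have cor j : correct_on (D o) (sq j).
  apply: (HB j).2 => Bo; have : j \in S by rewrite inE; apply/asboolP.
  by rewrite S0 inE.
have mem b : run (D o) (Defs.init (D o)) (kq b) = Defs.init (D o).
  have := z b; rewrite /can -size_run_touched => /size0nil e.
  by apply/ffunP => a; apply: run_untouched; rewrite e.
have cor1 : correct_on (D o) (ins1 ++ GetColor (emb i0) :: [:: GetColor (emb i2)]) by exact: (cor true).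
have [g0 fa0 c0] := complete_query (complete1 o) cor1.
have cor1' : correct_on (D o) ((ins1 ++ [:: GetColor (emb i0)]) ++ GetColor (emb i2) :: [::]) by exact: (cor true).
have [g1 fa1 _] := complete_query c0 cor1'.
rewrite (mem true) in fa0.
have := ohead_filterP fa0 => /=; case v0: (value _ _) => [x0|] // _.
move: fa1; rewrite run_cat (mem true : run _ _ ins1 = _) /(run _ _ [:: _]) /= fa0 /= => fa1.
have := ohead_filterP fa1 => /=; case v1: (value _ _) => [x1|] // _.
apply: (contradiction (cor true) (cor false) (g0 := g0) (c0 := x0) (g := g1) (c := x1)).
by move=> ops [->|->]; [rewrite (mem true : run _ _ ins1 = _)|rewrite (mem false : run _ _ ins2 = _)].
Qed.

End Constants.

(** * Choice of the parameters *)

Lemma ln2_ge (R : realType) : 1 / 2 <= ln (2 : R).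
Proof.
have := @le_ln_sub1 R (2^-1); rewrite lnV ?posrE ?ltr0n // => h.
have : (0 : R) < 2^-1 by rewrite invr_gt0.
by move=> /h; lra.
Qed.

Section Core.

Variables (R : realType) (n w b : nat) (cls : graph_class) (G : finType).
Variables (d : measure_display) (T : measurableType d) (P : probability T R).
Variables (D : T -> data_structure n w G) (tu tq delta c0 : R).
Hypothesis correct : correct_with_error cls P D delta.
Hypothesis amortized : amortized_time cls P D tu tq.
Hypothesis b_ge : (32 <= b)%N.
Hypothesis b_le : (b ^ 8 <= n)%N.
Hypothesis delta_ge0 : 0 <= delta.
Hypothesis delta_le : b%:R ^+ 8 * delta <= 1.
Hypothesis c0_gt0 : 0 < c0.
Hypothesis c0_le : 128 * c0 <= 1.
Hypothesis small_w : 24 * (c0 * (2 * w%:R + 1)) <= ln (b%:R : R).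

Let bR : 32 <= b%:R :> R. Proof. by rewrite ler_nat. Qed.

Let lnb_ge : 2 <= ln (b%:R : R).
Proof.
have h : ln ((2 : R) ^+ 4) <= ln (b%:R).
  rewrite ler_ln ?posrE ?exprn_gt0 ?ltr0n //; first by rewrite -natrX; apply: le_trans bR; rewrite ler_nat.
  exact: leq_trans b_ge.
by move: h; rewrite ln_exprn //; have := ln2_ge R; lra.
Qed.

(** [b] is the number of tracks and bounds the number of layers, with [Dl ^ H.+1 <= b < Dl ^ H.+2].
    If [Dl ^ 2 > b], then [ln b] is at most [2 * ln Dl] and [t >= 1 / 8] suffices; if [t * ln Dl] is
    already large, there is nothing to prove. *)
Lemma core_bound (md : bool) (t s : R) :
  t = (if md then tq else tu) -> s = (if md then tu else tq) ->
  0 <= s -> 1 / 8 <= t ->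
  c0 * ln (b%:R : R) <= 30 * 108 * (t * ln (2 + s / t)).
Proof.
move=> tE sE s0 t8; have t0 : 0 < t by lra.
set r := s / t; have r0 : 0 <= r by rewrite divr_ge0 // ltW.
have l2r : ln 2 <= ln (2 + r) by rewrite ler_ln ?posrE //; lra.
have lr : 1 / 2 <= ln (2 + r) by apply: le_trans l2r; apply: ln2_ge.
(* [Dl] is at least [r], so one operation of time [s] costs no more than [Dl] operations of time
   [t]. *)
pose D0 := (Num.truncn r).+1; pose Dl := (4 * D0)%N.
have D0_gt0 : (0 < D0)%N by [].
have rD : r <= Dl%:R.
  apply: (@le_trans _ _ D0%:R); last by rewrite ler_nat leq_pmull.
  by apply: ltW; rewrite -truncn_lt_nat.
have DlE : Dl%:R = 4 * D0%:R :> R by rewrite natrM.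
have Dr : Dl%:R <= 4 * (2 + r).
  rewrite DlE; apply: ler_wpM2l => //; rewrite /D0 -natr1.
  have : (Num.truncn r)%:R <= r by rewrite truncn_le.
  by lra.
have Dl_pos : 0 < Dl%:R :> R by rewrite ltr0n.
have lD : ln (Dl%:R : R) <= 3 * ln (2 + r).
  have : ln (Dl%:R : R) <= ln (4 * (2 + r)).
    by rewrite ler_ln ?posrE // mulr_gt0 //; lra.
  rewrite lnM ?posrE //; last by lra.
  have -> : (4 : R) = 2 ^+ 2 by rewrite -natrX.
  rewrite ln_exprn //; move: l2r; set A := ln (2 + r); set B := ln 2; set C := ln _.
  by clearbody A B C; lra.
have lb0 : 0 < ln (b%:R : R) by apply: lt_le_trans lnb_ge.
have cb : 128 * (c0 * ln (b%:R : R)) <= ln (b%:R : R).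
  by rewrite mulrA -[leRHS]mul1r; apply: ler_wpM2r => //; exact: ltW.
have b0 : (0 < b)%N by apply: leq_trans b_ge.
case: (leqP (Dl ^ 2) b) => Db; last first.
  have : ln (b%:R : R) <= 2 * ln (Dl%:R : R).
    rewrite -ln_exprn // ler_ln ?posrE ?exprn_gt0 ?ltr0n // -natrX ler_nat.
    exact: ltnW.
  have : 1 / 8 * ln (2 + r) <= t * ln (2 + r) by apply: ler_wpM2r => //; lra.
  move: cb lD lb0 lr; set A := ln (2 + r); set B := ln Dl%:R; set C := ln b%:R.
  set F := t * A; set F' := c0 * C; clearbody F F' A B C.
  by lra.
have Dl1 : (1 < Dl)%N by rewrite /Dl /D0 mulnS.
set e := trunc_log Dl b.
have e2 : (2 <= e)%N by rewrite /e; apply: trunc_log_max.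
have [elo ehi] : (Dl ^ e <= b)%N /\ (b < Dl ^ e.+1)%N.
  by have /andP[] := trunc_log_bounds Dl1 b0.
pose H := e.-1; have He : e = H.+1 by rewrite /H prednK // (leq_trans _ e2).
have H_gt0 : (0 < H)%N by rewrite -ltnS -He.
rewrite He in elo ehi.
have bk : b = b.-1.+1 by rewrite prednK.
have DH : (Dl ^ H * Dl <= b)%N by rewrite -expnSr.
have usD : (upds D0 md <= Dl)%N by rewrite /upds; case: (md).
have qsD : (qrys D0 md <= Dl)%N by rewrite /qrys; case: (md).
have Mu : (Dl ^ H * upds D0 md <= b)%N by apply: leq_trans DH; rewrite leq_mul2l usD orbT.
have Mq : (Dl ^ H * qrys D0 md <= b)%N by apply: leq_trans DH; rewrite leq_mul2l qsD orbT.
have MM : (Dl ^ H <= b)%N by apply: leq_trans DH; rewrite leq_pmulr.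
have b28 : (2 * (b.+1 * b) + 2 <= n)%N.
  apply: leq_trans b_le; have b3 : (4 * b ^ 2 <= b ^ 8)%N.
    rewrite -[8%N]/(6 + 2)%N expnD leq_mul2r; apply/orP; right.
    by apply: (@leq_trans (b ^ 1)%N); [rewrite expn1 (leq_trans _ b_ge)|rewrite leq_pexp2l].
  apply: leq_trans b3; rewrite -mulnn; move: b_ge; clear; nia.
have nV : (#|vertex (layers D0 H md) b.-1| <= n)%N.
  apply: leq_trans b28; rewrite card_vertex -bk layersE leq_add2r leq_mul2l /=.
  by rewrite leq_mul2r ltnS Mu orbT.
have na : (num_atoms D0 H b.-1 md <= 2 * b ^ 2)%N.
  rewrite /num_atoms -bk mulnAC -mulnn mulnA leq_mul2r; apply/orP; right.
  by rewrite mulnS mul2n -addnn leq_add.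
have no : (num_ops D0 H b.-1 md <= 30 * b ^ 2)%N.
  rewrite /num_ops -bk -[30%N]/(28 + 2)%N mulnDl -mulnn leq_add //.
    by rewrite leq_mul2l leq_mul2r Mu orbT.
  by rewrite mulnCA leq_mul2l mulnAC leq_mul2r Mq orbT.
(* At most [2 * b ^ 3] tests per secret, on sequences of at most [30 * b ^ 2] operations;
   [48 * 60 <= b ^ 3] absorbs the constants. *)
have small_error : 48 * ((num_atoms D0 H b.-1 md)%:R * b.-1.+1%:R *
     ((num_ops D0 H b.-1 md)%:R * delta)) <= 1.
  rewrite -bk; apply: le_trans delta_le.
  apply: (@le_trans _ _ (48 * ((2 * b%:R ^+ 2) * b%:R * ((30 * b%:R ^+ 2) * delta)))).
    apply: ler_wpM2l => //; apply: ler_pM; [by rewrite mulr_ge0|by rewrite mulr_ge0| |].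
      by apply: ler_wpM2r => //; rewrite -natrX -natrM ler_nat.
    by apply: ler_wpM2r => //; rewrite -natrX -natrM ler_nat.
  have -> : 48 * (2 * b%:R ^+ 2 * b%:R * (30 * b%:R ^+ 2 * delta)) =
     b%:R ^+ 5 * delta * (48 * 60) by ring.
  have -> : b%:R ^+ 8 * delta = b%:R ^+ 5 * delta * b%:R ^+ 3 by ring.
  apply: ler_wpM2l; first by rewrite mulr_ge0 // exprn_ge0.
  apply: (@le_trans _ _ (32 ^+ 3)); first by rewrite -natrX -natrM ler_nat.
  by rewrite lerXn2r // nnegrE.
have tut : (upds D0 md)%:R * tu <= Dl%:R * t.
  rewrite /upds; move: tE sE; case: (md) => tE sE; last by rewrite tE.
  rewrite mul1r -sE; apply: (@le_trans _ _ (r * t)); first by rewrite /r divfK // gt_eqF.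
  by apply: ler_wpM2r => //; exact: ltW.
have tqt : (qrys D0 md)%:R * tq <= Dl%:R * t.
  rewrite /qrys; move: tE sE; case: (md) => tE sE; first by rewrite tE.
  rewrite mul1r -sE; apply: (@le_trans _ _ (r * t)); first by rewrite /r divfK // gt_eqF.
  by apply: ler_wpM2r => //; exact: ltW.
have tu0 : 0 <= tu by move: tE sE; case: (md) => tE sE; [rewrite -sE|rewrite -tE ltW].
have tq0 : 0 <= tq by move: tE sE; case: (md) => tE sE; [rewrite -tE ltW|rewrite -sE].
suff key : c0 * ln (b%:R : R) <= 30 * 36 * (t * ln (Dl%:R : R)).
  have : t * ln (Dl%:R : R) <= t * (3 * ln (2 + r)) by apply: ler_wpM2l => //; exact: ltW.
  move: key; rewrite (mulrCA t 3); set A := t * ln (2 + r); set B := t * ln _; set C := c0 * _.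
  by clearbody A B C; lra.
case: (leP (48 * 60 * 48 * (t * ln (Dl%:R : R))) (ln (b%:R : R))) => small_t; last first.
  move: cb small_t; set B := t * ln _; set C := ln _; set F := c0 * C.
  by clearbody F B C; lra.
have kge : (32 <= b.-1.+1)%N by rewrite -bk.
have lk : 2 <= ln (b.-1.+1%:R : R) by rewrite -bk.
have st : 48 * 60 * 48 * (t * ln ((4 * D0)%:R : R)) <= ln (b.-1.+1%:R : R) by rewrite -bk.
have sw : 24 * (c0 * (2 * w%:R + 1)) <= ln (b.-1.+1%:R : R) by rewrite -bk.
have HH : H%:R * c0 <= 360 * t.
  by apply: (@tradeoff R D0 H b.-1 md D0_gt0 n w cls G d T P D tu tq delta t c0).
have lbH : ln (b%:R : R) <= 3 * (H%:R * ln (Dl%:R : R)).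
  apply: (@le_trans _ _ ((H.+2)%:R * ln (Dl%:R : R))).
    rewrite -ln_exprn // ler_ln ?posrE ?exprn_gt0 ?ltr0n // -natrX ler_nat.
    exact: ltnW.
  rewrite mulrA; apply: ler_wpM2r; first by apply: ln_ge0; rewrite ler1n.
  rewrite -natrM ler_nat; move: H_gt0; clear; lia.
have lD0 : 0 <= ln (Dl%:R : R) by apply: ln_ge0; rewrite ler1n.
have h1 := ler_wpM2r lD0 HH.
have h2 : c0 * ln (b%:R : R) <= c0 * (3 * (H%:R * ln (Dl%:R : R))) by apply: ler_wpM2l => //; exact: ltW.
have e3 : c0 * (3 * (H%:R * ln (Dl%:R : R))) = 3 * (H%:R * c0 * ln (Dl%:R : R)) by ring.
rewrite e3 in h2; move: h1 h2; rewrite -[360 * t * _]mulrA.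
set A := H%:R * c0 * _; set B := t * _; set C := c0 * _; clearbody A B C; lra.
Qed.

End Core.

Theorem theorem1 (R : realType) (K eps : R) (eps_gt0 : 0 < eps) :
  exists2 c : R, 0 < c &
  exists n0 : nat, forall (n w : nat), (n0 <= n)%N ->
    w%:R <= K * log2 (n%:R : R) ->
  forall (cls : graph_class) (G : finType)
    (d : measure_display) (T : measurableType d) (P : probability T R)
    (D : T -> data_structure n w G) (tu tq tR tD : R),
    correct_with_error cls P D (n%:R `^ (- eps)) ->
    amortized_time cls P D tu tq ->
    amortized_recoloring cls P D tR ->
    tD = tu - tR ->
    [/\ c * log2 n%:R <= tq * lg (tu / tq),
        c * log2 n%:R <= tu * lg (tq / tu)
      & c * log2 n%:R <= Num.max tD (Num.max tR tq)].
Proof.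
(* [b] will be [n ^ e1] rounded down. Then [b ^ 8 <= n ^ m], which is at most [n], for the vertices,
   and at most [n ^ eps], for the error. *)
pose m := Num.min eps 1; pose e1 := m / 8.
have m0 : 0 < m by rewrite lt_min eps_gt0 ltr01.
have m1 : m <= 1 by rewrite ge_min lexx orbT.
have me : m <= eps by rewrite ge_min lexx.
have e10 : 0 < e1 by rewrite divr_gt0.
have e11 : e1 <= 1 / 8 by rewrite /e1; move: m1; lra.
have e1m : e1 * 8 = m by rewrite /e1 divfK.
clearbody e1.
have K0 : 0 <= `|K| by [].
have q0 : 0 < 48 * (4 * `|K| + 1) by move: K0; lra.
(* Chosen for [small_w]: with [L = ln n], a word has at most [2 * |K| * L] bits, while
   [ln b >= e1 * L / 2]. *)
pose c0 := e1 / (48 * (4 * `|K| + 1)).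
have c00 : 0 < c0 by rewrite divr_gt0.
have c0E : c0 * (48 * (4 * `|K| + 1)) = e1 by rewrite divfK // gt_eqF.
clearbody c0.
have c0K : 0 <= c0 * `|K| by rewrite mulr_ge0 // ltW.
have c0e : c0 * (48 * (4 * `|K| + 1)) = 192 * (c0 * `|K|) + 48 * c0 by ring.
have c0_le : 128 * c0 <= 1 by move: c0K c0E c0e e11; set A := c0 * `|K|; lra.
(* [2] comes from [ln b >= e1 * L / 2] and [30 * 108] from [core_bound]; [6] serves the third bound,
   with three terms under the maximum and [log2 n <= 2 * L]. *)
pose c := c0 * e1 / (2 * (30 * 108) * 6).
have c_gt0 : 0 < c by rewrite divr_gt0 ?mulr_gt0.
have cE : c0 * e1 = c * (2 * (30 * 108) * 6) by rewrite divfK // gt_eqF ?mulr_gt0.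
clearbody c.
exists c => //.
have l64 : ln (64 : R) = 6 * ln 2.
  by have -> : (64 : R) = 2 ^+ 6; [rewrite -natrX|rewrite ln_exprn].
(* Beyond this threshold [n ^ e1 >= 64], so rounding down gives [b >= 32] and loses at most half. *)
exists (Num.truncn (expR (ln 64 / e1))).+1 => n w nn0 wK cls G d T P D tu tq tR tD cor amo _ tDE.
have n0 : (0 < n)%N by apply: leq_trans nn0.
have nR : 0 < n%:R :> R by rewrite ltr0n.
pose L := ln (n%:R : R).
have L64 : 6 * ln 2 <= e1 * L.
  rewrite -l64 mulrC -ler_pdivrMr // -ler_expR lnK ?posrE //.
  apply: ltW; rewrite -truncn_lt_nat ?expR_ge0 //.
have l2 := ln2_ge R; have l2' := ln2_le1 R.
have L0 : 0 <= L by apply: ln_ge0; rewrite ler1n.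
have L1 : 1 <= L.
  have : e1 * L <= 1 * L by apply: ler_wpM2r => //; lra.
  by move: L64; set A := e1 * L; lra.
pose a := n%:R `^ e1.
have a0 : 0 < a by rewrite powR_gt0.
have lna : ln a = e1 * L by rewrite /a ln_powR.
have a64 : 64 <= a by rewrite -ler_ln ?posrE // lna l64.
pose b := Num.truncn a.
have b_ge : (32 <= b)%N.
  by rewrite /b truncn_ge_nat ?(ltW a0) //; apply: le_trans a64; rewrite ler_nat.
have ba : b%:R <= a by rewrite truncn_le ltW.
have ab : a < b%:R + 1 by rewrite natr1 -truncn_lt_nat ?ltnS // ltW.
have bR : 32 <= b%:R :> R by rewrite ler_nat.
have b0 : 0 < b%:R :> R by apply: lt_le_trans bR.
have lnb : e1 * L / 2 <= ln (b%:R : R).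
  have : ln a <= ln (2 * b%:R) by rewrite ler_ln ?posrE ?mulr_gt0 //; move: ab bR; lra.
  rewrite lnM ?posrE // lna; move: L64; set A := e1 * L; set B := ln 2; set C := ln _.
  by move: l2; rewrite -/B; clearbody A B C; lra.
have n1 : 1 <= n%:R :> R by rewrite ler1n.
have b8 : b%:R ^+ 8 <= n%:R `^ m.
  apply: (@le_trans _ _ (a ^+ 8)); first by rewrite lerXn2r ?nnegrE // ltW.
  by rewrite -powR_mulrn ?(ltW a0) // /a -powRrM e1m.
have b_le : (b ^ 8 <= n)%N.
  rewrite -(ler_nat R) natrX; apply: le_trans b8 _.
  by rewrite -[leRHS]powRr1 // ler_powR.
pose delta := n%:R `^ (- eps).
have delta_ge0 : 0 <= delta by apply: powR_ge0.
have pe : 0 < n%:R `^ eps by apply: powR_gt0.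
have delta_le : b%:R ^+ 8 * delta <= 1.
  rewrite /delta powRN ler_pdivrMr // mul1r; apply: le_trans b8 _.
  by rewrite ler_powR.
have b32 : 32 <= b%:R ^+ 8 :> R.
  have b1 : 1 <= b%:R :> R by rewrite (le_trans _ bR) // ler1n.
  by apply: (le_trans bR); rewrite exprS ler_peMr ?(ltW b0) // exprn_ege1.
have delta32 : 32 * delta <= 1.
  by apply: le_trans delta_le; apply: ler_wpM2r.
have n3 : (3 <= n)%N.
  by rewrite -(ler_nat R) (le_trans _ (_ : b%:R ^+ 8 <= _)) ?(le_trans _ b32) ?ler_nat // -natrX ler_nat.
have small_w : 24 * (c0 * (2 * w%:R + 1)) <= ln (b%:R : R).
  apply: le_trans lnb; rewrite -c0E.
  have h : w%:R <= `|K| * (2 * L).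
    apply: (le_trans wK); apply: (@le_trans _ _ (`|K| * log2 n%:R)).
      by apply: ler_wpM2r; [rewrite divr_ge0 // (le_trans _ l2)|apply: ler_norm].
    apply: ler_wpM2l => //; rewrite /log2 ler_pdivrMr; last by apply: lt_le_trans l2.
    rewrite -/L; have : L * (1 / 2) <= L * ln 2 by apply: ler_wpM2l.
    by rewrite -[2 * L * _]mulrA; set A := L * ln 2; clearbody A; lra.
  have h2 : c0 * (2 * w%:R + 1) <= c0 * ((4 * `|K| + 1) * L).
    apply: ler_wpM2l; first exact: ltW.
    have -> : (4 * `|K| + 1) * L = 2 * (`|K| * (2 * L)) + L by ring.
    by move: h L1; set A := `|K| * _; lra.
  have -> : c0 * (48 * (4 * `|K| + 1)) * L / 2 = 24 * (c0 * ((4 * `|K| + 1) * L)) by field.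
  by apply: ler_wpM2l.
have tq8 : 1 / 8 <= tq by apply: (query_time_ge n3 cor amo delta_ge0 delta32).
have tu8 : 1 / 8 <= tu by apply: (update_time_ge n3 cor amo delta_ge0 delta32).
have ln2_0 : 0 < ln (2 : R) by apply: lt_le_trans l2.
have fin F : c0 * ln (b%:R : R) <= 30 * 108 * F -> 6 * (c * L) <= F.
  have : c0 * (e1 * L / 2) <= c0 * ln (b%:R : R) by apply: ler_wpM2l => //; exact: ltW.
  have -> : c0 * (e1 * L / 2) = c0 * e1 * L / 2 by ring.
  rewrite cE; have -> : c * (2 * (30 * 108) * 6) * L / 2 = (30 * 108) * (6 * (c * L)) by field.
  set A := 6 * (c * L); set B := c0 * ln _; clearbody A B; lra.
have tq0 : 0 <= tq by lra.
have tu0 : 0 <= tu by lra.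
have BA : 6 * (c * L) <= tq * ln (2 + tu / tq).
  apply: fin.
  exact: (@core_bound R n w b cls G d T P D tu tq delta c0 cor amo b_ge b_le delta_ge0
    delta_le c00 c0_le small_w true tq tu erefl erefl tu0 tq8).
have BB : 6 * (c * L) <= tu * ln (2 + tq / tu).
  apply: fin.
  exact: (@core_bound R n w b cls G d T P D tu tq delta c0 cor amo b_ge b_le delta_ge0
    delta_le c00 c0_le small_w false tu tq erefl erefl tq0 tu8).
have cL0 : 0 <= c * L by rewrite mulr_ge0 // ltW.
have out F x : 6 * (c * L) <= F * ln (2 + x) -> c * log2 n%:R <= F * lg x.
  move=> h; rewrite /lg /log2 !mulrA ler_pM2r ?invr_gt0 // -/L.
  by move: h cL0; set A := c * L; set B := F * _; clearbody A B; lra.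
split; [exact: out|exact: out|].
set M := Num.max _ _.
have MD : tD <= M by rewrite le_max lexx.
have MR : tR <= M by rewrite !le_max lexx orbT.
have MQ : tq <= M by rewrite !le_max lexx !orbT.
have tq_pos : 0 < tq by lra.
(* By [ln x <= x - 1]. The right side equals [tq + tD + tR], which is at most [3 * M]. *)
have : tq * ln (2 + tu / tq) <= tq + tu.
  apply: (@le_trans _ _ (tq * (1 + tu / tq))).
    apply: ler_wpM2l => //.
    have r0 : 0 <= tu / tq by rewrite divr_ge0.
    have p2 : 0 < 2 + tu / tq by lra.
    by have := le_ln_sub1 p2; lra.
  by rewrite mulrDr mulr1 mulrCA divff ?mulr1 // gt_eqF.
move=> h; have h3 : 2 * (c * L) <= M by move: BA h; set A := c * L; set B := tq * _; lra.
apply: le_trans h3; rewrite /log2 mulrA ler_pdivrMr // -/L.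
have : c * L * (1 / 2) <= c * L * ln 2 by apply: ler_wpM2l.
by rewrite -[2 * _ * _]mulrA; set A := c * L; set B := A * ln 2; clearbody A B; lra.
Qed.
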